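(* Let $b\in(0,3)$ and let $u\in C([0,\infty);H^2(\mathbb{R}))$ be a global solution of the $b$-family equation $$\partial_t u+\partial_x\left(\tfrac12 u^2+G\left(\tfrac b2u^2+\tfrac{3-b}{2}(\partial_xu)^2\right)\right)=0 .$$ Put $m=u-\partial_x^2u$ and $m_0(x)=m(0,x)$, and suppose $m_0\in L^1(\mathbb{R})$. (1) If $m_0\ge0$, then there exists $\sigma>0$ such that for every $1\le p\le\infty$ $$\lim_{t\to\infty}\|u(t)\|_{W^{1,p}((\sigma t,\infty))}=0 .$$ (2) If $m_0\le 0$, then there exists $\sigma>0$ such that for every $1\le p\le\infty$ $$\lim_{t\to\infty}\|u(t)\|_{W^{1,p}((-\infty,-\sigma t))}=0 .$$
   Context: $G=(1-\partial_x^2)^{-1}$, i.e. $Gf=\frac12 e^{-|x|}*f$ on $\mathbb{R}$. The equation is posed for $x\in\mathbb{R}$, $t\ge 0$; in terms of $m=u-\partial_x^2u$ it reads $\partial_t m+u\,\partial_xm+b\,m\,\partial_xu=0$. *)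

(* Defs.v *)
From HB Require Import structures.
From mathcomp Require Import all_boot all_order all_algebra.
From mathcomp Require Import all_classical all_reals all_analysis.

Set Implicit Arguments.
Unset Strict Implicit.
Unset Printing Implicit Defensive.

Import Order.TTheory GRing.Theory Num.Theory.
Import numFieldNormedType.Exports.

Local Open Scope classical_set_scope.
Local Open Scope ring_scope.

(* For finite-dimensional V, a function is of class C^n iff it is continuous
   and all its directional derivatives exist and are of class C^(n-1). *)
Fixpoint class_C (R : realType) (V : normedModType R) (n : nat)
    (phi : V -> R^o) : Prop :=
  continuous phi /\
  (if n is k.+1 then
     forall v : V, (forall p : V, derivable phi p v) /\ class_C k ('D_v phi)
   else True).

Definition smooth (R : realType) (V : normedModType R) (phi : V -> R^o) : Prop :=
  forall n : nat, class_C n phi.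

(* The space C_c^oo(U) of test functions on an open set U. *)
Definition test_function (R : realType) (V : normedModType R) (U : set V)
    (phi : V -> R^o) : Prop :=
  [/\ smooth phi,
      compact (closure [set p | phi p != 0]) &
      closure [set p | phi p != 0] `<=` U].

(* g is the distributional derivative of f on the real line. *)
Definition weak_derivative (R : realType) (f g : R -> R) : Prop :=
  forall phi : R^o -> R^o, test_function setT phi ->
    (\int[@lebesgue_measure R]_x (f x * derive1 phi x)
     = - \int[@lebesgue_measure R]_x (g x * phi x)).

(* f belongs to H^2(R), with first and second weak derivatives f1 and f2. *)
Definition H2_function (R : realType) (f f1 f2 : R -> R) : Prop :=
  [/\ [/\ f \in Lfun (@lebesgue_measure R) 2%:E,
          f1 \in Lfun (@lebesgue_measure R) 2%:E &
          f2 \in Lfun (@lebesgue_measure R) 2%:E],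
      weak_derivative f f1 & weak_derivative f1 f2].

Definition Lp_norm_on (R : realType) (p : \bar R) (D : set R) (f : R -> R) :
    \bar R :=
  'N[@lebesgue_measure R]_p[EFin \o (f \_ D)].

Definition H2_norm (R : realType) (f f1 f2 : R -> R) : \bar R :=
  (Lp_norm_on 2%:E setT f + Lp_norm_on 2%:E setT f1
   + Lp_norm_on 2%:E setT f2)%E.

Definition W1p_norm_on (R : realType) (p : \bar R) (D : set R) (f f1 : R -> R) :
    \bar R :=
  (Lp_norm_on p D f + Lp_norm_on p D f1)%E.

(* u belongs to C([0,oo); H^2(R)), where ux t and uxx t are representatives of
   the first two weak x-derivatives of u t.  Values at t < 0 are irrelevant. *)
Definition continuous_H2_path (R : realType) (u ux uxx : R -> R -> R) : Prop :=
  (forall t : R, 0 <= t -> H2_function (u t) (ux t) (uxx t)) /\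
  (forall t0 : R, 0 <= t0 ->
     H2_norm (u t \- u t0) (ux t \- ux t0) (uxx t \- uxx t0)
       @[t --> within [set t : R | 0 <= t] (nbhs t0)] --> 0%E).

(* G f = (1/2) exp(-|x|) * f, the inverse of 1 - d_x^2. *)
Definition Gconv (R : realType) (f : R -> R) (x : R) : R :=
  2^-1 * \int[@lebesgue_measure R]_y (expR (- `|x - y|) * f y).

Definition b_flux (R : realType) (b : R) (f f1 : R -> R) (x : R) : R :=
  2^-1 * f x ^+ 2
  + Gconv (fun y => b / 2 * f y ^+ 2 + (3 - b) / 2 * f1 y ^+ 2) x.

(* u_t + (b_flux)_x = 0 in the sense of distributions on (0,oo) x R.  The
   integral is iterated because only t |-> u t is regular: the representatives
   u t, for t varying, need not be jointly measurable. *)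
Definition b_family_solution (R : realType) (b : R) (u ux : R -> R -> R) : Prop :=
  forall phi : R^o * R^o -> R^o,
    test_function ([set p | 0 < p.1] : set (R^o * R^o)%type) phi ->
    \int[@lebesgue_measure R]_(t in `]0, +oo[)
      \int[@lebesgue_measure R]_x
        (u t x * 'D_((1, 0) : R^o * R^o) phi (t, x)
         + b_flux b (u t) (ux t) x * 'D_((0, 1) : R^o * R^o) phi (t, x)) = 0.

Definition momentum (R : realType) (f f2 : R -> R) : R -> R :=
  fun x => f x - f2 x.

(* Main.v *)
(* A potential [W] of [u] is chosen with [W_t + u ^ 2 / 2 + P = 0], where
   [P = G (b / 2 u ^ 2 + (3 - b) / 2 u_x ^ 2)], so that [W - u_x] is a primitive
   of the momentum.  Backward characteristics [q' = u (t, q)] and a Gronwall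
   estimate for the increment of [W - u_x] between two of them show that the sign
   of [m] persists; this works although [m] is only in [L^2].  If [m >= 0] then
   [|u_x| <= u], the mass [int u] stays at most
   [A = |m_0|_1 + 2 sup |u_x (0, .)|], and [|u_x| <= u] also gives [P <= 3 A u]:
   the flux [u ^ 2 / 2 + P] is at most [4 A u].  Hence the mass to the right of
   [x + 4 A t] at time [t] is at most the mass to the right of [x] at time [0].
   With [sigma = 4 A + 1] the mass on [(sigma t, +oo)] therefore tends to [0]; it
   bounds [u], whence every [L^p] norm.  The case [m <= 0] is the image of this
   one under [(x, u) -> (- x, - u)]. *)
Require Import Defs.
From HB Require Import structures.
From mathcomp Require Import all_boot all_order all_algebra.
From mathcomp Require Import all_classical all_reals all_analysis.
From mathcomp Require Import measurable_realfun ess_sup_inf ring lra.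

Set Implicit Arguments.
Unset Strict Implicit.
Unset Printing Implicit Defensive.

Import Order.TTheory GRing.Theory Num.Theory.
Import numFieldNormedType.Exports.

Local Open Scope classical_set_scope.
Local Open Scope ring_scope.

(** The equation holds only in the sense of distributions, so nothing can be differentiated in time
    at the start. Testing with products of cutoffs and shrinking their widths gives the conservation
    law on rectangles; it makes an antiderivative of [U 0], minus the time integral of the flux,
    differentiable in [x] with derivative [U t]. That is the potential, and [U_t] is its mixed
    derivative. Along a characteristic [W - V] has derivative [(1 - b) / 2 * (U ^ 2 - V ^ 2)]: the
    nonlocal term cancels. For two characteristics at distance [d], the increment [N] satisfies a
    linear equation whose remainder has no term of order [d], so [N >= - o(d)]; Dini's criterion
    turns this into monotonicity without any pointwise momentum. The convolution is handled through
    [P - P'' = g], and the factorization of [1 - (d / dx) ^ 2] into first-order operators reduces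
    comparison to integrating factors. With [0 < b < 3] both coefficients of [g] are positive, so
    the flux is nonnegative. The speed exceeds [4 A] so that rays traced back to time [0] start ever
    farther to the right. *)

(** * Difference quotients, monotonicity criteria and first-order comparison *)

Lemma is_deriveP (R : realType) (f : R -> R) (x d : R) :
  is_derive x 1 f d <->
  forall e : R, 0 < e -> exists2 dl : R, 0 < dl &
    forall y, `|y - x| < dl -> `|f y - f x - d * (y - x)| <= e * `|y - x|.
Proof.
split=> [[fx fd]|H].
- move=> e e0.
  have /cvgrPdist_le /(_ e e0) : h^-1 *: (f (h *: 1 + x) - f x) @[h --> 0^'] --> d.
    by rewrite -fd; exact: fx.
  move=> /nbhs_ballP[dl /= dl0 Hdl]; exists dl => // y yx.
  have [->|neq] := eqVneq y x; first by rewrite !subrr mulr0 subr0 normr0 mulr0.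
  have yx0 : y - x != 0 by rewrite subr_eq0.
  have := Hdl (y - x); rewrite /ball /= sub0r normrN => /(_ yx yx0).
  rewrite /GRing.scale /= mulr1 subrK => Hy.
  rewrite -normrN (_ : - (f y - f x - d * (y - x)) = (d - (y - x)^-1 * (f y - f x)) * (y - x)).
    by rewrite normrM ler_wpM2r.
  by field.
- have cv : h^-1 *: (f (h *: 1 + x) - f x) @[h --> 0^'] --> d.
    apply/cvgrPdist_le => e e0; have [dl dl0 Hdl] := H e e0.
    apply/nbhs_ballP; exists dl => //= h /=; rewrite /ball /= sub0r normrN => hd h0.
    have := Hdl (x + h); rewrite (addrC x h) addrK => /(_ hd) Hh.
    rewrite /GRing.scale /= mulr1.
    rewrite -(ler_pM2r (x := `|h|)) ?normr_gt0// -normrM.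
    rewrite -normrN (_ : - ((d - h^-1 * (f (h + x) - f x)) * h) = f (h + x) - f x - d * h)//.
    by field.
  split; first by apply/cvg_ex; exists d.
  by apply/cvg_lim.
Qed.

Lemma is_derive_continuous (R : realType) (f : R -> R) (x d : R) :
  is_derive x 1 f d -> {for x, continuous f}.
Proof. by move=> [h _]; apply/differentiable_continuous/derivable1_diffP. Qed.

Lemma continuousP_eps (R : realType) (f : R -> R) (x : R) :
  {for x, continuous f} <->
  forall e : R, 0 < e -> exists2 dl : R, 0 < dl &
    forall y, `|y - x| < dl -> `|f y - f x| <= e.
Proof.
split=> [/cvgrPdist_le H e e0|H].
  have /nbhs_ballP[dl /= dl0 Hdl] := H e e0; exists dl => // y yx.
  by rewrite distrC; apply: Hdl; rewrite /ball /= distrC.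
apply/cvgrPdist_le => e e0; have [dl dl0 Hdl] := H e e0.
apply/nbhs_ballP; exists dl => //= y; rewrite /ball /= distrC => yx.
by rewrite distrC; apply: Hdl.
Qed.

Lemma within_continuousP_eps (R : realType) (f : R -> R) (a b : R) :
  {within `[a, b], continuous f} <->
  forall x, a <= x <= b -> forall e : R, 0 < e -> exists2 dl : R, 0 < dl &
    forall y, a <= y <= b -> `|y - x| < dl -> `|f y - f x| <= e.
Proof.
split=> [H x xab e e0|H].
  have xab' : `[a, b]%classic x by rewrite /= in_itv.
  have /(@subspace_continuousP _ `[a, b]%classic _ f) := H.
  move=> /(_ x xab') /cvgrPdist_le /(_ e e0).
  move=> /nbhs_ballP[dl /= dl0 Hdl]; exists dl => // y yab yx.
  by rewrite distrC; apply: Hdl; rewrite /ball /= ?in_itv// distrC.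
apply/(@subspace_continuousP _ `[a, b]%classic _ f) => x /=; rewrite in_itv /= => xab.
apply/cvgrPdist_le => e e0; have [dl dl0 Hdl] := H x xab e e0.
apply/nbhs_ballP; exists dl => //= y; rewrite /ball /= distrC in_itv /= => yx yab.
by rewrite distrC; apply: Hdl.
Qed.

(** Distances to both ends locate the intermediate point without presupposing [x <= y]; later uses
    concern time and space increments of unknown sign. *)
Lemma mvt_unordered (R : realType) (f df : R -> R) (x y : R) :
  (forall z : R, `|z - x| <= `|y - x| -> `|z - y| <= `|y - x| -> is_derive z 1 f (df z)) ->
  exists c, [/\ `|c - x| <= `|y - x|, `|c - y| <= `|y - x| &
    f y - f x = df c * (y - x)].
Proof.
move=> fd.
wlog xy : x y fd / x <= y.
  move=> H; have [xy|/ltW yx] := leP x y; first exact: H.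
  have [|c [c1 c2 c3]] := H y x _ yx.
    by move=> z zy zx; apply: fd; rewrite (distrC y x).
  exists c; rewrite (distrC y x); split => //.
  by rewrite -opprB c3 -mulrN opprB.
have fd' z : z \in `[x, y] -> is_derive z 1 f (df z).
  rewrite in_itv /= => /andP[xz zy]; apply: fd.
    by rewrite !ger0_norm ?subr_ge0// lerD2r.
  by rewrite distrC !ger0_norm ?subr_ge0// lerD2l lerN2.
have fc : {within `[x, y], continuous f}.
  by apply: derivable_within_continuous => z /fd' [].
have fd'' z : z \in `]x, y[ -> is_derive z 1 f (df z).
  by move=> zxy; apply: fd'; apply: subset_itv_oo_cc zxy.
have [c] := @MVT_segment R f df x y xy fd'' fc.
rewrite in_itv /= => /andP[xc cy] E; exists c; split => //.
  by rewrite !ger0_norm ?subr_ge0// lerD2r.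
by rewrite distrC !ger0_norm ?subr_ge0// lerD2l lerN2.
Qed.

Lemma derive_ge0_le (R : realType) (f df : R -> R) (a b : R) :
  a <= b ->
  (forall x : R, a < x < b -> is_derive x 1 f (df x)) ->
  (forall x, a < x < b -> 0 <= df x) ->
  {within `[a, b], continuous f} -> f a <= f b.
Proof.
rewrite le_eqVlt => /predU1P[->//|ab] fd df0 fc.
have fd' z : z \in `]a, b[ -> is_derive z 1 f (df z) by rewrite in_itv /= => /fd.
have [c] := @MVT R f df a b ab fd' fc.
rewrite in_itv /= => /df0 H E.
by rewrite -subr_ge0 E mulr_ge0// subr_ge0 ltW.
Qed.

Lemma derive_ge0_homo (R : realType) (f df : R -> R) :
  (forall x : R, is_derive x 1 f (df x)) -> (forall x, 0 <= df x) ->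
  {homo f : x y / x <= y}.
Proof.
move=> fd df0 x y xy; apply: (@derive_ge0_le _ f df) => //.
by apply: continuous_subspaceT => z; exact: is_derive_continuous (fd z).
Qed.

Lemma derive_bound_lip (R : realType) (f df : R -> R) (K x y : R) :
  (forall z : R, is_derive z 1 f (df z)) -> (forall z, `|df z| <= K) ->
  `|f y - f x| <= K * `|y - x|.
Proof.
move=> fd dfK; have [c [_ _ ->]] := mvt_unordered (fun z (_ : `|z - x| <= `|y - x|)
  (_ : `|z - y| <= `|y - x|) => fd z).
by rewrite normrM ler_wpM2r.
Qed.

(** Dini's criterion from the left. The functions it serves, built from [W - V] and from
    [expR (- z) * (u + v)], are not known to be differentiable, but their left increments admit a
    one-sided estimate with arbitrarily small slope [eta]. *)
Lemma dini_nonincreasing (R : realType) (g : R -> R) (a b : R) :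
  a <= b -> {within `[a, b], continuous g} ->
  (forall eta, 0 < eta -> forall t, a < t <= b -> exists2 dl : R, 0 < dl &
     forall s, a <= s < t -> t - dl < s -> g t - g s <= eta * (t - s)) ->
  g b <= g a.
Proof.
move=> ab /within_continuousP_eps gc gd; apply/ler_addgt0Pr => e e0.
pose eta := e / (b - a + 1).
have ba1 : 0 < b - a + 1 by rewrite ltr_wpDl// subr_ge0.
have eta0 : 0 < eta by rewrite divr_gt0.
pose k s := g s - eta * s.
(* [inf S] lies in [S] by continuity; were it larger than [a], the left estimate there would produce
   an element of [S] below it. So [inf S = a], and the tilt by [eta] costs at most [e]. *)
pose S := [set s | a <= s <= b /\ k b <= k s].
have Sb : S b by split=> //; rewrite ab lexx.
have Slb : lbound S a by move=> s [/andP[]].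
have Sinf : has_inf S by split; [exists b|exists a].
have iS : forall s, S s -> inf S <= s by move=> s Ss; apply: ge_inf => //; exists a.
have ai : a <= inf S by apply: lb_le_inf => //; exists b.
have ib : inf S <= b by exact: iS.
have Si : k b <= k (inf S).
  apply/ler_addgt0Pr => d d0.
  have d2 : 0 < d / 2 by rewrite divr_gt0.
  have iab : a <= inf S <= b by rewrite ai ib.
  have [dl dl0 Hdl] := gc _ iab _ d2.
  pose dl' := Num.min dl (d / (2 * eta)).
  have dl'0 : 0 < dl' by rewrite lt_min dl0 divr_gt0// mulr_gt0.
  have [s Ss sd] := inf_adherent dl'0 Sinf.
  have is_ := iS _ Ss; case: Ss => sab kbs.
  have sd1 : s - inf S < dl by rewrite ltrBlDl (lt_le_trans sd)// lerD2l ge_min lexx.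
  have sd2 : s - inf S < d / (2 * eta).
    by rewrite ltrBlDl (lt_le_trans sd)// lerD2l ge_min lexx orbT.
  have := Hdl s sab; rewrite ger0_norm ?subr_ge0// => /(_ sd1).
  rewrite ler_norml => /andP[_ H].
  apply: (le_trans kbs); rewrite /k.
  have : eta * (s - inf S) >= 0 by rewrite mulr_ge0 ?subr_ge0// ltW.
  lra.
suff iE : inf S = a.
  move: Si; rewrite iE /k => Si.
  have : eta * (b - a) <= e.
    by rewrite /eta mulrAC ler_pdivrMr// ler_pM2l// lerDl.
  lra.
apply/eqP; rewrite eq_le ai andbT leNgt; apply/negP => ai'.
have [dl dl0 Hdl] := gd _ eta0 (inf S) (introT andP (conj ai' ib)).
pose s := Num.max a (inf S - dl / 2).
have si : s < inf S by rewrite gt_max ai' /=; lra.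
have sa : a <= s by rewrite le_max lexx.
have sd : inf S - dl < s by rewrite lt_max; apply/orP; right; lra.
have := Hdl s; rewrite sa si => /(_ erefl sd) H.
suff : inf S <= s by rewrite leNgt si.
apply: iS; split; first by rewrite sa/= (le_trans (ltW si)).
by apply: (le_trans Si); rewrite /k; lra.
Qed.

Lemma is_derive_curve (R : realType) (f ft : R -> R -> R) (q : R -> R) (t dx dq r : R) :
  0 < r ->
  (forall s x : R, `|s - t| < r -> is_derive s 1 (f^~ x) (ft s x)) ->
  (forall e, 0 < e -> exists2 dl : R, 0 < dl & forall s x,
     `|s - t| < dl -> `|x - q t| < dl -> `|ft s x - ft t (q t)| <= e) ->
  is_derive (q t) 1 (f t) dx -> is_derive t 1 q dq ->
  is_derive t 1 (fun s => f s (q s)) (ft t (q t) + dx * dq).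
Proof.
move=> r0 fd ftc fx qd.
have fq : is_derive t 1 (f t \o q) (dx * dq) by exact: is_derive1_comp.
apply/is_deriveP => e e0; have e2 : 0 < e / 2 by rewrite divr_gt0.
have /is_deriveP/(_ _ e2)[d1 d10 H1] := fq.
have [d2 d20 H2] := ftc _ e2.
have /is_derive_continuous/continuousP_eps/(_ (d2 / 2)) := qd.
rewrite divr_gt0// => /(_ erefl)[d3 d30 H3].
exists (Num.min r (Num.min d1 (Num.min d2 d3))).
  by rewrite !lt_min r0 d10 d20 d30.
move=> s; rewrite !lt_min => /and4P[s0 s1 s2 s3].
have [|c [ct cs E]] := @mvt_unordered _ (f^~ (q s)) (ft^~ (q s)) t s.
  by move=> z zt _; apply: fd; exact: le_lt_trans zt s0.
have cd := le_lt_trans ct s2.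
have qs : `|q s - q t| < d2 by rewrite (le_lt_trans (H3 _ s3))//; lra.
have := H1 s s1; rewrite /= => {}H1; have {}H2 := H2 c (q s) cd qs.
rewrite (_ : _ - _ - _ = (ft c (q s) - ft t (q t)) * (s - t) +
   (f t (q s) - f t (q t) - dx * dq * (s - t))); last first.
  by move: E => /= E; rewrite mulrBl -E; ring.
rewrite (le_trans (ler_normD _ _))// normrM.
have := ler_wpM2r (normr_ge0 (s - t)) H2; lra.
Qed.

(** Compactness of [[0, T]] as a supremum argument: [L] may be enlarged, so local bounds merge into
    one that holds at all times. *)
Lemma segment_uniform (R : realType) (T : R) (A : R -> R -> Prop) :
  (forall t L L', L <= L' -> A t L -> A t L') ->
  (forall t0, 0 <= t0 <= T -> exists2 dl : R, 0 < dl &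
     exists L, forall t, 0 <= t <= T -> `|t - t0| < dl -> A t L) ->
  exists L, forall t, 0 <= t <= T -> A t L.
Proof.
move=> Amon Aloc; have [T0|T0] := ltP T 0.
  by exists 0 => t /andP[a b]; have := le_lt_trans (le_trans a b) T0; rewrite ltxx.
pose S := [set s | 0 <= s <= T /\ exists L, forall t, 0 <= t <= s -> A t L].
have S0 : S 0.
  split; first by rewrite lexx.
  have [|dl dl0 [L HL]] := Aloc 0; first by rewrite lexx.
  exists L => t /andP[t0 t0']; apply: HL; first by rewrite t0 (le_trans t0').
  by rewrite subr0 ger0_norm// (le_lt_trans t0').
have SubS : ubound S T by move=> s [/andP[]].
have hS : has_sup S by split; [exists 0|exists T].
have sS : forall s, S s -> s <= sup S by move=> s Ss; apply: ub_le_sup => //; exists T.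
have s0 : 0 <= sup S by exact: sS.
have sT : sup S <= T by apply: ge_sup => //; exists 0.
have [|dl dl0 [L HL]] := Aloc (sup S); first by rewrite s0 sT.
have [s [/andP[s0' sT'] [L' HL']] sd] := sup_adherent dl0 hS.
have ssup : s <= sup S by apply: sS; split; [rewrite s0' sT'|exists L'].
have key u : sup S <= u -> u <= T -> u < sup S + dl -> S u.
  move=> su uT ud; split; first by rewrite (le_trans s0 su).
  exists (Num.max L L') => t /andP[t0 tu]; have [ts|st] := leP t s.
    by apply: Amon (HL' t _); rewrite ?le_max ?lexx ?orbT ?t0.
  apply: Amon (HL t _ _); first by rewrite le_max lexx.
    by rewrite t0 (le_trans tu).
  by rewrite ltr_norml; apply/andP; split; lra.
have sTE : sup S = T.
  apply/eqP; rewrite eq_le sT leNgt; apply/negP => sltT.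
  pose u := Num.min T (sup S + dl / 2).
  have su : sup S < u by rewrite lt_min sltT /=; lra.
  have uT : u <= T by rewrite ge_min lexx.
  have ud : u < sup S + dl by rewrite gt_min; apply/orP; right; lra.
  by have := sS _ (key u (ltW su) uT ud); rewrite leNgt su.
have [_ [L2 HL2]] : S T by apply: key; rewrite ?sTE// ltrDl.
by exists L2.
Qed.

Lemma supersol_le (R : realType) (H dH : R -> R) (x y : R) :
  x <= y -> (forall z : R, x <= z <= y -> is_derive z 1 H (dH z)) ->
  (forall z, x <= z <= y -> H z <= dH z) -> H x <= expR (x - y) * H y.
Proof.
move=> xy Hd HdH.
pose k z := expR (- z) * H z.
have kd z : x <= z <= y -> is_derive z 1 k (expR (- z) * (dH z - H z)).
  move=> zxy; have := Hd z zxy => Hz.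
  have -> : expR (- z) * (dH z - H z) = expR (- z) *: dH z + H z *: (expR (- z) *: (- 1)).
    by rewrite /GRing.scale /=; ring.
  exact: is_deriveM.
have : k x <= k y.
  apply: (derive_ge0_le (df := fun z => expR (- z) * (dH z - H z))) => //.
  - by move=> z /andP[xz zy]; apply: kd; rewrite !ltW.
  - move=> z /andP[xz zy]; rewrite mulr_ge0 ?expR_ge0// subr_ge0 HdH//.
    by rewrite !ltW.
  - apply: derivable_within_continuous => z; rewrite in_itv /= => zxy.
    by have [] := kd z zxy.
by rewrite /k -(ler_pM2l (expR_gt0 x)) !mulrA -!expRD addrN expR0 mul1r.
Qed.

(* Multiplied by [exp (- x)], such an [H] is nondecreasing and vanishes at +oo. *)
Lemma supersol_bounded_le0 (R : realType) (H dH : R -> R) (a C : R) :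
  (forall z : R, a <= z -> is_derive z 1 H (dH z)) ->
  (forall z, a <= z -> H z <= dH z) -> (forall z, a <= z -> H z <= C) ->
  forall x, a <= x -> H x <= 0.
Proof.
move=> Hd HdH HC x ax; rewrite leNgt; apply/negP => Hx.
have C0 : 0 < C := lt_le_trans Hx (HC x ax).
(* With this [z], [H x * z = C], while [1 + z <= expR z] yields [H x * (1 + z) <= C]; together they
   contradict [0 < H x]. *)
pose z := C / H x; have z0 : 0 < z by rewrite divr_gt0.
have := @supersol_le _ H dH x (x + z); rewrite lerDl ltW// => /(_ erefl).
have sub w : x <= w <= x + z -> a <= w by move=> /andP[xw _]; exact: le_trans xw.
move=> /(_ (fun w h => Hd w (sub w h)) (fun w h => HdH w (sub w h))).
rewrite opprD addNKr => Hle.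
have : H x <= expR (- z) * C.
  apply: (le_trans Hle); rewrite ler_wpM2l ?expR_ge0// HC//.
  by rewrite (le_trans ax)// lerDl ltW.
rewrite expRN mulrC ler_pdivlMr ?expR_gt0// => Hle2.
have : H x * (1 + z) <= C by rewrite (le_trans _ Hle2)// ler_wpM2l ?expR_ge1Dx// ltW.
by rewrite mulrDr mulr1 /z mulrCA divff ?gt_eqF// mulr1; lra.
Qed.

(** * Comparison for the equation P - P'' = g *)

Lemma is_derive_reflect (R : realType) (f : R -> R) (x d : R) :
  is_derive (- x) 1 f d -> is_derive x 1 (fun y => f (- y)) (- d).
Proof.
move=> fd; rewrite (_ : - d = d * (- 1)); last by rewrite mulrN1.
exact: (@is_derive1_comp _ f (fun y => - y)).
Qed.

(** Maximum principle by factorization: [H = P + Q - c] satisfies [H <= H'], and so does the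
    reflection of [P - Q - c]; being bounded above, both are nonpositive. The two signs of [Q]
    together give its absolute value. *)
Lemma green_le (R : realType) (P Q g : R -> R) (C c : R) :
  (forall x : R, is_derive x 1 P (Q x)) ->
  (forall x : R, is_derive x 1 Q (P x - g x)) ->
  (forall x, `|P x| <= C) -> (forall x, `|Q x| <= C) -> (forall x, g x <= c) ->
  forall x, P x + `|Q x| <= c.
Proof.
move=> Pd Qd PC QC gc.
have EC s x : `|s| <= 1 -> P x + s * Q x - c <= C + C + `|c|.
  move=> s1; have := ler_norm (P x); have := PC x; have := ler_norm (- c).
  have : s * Q x <= C.
    rewrite (le_trans (ler_norm _))// normrM (le_trans _ (QC x))//.
    by rewrite ler_piMl.
  rewrite normrN; lra.
have E1 x : P x + Q x <= c.
  rewrite -subr_le0.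
  apply: (@supersol_bounded_le0 _ (fun x => P x + Q x - c)
    (fun x => Q x + (P x - g x) - 0) x (C + C + `|c|)) => // z xz.
  - by rewrite subr0; have := gc z; lra.
  - by have := EC 1 z; rewrite normr1 lexx mul1r; exact.
have E2 x : P x - Q x <= c.
  rewrite -subr_le0.
  pose H y := P (- y) - Q (- y) - c.
  suff : H (- x) <= 0 by rewrite /H opprK.
  apply: (@supersol_bounded_le0 _ H
    (fun y => - Q (- y) - (- (P (- y) - g (- y))) - 0) (- x) (C + C + `|c|)) => // z xz.
  - apply: is_deriveB; apply: is_deriveB; exact: is_derive_reflect.
  - by rewrite /H subr0; have := gc (- z); lra.
  - by have := EC (-1) (- z); rewrite normrN1 lexx mulN1r; exact.
move=> x; have [Q0|Q0] := leP 0 (Q x); first by rewrite ger0_norm.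
by rewrite ltr0_norm.
Qed.

Lemma green_norm_le (R : realType) (P Q g : R -> R) (C c : R) :
  (forall x : R, is_derive x 1 P (Q x)) ->
  (forall x : R, is_derive x 1 Q (P x - g x)) ->
  (forall x, `|P x| <= C) -> (forall x, `|Q x| <= C) -> (forall x, `|g x| <= c) ->
  forall x, `|P x| <= c /\ `|Q x| <= c.
Proof.
move=> Pd Qd PC QC gc x.
have H1 : P x + `|Q x| <= c.
  by apply: (green_le Pd Qd PC QC) => y; rewrite (le_trans (ler_norm _))//.
have H2 : - P x + `|Q x| <= c.
  rewrite -(normrN (Q x)).
  apply: (@green_le _ (fun x => - P x) (fun x => - Q x) (fun x => - g x) C) => //.
  - move=> y; have -> : - P y - - g y = - (P y - g y) by ring.
    exact: is_deriveN.
  - by move=> y; rewrite normrN.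
  - by move=> y; rewrite normrN.
  - by move=> y; rewrite (le_trans (ler_norm _))// normrN.
have := normr_ge0 (Q x); split; last by lra.
by rewrite ler_norml; lra.
Qed.

(** Only [P + Q] is controlled from the far right. [P - Q] is propagated from [L] with the factor
    [expR (L - x)]; by [1 + y <= expR y], the distance [2 * C / e] brings an initial size [2 * C]
    down to [e]. *)
Lemma green_decay_pos (R : realType) (P Q g : R -> R) (C e L : R) :
  (forall x : R, is_derive x 1 P (Q x)) ->
  (forall x : R, is_derive x 1 Q (P x - g x)) ->
  (forall x, `|P x| <= C) -> (forall x, `|Q x| <= C) ->
  0 <= C -> 0 < e -> (forall x, L <= x -> g x <= e) ->
  forall x, L + 2 * C / e <= x -> P x <= 2 * e.
Proof.
move=> Pd Qd PC QC C0 e0 gL x Lx.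
have Ce : 0 <= 2 * C / e by rewrite divr_ge0 ?mulr_ge0// ltW.
have Lx' : L <= x by rewrite (le_trans _ Lx)// lerDl.
have E1 : P x + Q x - e <= 0.
  apply: (@supersol_bounded_le0 _ (fun x => P x + Q x - e)
    (fun x => Q x + (P x - g x) - 0) L (C + C)) => // z Lz.
  - by rewrite subr0; have := gL z Lz; lra.
  - by have := PC z; have := QC z; rewrite !ler_norml; lra.
have E2 : P x - Q x - e <= e.
  pose H y := P (- y) - Q (- y) - e.
  have := @supersol_le _ H (fun y => - Q (- y) - (- (P (- y) - g (- y))) - 0) (- x) (- L).
  rewrite /H !opprK lerN2 => /(_ Lx').
  have H1 z : - x <= z <= - L ->
      is_derive z 1 (fun y => P (- y) - Q (- y) - e) (- Q (- z) - (- (P (- z) - g (- z))) - 0).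
    by move=> _; apply: is_deriveB; apply: is_deriveB; exact: is_derive_reflect.
  have H2 z : - x <= z <= - L ->
      P (- z) - Q (- z) - e <= - Q (- z) - (- (P (- z) - g (- z))) - 0.
    by move=> /andP[_ zL]; rewrite subr0; have := gL (- z); rewrite lerNr => /(_ zL); lra.
  move=> /(_ H1 H2) /le_trans; apply.
  have PQ : P L - Q L - e <= 2 * C.
    by have := PC L; have := QC L; rewrite !ler_norml; lra.
  rewrite (le_trans (ler_wpM2l (expR_ge0 _) PQ))// (_ : - x + L = - (x - L)); last by ring.
  rewrite expRN mulrC ler_pdivrMr ?expR_gt0//.
  have h : 1 + (x - L) <= expR (x - L) by rewrite expR_ge1Dx.
  have : e * (1 + (x - L)) <= e * expR (x - L) by rewrite ler_wpM2l// ltW.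
  apply: le_trans; rewrite -ler_pdivrMl// mulrC; lra.
by lra.
Qed.

Lemma green_decay (R : realType) (P Q g : R -> R) (C e L : R) :
  (forall x : R, is_derive x 1 P (Q x)) ->
  (forall x : R, is_derive x 1 Q (P x - g x)) ->
  (forall x, `|P x| <= C) -> (forall x, `|Q x| <= C) ->
  0 <= C -> 0 < e -> 0 <= L -> (forall x, L <= `|x| -> g x <= e) ->
  forall x, L + 2 * C / e <= `|x| -> P x <= 2 * e.
Proof.
move=> Pd Qd PC QC C0 e0 L0 gL x; have [x0|x0] := leP 0 x => Lx.
  rewrite ger0_norm// in Lx.
  apply: (green_decay_pos Pd Qd PC QC C0 e0 _ Lx) => // y Ly.
  by apply: gL; rewrite ger0_norm// (le_trans L0).
rewrite ltr0_norm// in Lx; rewrite -[x]opprK.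
apply: (@green_decay_pos _ (fun y => P (- y)) (fun y => - Q (- y)) (fun y => g (- y)) C e L) => //.
- by move=> y; exact: is_derive_reflect.
- move=> y; rewrite -[P (- y) - _]opprK; apply: is_deriveN.
  exact: is_derive_reflect.
- by move=> y; rewrite normrN.
- by move=> y Ly; apply: gL; rewrite normrN ger0_norm// (le_trans L0).
Qed.

(** * Classical solutions and their potential *)

Definition b_source (R : realType) (b u v : R) : R :=
  b / 2 * u ^+ 2 + (3 - b) / 2 * v ^+ 2.

(* [P = G (b_source b U V)], [V = U_x] and [Q = P_x]. *)
Record bfam_reg (R : realType) (b : R) (U V P Q : R -> R -> R) : Prop := BfamReg {
  bfam_U : forall t x : R, 0 <= t -> is_derive x 1 (U t) (V t x) ;
  bfam_P : forall t x : R, 0 <= t -> is_derive x 1 (P t) (Q t x) ;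
  bfam_Q : forall t x : R, 0 <= t ->
    is_derive x 1 (Q t) (P t x - b_source b (U t x) (V t x)) ;
  bfam_cont : forall t0 e : R, 0 <= t0 -> 0 < e -> exists2 dl : R, 0 < dl &
    forall t x y, 0 <= t -> `|t - t0| < dl -> `|x - y| < dl ->
      `|U t x - U t0 y| <= e /\ `|V t x - V t0 y| <= e ;
  bfam_decay : forall t e : R, 0 <= t -> 0 < e -> exists L : R,
    forall x, L <= `|x| -> `|U t x| <= e /\ `|V t x| <= e ;
  bfam_bdd : forall t : R, 0 <= t -> exists C : R, forall x,
    [/\ `|U t x| <= C, `|V t x| <= C, `|P t x| <= C & `|Q t x| <= C] }.

(* A potential [W] of [U] solves [W_t + U ^ 2 / 2 + P = 0], which encodes the
   b-family equation without differentiating [U] in time. *)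
Record bfam (R : realType) (b : R) (W U V P Q : R -> R -> R) : Prop := Bfam {
  bfam_regular :> bfam_reg b U V P Q ;
  bfam_W : forall t x : R, 0 <= t -> is_derive x 1 (W t) (U t x) ;
  bfam_Wt : forall t x : R, 0 < t ->
    is_derive t 1 (W^~ x) (- (2^-1 * U t x ^+ 2 + P t x)) ;
  bfam_W0 : forall x e : R, 0 < e -> exists2 dl : R, 0 < dl &
    forall s, 0 <= s < dl -> `|W s x - W 0 x| <= e }.

Lemma norm_close (R : realType) (x y e C : R) :
  `|x - y| <= e -> `|y| <= C -> `|x| <= C + e.
Proof. by move=> xy yC; rewrite -[x](subrK y) (le_trans (ler_normD _ _))//; lra. Qed.

Section bfam_facts.
Context {R : realType} {b : R} {U V P Q : R -> R -> R}.
Hypothesis hb : 0 < b < 3.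
Hypothesis H : bfam_reg b U V P Q.

Lemma bfam_UV_bdd (T : R) : exists2 K : R, 0 < K & forall t x, 0 <= t <= T ->
  `|U t x| <= K /\ `|V t x| <= K.
Proof.
have [||L HL] := @segment_uniform R T (fun t L => forall x, `|U t x| <= L /\ `|V t x| <= L).
- by move=> t L L' LL' h x; have [h1 h2] := h x; split; exact: le_trans LL'.
- move=> t0 /andP[t00 _]; have [C HC] := bfam_bdd H t00.
  have [dl dl0 Hdl] := bfam_cont H t00 ltr01.
  exists dl => //; exists (C + 1) => t /andP[t_ge0 _] td x.
  have [h1 h2] := Hdl t x x t_ge0 td (ltac:(by rewrite subrr normr0)).
  have [c1 c2 _ _] := HC x.
  by rewrite (norm_close h1 c1) (norm_close h2 c2).
exists (Num.max L 1); first by rewrite lt_max ltr01 orbT.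
by move=> t x /HL/(_ x)[h1 h2]; rewrite !le_max h1 h2.
Qed.

Lemma bfam_modulus (T e : R) : 0 < e -> exists2 dl : R, 0 < dl &
  forall t x y, 0 <= t <= T -> `|x - y| < dl ->
    `|U t x - U t y| <= e /\ `|V t x - V t y| <= e.
Proof.
move=> e0.
(* The parameter is the inverse of the modulus of continuity, so that enlarging it weakens the
   property, as [segment_uniform] requires. *)
have [||L HL] := @segment_uniform R T (fun t L => 0 < L /\ forall x y, `|x - y| * L < 1 ->
    `|U t x - U t y| <= e /\ `|V t x - V t y| <= e).
- move=> t L L' LL' [L0 h]; split=> [|x y xy]; first exact: lt_le_trans LL'.
  by apply: h; rewrite (le_lt_trans _ xy)// ler_wpM2l.
- move=> t0 /andP[t00 _].
  have e2 : 0 < e / 2 by rewrite divr_gt0.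
  have [dl dl0 Hdl] := bfam_cont H t00 e2.
  exists dl => //; exists (dl^-1) => t /andP[t_ge0 _] td.
  rewrite invr_gt0; split=> // x y; rewrite ltr_pdivrMr// mul1r => xy.
  have [h1 h2] := Hdl t x x t_ge0 td (ltac:(by rewrite subrr normr0)).
  have [h3 h4] := Hdl t y x t_ge0 td (ltac:(by rewrite distrC)).
  have tri (f : R -> R -> R) : `|f t x - f t0 x| <= e / 2 ->
      `|f t y - f t0 x| <= e / 2 -> `|f t x - f t y| <= e.
    move=> f1 f2; rewrite (_ : _ - _ = (f t x - f t0 x) - (f t y - f t0 x)); last by ring.
    by rewrite (le_trans (ler_normB _ _))//; lra.
  by split; apply: tri.
have [T0|T0] := ltP T 0.
  by exists 1 => // t x y /andP[a c]; have := le_lt_trans (le_trans a c) T0; rewrite ltxx.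
have [|L0 _] := HL 0; first by rewrite lexx.
exists L^-1; first by rewrite invr_gt0.
move=> t x y tT xy; have [_] := HL t tT; apply.
by rewrite -ltr_pdivlMr// mul1r.
Qed.

Lemma bfam_decay_unif (T e : R) : 0 < e -> exists2 L : R, 0 <= L &
  forall t x, 0 <= t <= T -> L <= `|x| -> `|U t x| <= e /\ `|V t x| <= e.
Proof.
move=> e0.
have [||L HL] := @segment_uniform R T (fun t L => forall x, L <= `|x| ->
    `|U t x| <= e /\ `|V t x| <= e).
- by move=> t L L' LL' h x Lx; apply: h; exact: le_trans Lx.
- move=> t0 /andP[t00 _].
  have e2 : 0 < e / 2 by rewrite divr_gt0.
  have [dl dl0 Hdl] := bfam_cont H t00 e2.
  have [L HL] := bfam_decay H t00 e2.
  exists dl => //; exists L => t /andP[t_ge0 _] td x Lx.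
  have [h1 h2] := Hdl t x x t_ge0 td (ltac:(by rewrite subrr normr0)).
  have [c1 c2] := HL x Lx.
  by have := norm_close h1 c1; have := norm_close h2 c2; rewrite -splitr.
exists (Num.max L 0); first by rewrite le_max lexx orbT.
by move=> t x tT; rewrite ge_max => /andP[Lx _]; exact: HL.
Qed.

Lemma b_source_ge0 (u v : R) : 0 <= b_source b u v.
Proof.
by rewrite /b_source addr_ge0// mulr_ge0 ?sqr_ge0//; move: hb; lra.
Qed.

Lemma b_source_le (u v K : R) : `|u| <= K -> `|v| <= K -> b_source b u v <= 2 * K ^+ 2.
Proof.
move=> uK vK; have u2 : u ^+ 2 <= K ^+ 2 by rewrite -(real_normK (num_real _)) lerXn2r// ?nnegrE// (le_trans _ uK).
have v2 : v ^+ 2 <= K ^+ 2 by rewrite -(real_normK (num_real _)) lerXn2r// ?nnegrE// (le_trans _ vK).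
have h1 : b / 2 * u ^+ 2 <= b / 2 * K ^+ 2 by rewrite ler_wpM2l//; move: hb; lra.
have h2 : (3 - b) / 2 * v ^+ 2 <= (3 - b) / 2 * K ^+ 2 by rewrite ler_wpM2l//; move: hb; lra.
rewrite /b_source (le_trans (lerD h1 h2))// -mulrDl ler_wpM2r ?sqr_ge0//; lra.
Qed.

Lemma b_source_norm_le (u v K : R) : `|u| <= K -> `|v| <= K -> `|b_source b u v| <= 2 * K ^+ 2.
Proof. by move=> uK vK; rewrite ger0_norm ?b_source_ge0// b_source_le. Qed.

Lemma b_source_lip (u v u' v' K e : R) : `|u| <= K -> `|v| <= K -> `|u'| <= K -> `|v'| <= K ->
  `|u - u'| <= e -> `|v - v'| <= e -> `|b_source b u v - b_source b u' v'| <= 3 * K * e.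
Proof.
move=> uK vK uK' vK' ue ve.
have sq x y : `|x| <= K -> `|y| <= K -> `|x - y| <= e -> `|x ^+ 2 - y ^+ 2| <= e * (2 * K).
  move=> xK yK xy; rewrite subr_sqr normrM ler_pM// (le_trans (ler_normD _ _))//; lra.
rewrite /b_source (_ : _ - _ = b / 2 * (u ^+ 2 - u' ^+ 2) + (3 - b) / 2 * (v ^+ 2 - v' ^+ 2)); last by ring.
have h1 := sq _ _ uK uK' ue; have h2 := sq _ _ vK vK' ve.
rewrite (le_trans (ler_normD _ _))// (normrM (b / 2)) (normrM ((3 - b) / 2))
  (ger0_norm (_ : 0 <= b / 2)); last by move: hb; lra.
rewrite (ger0_norm (_ : 0 <= (3 - b) / 2)); last by move: hb; lra.
have h3 : b / 2 * `|u ^+ 2 - u' ^+ 2| <= b / 2 * (e * (2 * K)) by rewrite ler_wpM2l//; move: hb; lra.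
have h4 : (3 - b) / 2 * `|v ^+ 2 - v' ^+ 2| <= (3 - b) / 2 * (e * (2 * K)).
  by rewrite ler_wpM2l//; move: hb; lra.
by rewrite (le_trans (lerD h3 h4))//; lra.
Qed.

(** The bound in the record is only qualitative; the maximum principle replaces it by one that
    depends on the size of [U t] and [V t] alone, hence is uniform on bounded time intervals. *)
Lemma bfam_PQ_bdd (K t : R) : 0 <= t -> (forall x, `|U t x| <= K /\ `|V t x| <= K) ->
  forall x, `|P t x| <= 2 * K ^+ 2 /\ `|Q t x| <= 2 * K ^+ 2.
Proof.
move=> t0 UVK; have [C HC] := bfam_bdd H t0.
apply: (green_norm_le (fun x => bfam_P H x t0) (fun x => bfam_Q H x t0) (C := C)).
- by move=> x; have [] := HC x.
- by move=> x; have [] := HC x.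
- by move=> x; have [? ?] := UVK x; exact: b_source_norm_le.
Qed.

(** Maximum principle for [- P], whose source is nonpositive because both coefficients of [b_source]
    are positive for [b] between [0] and [3]. *)
Lemma bfam_P_ge0 (t x : R) : 0 <= t -> 0 <= P t x.
Proof.
move=> t0; have [C HC] := bfam_bdd H t0.
suff : - P t x + `|- Q t x| <= 0 by have := normr_ge0 (- Q t x); lra.
apply: (@green_le _ (fun x => - P t x) (fun x => - Q t x)
  (fun x => - b_source b (U t x) (V t x)) C) => y.
- by apply: is_deriveN; exact: (bfam_P H).
- rewrite (_ : _ - _ = - (P t y - b_source b (U t y) (V t y))); last by ring.
  by apply: is_deriveN; exact: (bfam_Q H).
- by rewrite normrN; have [] := HC y.
- by rewrite normrN; have [] := HC y.
- by rewrite oppr_le0 b_source_ge0.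
Qed.

(** Continuity in time comes from linearity: the difference of [P] at two times solves the same
    equation with the difference of the sources, which is small uniformly in [x]. Continuity in
    space comes from bounds on the derivatives. *)
Lemma bfam_PQ_cont (t0 e : R) : 0 <= t0 -> 0 < e -> exists2 dl : R, 0 < dl &
  forall t x y, 0 <= t -> `|t - t0| < dl -> `|x - y| < dl ->
    `|P t x - P t0 y| <= e /\ `|Q t x - Q t0 y| <= e.
Proof.
move=> t00 e0; have [K K0 HK] := bfam_UV_bdd (t0 + 1).
(* [3 * K] is the Lipschitz constant of [b_source] for arguments bounded by [K], so this [a] makes
   the sources differ by at most [e / 2]. *)
pose a := e / 2 / (3 * K); have a0 : 0 < a by rewrite !divr_gt0// mulr_gt0.
have [dl dl0 Hdl] := bfam_cont H t00 a0.
have D0 : 0 < 4 * K ^+ 2 by rewrite mulr_gt0// exprn_gt0.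
exists (Num.min (Num.min dl 1) (e / 2 / (4 * K ^+ 2))).
  by rewrite !lt_min dl0 ltr01 !divr_gt0.
move=> t x y t_ge0; rewrite !lt_min => /andP[/andP[td t1] _] /andP[_ xy].
have tT : 0 <= t <= t0 + 1.
  by rewrite t_ge0 /= -lerBlDl (le_trans (ler_norm _))// ltW.
have t0T : 0 <= t0 <= t0 + 1 by rewrite t00 lerDl ler01.
have [C HC] := bfam_bdd H t_ge0; have [C0 HC0] := bfam_bdd H t00.
have time : `|P t x - P t0 x| <= e / 2 /\ `|Q t x - Q t0 x| <= e / 2.
  apply: (@green_norm_le _ (fun x => P t x - P t0 x) (fun x => Q t x - Q t0 x)
    (fun x => b_source b (U t x) (V t x) - b_source b (U t0 x) (V t0 x)) (C + C0)) => z.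
  - by apply: is_deriveB; exact: (bfam_P H).
  - rewrite (_ : _ - _ = (P t z - b_source b (U t z) (V t z)) -
        (P t0 z - b_source b (U t0 z) (V t0 z))); last by ring.
    by apply: is_deriveB; exact: (bfam_Q H).
  - by have [_ _ p _] := HC z; have [_ _ p' _] := HC0 z; rewrite (le_trans (ler_normB _ _))// lerD.
  - by have [_ _ _ p] := HC z; have [_ _ _ p'] := HC0 z; rewrite (le_trans (ler_normB _ _))// lerD.
  - have [k1 k2] := HK t z tT; have [k3 k4] := HK t0 z t0T.
    have [|h1 h2] := Hdl t z z t_ge0 td; first by rewrite subrr normr0.
    rewrite (le_trans (b_source_lip k1 k2 k3 k4 h1 h2))// /a mulrC divfK//.
    by rewrite mulf_neq0 ?gt_eqF.
have PQ0 := bfam_PQ_bdd t00 (fun x => HK t0 x t0T).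
have space : `|P t0 x - P t0 y| <= e / 2 /\ `|Q t0 x - Q t0 y| <= e / 2.
  have xy' : 4 * K ^+ 2 * `|x - y| <= e / 2.
    by rewrite mulrC -ler_pdivlMr// ltW.
  split; apply: le_trans xy'.
    apply: (derive_bound_lip (df := Q t0)) => z; first exact: (bfam_P H).
    by have [_ q] := PQ0 z; rewrite (le_trans q)// ler_wpM2r ?sqr_ge0// ler_nat.
  apply: (derive_bound_lip (df := fun z => P t0 z - b_source b (U t0 z) (V t0 z))) => z.
    exact: (bfam_Q H).
  have [p _] := PQ0 z; rewrite (le_trans (ler_normB _ _))//.
  have [k3 k4] := HK t0 z t0T; have := b_source_norm_le k3 k4; lra.
have tri (f : R -> R -> R) : `|f t x - f t0 x| <= e / 2 ->
    `|f t0 x - f t0 y| <= e / 2 -> `|f t x - f t0 y| <= e.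
  move=> f1 f2; rewrite (_ : _ - _ = (f t x - f t0 x) + (f t0 x - f t0 y)); last by ring.
  by rewrite (le_trans (ler_normD _ _))//; lra.
by move: time space => [p1 p2] [p3 p4]; split; apply: tri.
Qed.

Lemma bfam_Ux_cont (t0 x0 e : R) : 0 <= t0 -> 0 < e -> exists2 dl : R, 0 < dl &
  forall t x, 0 <= t -> `|t - t0| < dl -> `|x - x0| < dl ->
    `|U t x * V t x + Q t x - (U t0 x0 * V t0 x0 + Q t0 x0)| <= e.
Proof.
move=> t00 e0; have [K K0 HK] := bfam_UV_bdd (t0 + 1).
pose a := e / (2 * K + 1); have a0 : 0 < a by rewrite divr_gt0// ltr_wpDl// mulr_ge0// ltW.
have [dl dl0 Hdl] := bfam_cont H t00 a0.
have [dl' dl'0 Hdl'] := bfam_PQ_cont t00 a0.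
exists (Num.min (Num.min dl 1) dl'); first by rewrite !lt_min dl0 ltr01.
move=> t x t_ge0; rewrite !lt_min => /andP[/andP[td t1] td'] /andP[/andP[xd _] xd'].
have tT : 0 <= t <= t0 + 1.
  by rewrite t_ge0 /= -lerBlDl (le_trans (ler_norm _))// ltW.
have t0T : 0 <= t0 <= t0 + 1 by rewrite t00 lerDl ler01.
have [h1 h2] := Hdl t x x0 t_ge0 td xd; have [_ h3] := Hdl' t x x0 t_ge0 td' xd'.
have [k1 k2] := HK t x tT; have [k3 k4] := HK t0 x0 t0T.
rewrite (_ : _ - _ = (U t x - U t0 x0) * V t x + U t0 x0 * (V t x - V t0 x0) +
  (Q t x - Q t0 x0)); last by ring.
have p1 : `|(U t x - U t0 x0) * V t x| <= a * K by rewrite normrM ler_pM.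
have p2 : `|U t0 x0 * (V t x - V t0 x0)| <= K * a by rewrite normrM ler_pM.
have aE : a * (2 * K + 1) = e by rewrite /a divfK// gt_eqF// ltr_wpDl// mulr_ge0// ltW.
have n1 := ler_normD ((U t x - U t0 x0) * V t x + U t0 x0 * (V t x - V t0 x0)) (Q t x - Q t0 x0).
have n2 := ler_normD ((U t x - U t0 x0) * V t x) (U t0 x0 * (V t x - V t0 x0)).
lra.
Qed.

Lemma bfam_flux_deriv (t x : R) : 0 <= t ->
  is_derive x 1 (fun x => 2^-1 * U t x ^+ 2 + P t x) (U t x * V t x + Q t x).
Proof.
move=> t0; have h1 := bfam_U H x t0; have h2 := bfam_P H x t0.
have -> : U t x * V t x + Q t x = 2^-1 * (2 * U t x ^+ 1 * V t x) + Q t x.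
  by rewrite expr1; field.
apply: is_deriveD; apply: is_deriveZ.
exact: (@is_deriveX _ _ (U t) 2 x 1 (V t x) h1).
Qed.

Lemma sqr_lip (u u' K e : R) : `|u| <= K -> `|u'| <= K -> `|u - u'| <= e ->
  `|u ^+ 2 - u' ^+ 2| <= 2 * K * e.
Proof.
move=> uK uK' ue; rewrite subr_sqr normrM mulrC ler_pM//.
by rewrite (le_trans (ler_normD _ _))//; lra.
Qed.

Lemma bfam_flux_cont (t e : R) : 0 <= t -> 0 < e -> exists2 dl : R, 0 < dl &
  forall w z x, 0 <= w -> `|w - t| < dl -> `|z - x| < dl ->
    `|2^-1 * U w z ^+ 2 + P w z - (2^-1 * U t x ^+ 2 + P t x)| <= e.
Proof.
move=> t0 e0; have [K K0 HK] := bfam_UV_bdd (t + 1).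
pose a := e / (K + 1).
have D0 : 0 < K + 1 by rewrite ltr_wpDl// ltW.
have a0 : 0 < a by rewrite divr_gt0.
have [dl1 dl10 Hdl1] := bfam_cont H t0 a0.
have [dl2 dl20 Hdl2] := bfam_PQ_cont t0 a0.
exists (Num.min (Num.min dl1 dl2) 1); first by rewrite !lt_min dl10 dl20 ltr01.
move=> w z x w0; rewrite !lt_min => /andP[/andP[w1 w2] w4] /andP[/andP[x1 x2] _].
have [h1 _] := Hdl1 w z x w0 w1 x1; have [h2 _] := Hdl2 w z x w0 w2 x2.
have wT : 0 <= w <= t + 1 by rewrite w0/= -lerBlDl (le_trans (ler_norm _))// ltW.
have tT' : 0 <= t <= t + 1 by rewrite t0 lerDl ler01.
have [k1 _] := HK w z wT; have [k2 _] := HK t x tT'.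
have h3 := sqr_lip k1 k2 h1.
have aE : a * (K + 1) = e by rewrite /a divfK// gt_eqF.
rewrite (_ : _ - _ = 2^-1 * (U w z ^+ 2 - U t x ^+ 2) + (P w z - P t x)); last by ring.
have n1 := ler_normD (2^-1 * (U w z ^+ 2 - U t x ^+ 2)) (P w z - P t x).
rewrite normrM ger0_norm// in n1; lra.
Qed.

Lemma bfam_flux_bdd (T K t x : R) : (forall t x, 0 <= t <= T -> `|U t x| <= K /\ `|V t x| <= K) ->
  0 <= t <= T -> `|2^-1 * U t x ^+ 2 + P t x| <= 3 * K ^+ 2 /\ `|U t x * V t x + Q t x| <= 3 * K ^+ 2.
Proof.
move=> HK tT; have /andP[t0 _] := tT.
have [h1 h2] := bfam_PQ_bdd t0 (fun x => HK t x tT) x.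
have [k1 k2] := HK t x tT.
have p1 : `|U t x ^+ 2| <= K ^+ 2 by rewrite normrX lerXn2r// ?nnegrE// (le_trans _ k1).
have p2 : `|U t x * V t x| <= K ^+ 2 by rewrite normrM expr2 ler_pM.
split.
  rewrite (le_trans (ler_normD _ _))// normrM ger0_norm//.
  by have := normr_ge0 (U t x ^+ 2); lra.
by rewrite (le_trans (ler_normD _ _))//; lra.
Qed.

End bfam_facts.

Section bfam_time_derivative.
Context {R : realType} {b : R} {W U V P Q : R -> R -> R}.
Hypothesis hb : 0 < b < 3.
Hypothesis H : bfam b W U V P Q.

(** Interchange of mixed derivatives: [U = W_x] and [W_t = - F] give [U_t = - F_x]. The second
    difference of [W] over a rectangle is computed by the mean value theorem, first in time and then
    in space. *)
Lemma bfam_Ut (t x : R) : 0 < t ->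
  is_derive t 1 (U^~ x) (- (U t x * V t x + Q t x)).
Proof.
move=> t0; apply/is_deriveP => e e0.
have t0' := ltW t0.
have [dl dl0 Hdl] := bfam_Ux_cont hb H x t0' e0.
exists (Num.min dl t); first by rewrite lt_min dl0.
move=> s; rewrite lt_min => /andP[sd st].
have near_pos z : `|z - t| <= `|s - t| -> 0 < z.
  by move=> /le_lt_trans/(_ st); rewrite ltr_norml => /andP[]; lra.
have s0 : 0 < s by apply: near_pos.
(* The width [h] of the rectangle may depend on [s]: it is so small that the quotients of [W] at
   both times are within [d / 2] of [U t x] and [U s x]. The slack [d] absorbs this error. *)
apply/ler_addgt0Pr => d d0; have d2 : 0 < d / 2 by rewrite divr_gt0.
have /is_deriveP/(_ _ d2)[d1 d10 H1] := bfam_W H x t0'.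
have /is_deriveP/(_ _ d2)[d3 d30 H3] := bfam_W H x (ltW s0).
pose h := Num.min dl (Num.min d1 d3) / 2.
have m0 : 0 < Num.min dl (Num.min d1 d3) by rewrite !lt_min dl0 d10 d30.
have h0 : 0 < h by rewrite divr_gt0.
have hm : h < Num.min dl (Num.min d1 d3) by rewrite /h; lra.
move: (hm); rewrite !lt_min => /and3P[hdl hd1 hd3].
have hn : `|x + h - x| = h by rewrite addrAC subrr add0r ger0_norm// ltW.
have {}H1 : `|W t (x + h) - W t x - U t x * h| <= d / 2 * h.
  by have := H1 (x + h); rewrite hn [x + h - x]addrAC subrr add0r; exact.
have {}H3 : `|W s (x + h) - W s x - U s x * h| <= d / 2 * h.
  by have := H3 (x + h); rewrite hn [x + h - x]addrAC subrr add0r; exact.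
pose k z := W z (x + h) - W z x.
pose F z y := 2^-1 * U z y ^+ 2 + P z y.
have [|c [ct cs E]] := @mvt_unordered _ k (fun z => - F z (x + h) - - F z x) t s.
  by move=> z /near_pos z0 _; apply: is_deriveB; exact: (bfam_Wt H).
have c0 := near_pos _ ct.
have [y [yx _ Ey]] := @mvt_unordered _ (F c) (fun y => U c y * V c y + Q c y) x (x + h)
  (fun y _ _ => bfam_flux_deriv H y (ltW c0)).
have {}E : k s - k t = - ((U c y * V c y + Q c y) * h) * (s - t).
  by move: Ey; rewrite [x + h - x]addrAC subrr add0r E => <-; ring.
have := Hdl c y (ltW c0) (le_lt_trans ct sd).
rewrite hn in yx; move=> /(_ (le_lt_trans yx hdl)).
set A := U c y * V c y + Q c y in E *; set B := U t x * V t x + Q t x => AB.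
rewrite -(ler_pM2r h0) -[X in _ * X <= _]gtr0_norm// -normrM.
rewrite (_ : _ * h = (W t (x + h) - W t x - U t x * h) -
   (W s (x + h) - W s x - U s x * h) + (k s - k t + B * (s - t) * h)); last first.
  by rewrite /k; ring.
have n1 : `|k s - k t + B * (s - t) * h| <= e * `|s - t| * h.
  rewrite E (_ : _ + _ = (B - A) * (s - t) * h); last by ring.
  by rewrite (normrM _ h) (normrM (B - A)) (gtr0_norm h0) ler_wpM2r ?(ltW h0)// ler_wpM2r// distrC.
rewrite (le_trans (ler_normD _ _))//.
have n2 := ler_normB (W t (x + h) - W t x - U t x * h) (W s (x + h) - W s x - U s x * h).
by lra.
Qed.

End bfam_time_derivative.

(** * Characteristics *)

Section segment_integral.
Context {R : realType}.
Notation mu := (@lebesgue_measure R).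
Implicit Types (f g : R -> R) (a b c : R).

Lemma continuous_integrable_segment f a b : continuous f ->
  mu.-integrable `[a, b] (EFin \o f).
Proof.
move=> fc; apply: continuous_compact_integrable; first exact: segment_compact.
exact: continuous_subspaceT.
Qed.

Lemma Rintegral_segment_cat f a b c : a <= b -> b <= c ->
  mu.-integrable `[a, c] (EFin \o f) ->
  \int[mu]_(x in `[a, c]) f x =
  \int[mu]_(x in `[a, b]) f x + \int[mu]_(x in `[b, c]) f x.
Proof.
move=> ab bc fi.
have := @Rintegral_itvB R f (BLeft a) (BRight c) b fi.
rewrite !bnd_simp => /(_ ab bc) E.
have : \int[mu]_(x in `]b, c]) f x = \int[mu]_(x in `[b, c]) f x.
  apply: Rintegral_itv_obnd_cbnd; apply: integrableS fi => //.
  by apply: subset_itv; rewrite bnd_simp.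
by move: E => /[swap] <- <-; rewrite addrC subrK.
Qed.

Lemma Rintegral_segment1 f a : \int[mu]_(x in `[a, a]) f x = 0.
Proof. by rewrite set_itv1 Rintegral_set1. Qed.

Lemma Rintegral_segment_cst a b c : a <= b -> \int[mu]_(x in `[a, b]) c = c * (b - a).
Proof.
move=> ab; rewrite Rintegral_cst//= lebesgue_measure_itv /=.
case: ifPn => [_//|]; rewrite lte_fin -leNgt => ba.
by rewrite (le_anti (introT andP (conj ab ba))) subrr.
Qed.

Lemma Rintegral_segment_norm_le f a b c : a <= b ->
  mu.-integrable `[a, b] (EFin \o f) ->
  (forall x, a <= x <= b -> `|f x| <= c) ->
  `|\int[mu]_(x in `[a, b]) f x| <= c * (b - a).
Proof.
move=> ab fi fc; rewrite (le_trans (le_normr_Rintegral _ fi))//.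
rewrite -Rintegral_segment_cst//; apply: le_Rintegral => //.
- exact: integrable_norm.
- by apply: continuous_integrable_segment => x; exact: cvg_cst.
Qed.

Lemma Rintegral_segment_deriv f a t : continuous f -> a < t ->
  is_derive t 1 (fun t => \int[mu]_(x in `[a, t]) f x) (f t).
Proof.
move=> fc at_.
have tt : t < t + 1 by rewrite ltrDl.
have fi := @continuous_integrable_segment f a (t + 1) fc.
have [d E] := continuous_FTC1_closed tt fi at_ (fc t).
by rewrite derive1E in E; split.
Qed.

Lemma Rintegral_segment_FTC f F a b : a <= b -> continuous f ->
  (forall x : R, is_derive x 1 F (f x)) ->
  \int[mu]_(x in `[a, b]) f x = F b - F a.
Proof.
rewrite le_eqVlt => /predU1P[<-|ab] fc Fd; first by rewrite Rintegral_segment1 subrr.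
have Fc : continuous F by move=> x; exact: is_derive_continuous (Fd x).
rewrite /Rintegral (@continuous_FTC2 R f F a b ab) => //.
- exact: continuous_subspaceT.
- split.
  + by move=> x _; have [] := Fd x.
  + exact/cvg_at_right_filter/Fc.
  + exact/cvg_at_left_filter/Fc.
- by move=> x _; have [_] := Fd x; rewrite derive1E.
Qed.

End segment_integral.

Lemma geometric_small (R : realType) (C e : R) : 0 < e -> exists n, C / 2 ^+ n <= e.
Proof.
move=> e0; have [n Hn] : exists n : nat, C / e <= n%:R.
  exists (Num.Def.archi_bound `|C / e|); rewrite (le_trans (ler_norm _))//.
  by rewrite ltW// archi_boundP.
exists n; rewrite ler_pdivrMr ?exprn_gt0// mulrC -ler_pdivrMr//.
by rewrite (le_trans Hn)// -natrX ler_nat ltnW// ltn_expl.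
Qed.

(** The intervals [[a n - d n, a n + d n]] with [d n = 2 * C / 2 ^+ n] are nested, since
    [d n - d n.+1 = C / 2 ^+ n]; the supremum of their left ends lies in all of them. *)
Lemma geometric_cauchy (R : realType) (a : nat -> R) (C : R) : 0 <= C ->
  (forall n, `|a n.+1 - a n| <= C / 2 ^+ n) ->
  exists l, forall n, `|a n - l| <= 2 * C / 2 ^+ n.
Proof.
move=> C0 aC.
pose d n : R := 2 * C / 2 ^+ n.
have dS n : d n.+1 = C / 2 ^+ n.
  by rewrite /d exprS; field; rewrite expf_neq0.
have d2 n : d n = 2 * (C / 2 ^+ n) by rewrite /d mulrA.
have up : {homo (fun n => a n - d n) : n m / (n <= m)%N >-> n <= m}.
  apply: homo_leq => [x|y x z|n]; [exact: lexx|exact: le_trans|].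
  by rewrite dS d2; have := aC n; rewrite ler_norml; lra.
have dn : {homo (fun n => a n + d n) : n m / (n <= m)%N >-> m <= n}.
  apply: (homo_leq (r := fun x y => y <= x)) => [x|y x z /= h1 h2|n];
    [exact: lexx|exact: le_trans h2 h1|].
  by rewrite dS d2; have := aC n; rewrite ler_norml; lra.
have d0 n : 0 <= d n by rewrite /d divr_ge0 ?exprn_ge0 ?mulr_ge0.
have ud n m : a n - d n <= a m + d m.
  have := up n (maxn n m) (leq_maxl _ _); have := dn m (maxn n m) (leq_maxr _ _).
  by have := d0 (maxn n m); lra.
pose S := range (fun n => a n - d n).
have hS : has_sup S.
  by split; [exists (a 0%N - d 0%N); exists 0%N|exists (a 0%N + d 0%N) => _ [n _ <-]].
exists (sup S) => n; rewrite ler_norml -/(d n).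
have h1 : a n - d n <= sup S by apply: ub_le_sup; [by case: hS|exists n].
have h2 : sup S <= a n + d n by apply: ge_sup; [by case: hS|move=> _ [m _ <-]].
by lra.
Qed.

(** * Global Picard iteration *)

Section picard.
Context {R : realType}.
Notation mu := (@lebesgue_measure R).
Variables (v : R -> R -> R) (K B x0 : R).
Hypothesis K0 : 0 < K.
Hypothesis vlip : forall t x y, `|v t x - v t y| <= K * `|x - y|.
Hypothesis vcont : forall x, continuous (v^~ x).
Hypothesis vB : forall t x, `|v t x| <= B.

Let B0 : 0 <= B. Proof. exact: le_trans (vB 0 0). Qed.

(** For [t < 0] the segment is empty and the value is [x0], so the iterates are Lipschitz on the
    whole line, with no boundary at [0]. *)
Let picard_map (q : R -> R) (t : R) : R := x0 + \int[mu]_(s in `[0, t]) v s (q s).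

Let Blip (q : R -> R) := forall s t, `|q t - q s| <= B * `|t - s|.

Let along_continuous q : Blip q -> continuous (fun s => v s (q s)).
Proof.
move=> ql t; apply/continuousP_eps => e e0; have e2 : 0 < e / 2 by rewrite divr_gt0.
have /continuousP_eps/(_ _ e2)[d d0 Hd] := @vcont (q t) t.
have KB : 0 < K * B + 1 by rewrite ltr_wpDl// mulr_ge0// ltW.
exists (Num.min d (e / 2 / (K * B + 1))); first by rewrite lt_min d0 divr_gt0.
move=> s; rewrite lt_min => /andP[/Hd h1]; rewrite ltr_pdivlMr// => h2.
rewrite (_ : _ - _ = (v s (q s) - v s (q t)) + (v s (q t) - v t (q t))); last by ring.
rewrite (le_trans (ler_normD _ _))//.
have h3 : K * `|q s - q t| <= K * (B * `|s - t|) by rewrite ler_wpM2l// ltW.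
have := vlip s (q s) (q t); have := normr_ge0 (s - t); lra.
Qed.

Let picard_map_neg q t : t < 0 -> picard_map q t = x0.
Proof. by move=> t0; rewrite /picard_map set_itv_ge ?bnd_simp -?ltNge// Rintegral_set0 addr0. Qed.

Let picard_map_lip q : Blip q -> Blip (picard_map q).
Proof.
move=> ql s t; wlog st : s t / s <= t.
  by move=> h; have [/h//|/ltW/h] := leP s t; rewrite distrC (distrC t).
have qi a c := @continuous_integrable_segment R _ a c (along_continuous ql).
rewrite (ger0_norm (_ : 0 <= t - s)) ?subr_ge0//.
have [t0|t0] := ltP t 0.
  by rewrite !picard_map_neg// ?(le_lt_trans st)// subrr normr0 mulr_ge0// subr_ge0.
have [s0|s0] := ltP s 0.
  rewrite (picard_map_neg _ s0) /picard_map addrAC subrr add0r.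
  rewrite (le_trans (Rintegral_segment_norm_le (c := B) t0 (qi _ _) _))//.
  by rewrite ler_wpM2l// subr0 lerDl oppr_ge0 ltW.
rewrite /picard_map opprD addrACA subrr add0r.
rewrite (Rintegral_segment_cat s0 st (qi _ _)) addrAC subrr add0r.
exact: Rintegral_segment_norm_le.
Qed.

Let q_ n : R -> R := iter n picard_map (fun _ => x0).

Let q_lip n : Blip (q_ n).
Proof.
elim: n => [s t|n IH]; first by rewrite subrr normr0 mulr_ge0.
exact: picard_map_lip.
Qed.

Let c := B / (2 * K).
Let c0 : 0 <= c. Proof. by rewrite divr_ge0// mulr_ge0// ltW. Qed.

(** The weight [expR (2 * K * t)] makes the iteration contract by one half on the whole half-line at
    once: [K] times the integral of the weight over [[0, t]] is at most half the weight. The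
    constant [c] comes from the first step, [B * t = c * (2 * K * t) <= c * expR (2 * K * t)]. *)
Let q_step n t : `|q_ n.+1 t - q_ n t| <= c * expR (2 * K * `|t|) / 2 ^+ n.
Proof.
elim: n t => [|n IH] t.
  rewrite expr0 divr1 /=; have [t0|t0] := ltP t 0.
    by rewrite picard_map_neg// subrr normr0 mulr_ge0 ?expR_ge0.
  rewrite (ger0_norm t0) /picard_map addrAC subrr add0r.
  have ql := @q_lip 0%N.
  rewrite (le_trans (Rintegral_segment_norm_le (c := B) t0
    (@continuous_integrable_segment R _ 0 t (along_continuous ql)) _))//.
  rewrite subr0 (_ : B * t = c * (2 * K * t)); last first.
    by rewrite /c; field; rewrite gt_eqF.
  rewrite ler_wpM2l// (le_trans _ (expR_ge1Dx _))//; lra.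
have [t0|t0] := ltP t 0.
  rewrite /= !picard_map_neg// subrr normr0 divr_ge0 ?exprn_ge0//.
  by rewrite mulr_ge0 ?expR_ge0.
have i1 := @continuous_integrable_segment R _ 0 t (along_continuous (@q_lip n.+1)).
have i0 := @continuous_integrable_segment R _ 0 t (along_continuous (@q_lip n)).
rewrite [q_ n.+2]/= [X in _ - X]/= -/(q_ n.+1) -/(q_ n) /picard_map opprD addrACA subrr add0r.
rewrite -RintegralB// (ger0_norm t0).
have i2 : mu.-integrable `[0, t]
   (EFin \o (fun s => v s (q_ n.+1 s) - v s (q_ n s))).
  apply: continuous_integrable_segment => s.
  by apply: continuousB; exact: along_continuous.
pose w (s : R) := c / 2 / 2 ^+ n * (expR (2 * K * s) * (2 * K)).
have wc : continuous w.
  move=> s; apply: cvgM; first exact: cvg_cst.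
  apply: cvgM; last exact: cvg_cst.
  apply: (@continuous_comp _ _ _ (fun s => 2 * K * s) expR); last exact: continuous_expR.
  by apply: cvgM; [exact: cvg_cst|exact: cvg_id].
apply: (@le_trans _ _ (\int[mu]_(s in `[0, t]) w s)).
  rewrite (le_trans (le_normr_Rintegral _ i2))//.
  apply: le_Rintegral => //.
  - exact: integrable_norm.
  - exact: continuous_integrable_segment.
  - move=> s; rewrite /= in_itv /= => /andP[s0 _].
    rewrite (le_trans (vlip _ _ _))//.
    have := IH s; rewrite (ger0_norm s0) => h.
    rewrite (le_trans (ler_wpM2l (ltW K0) h))// /w le_eqVlt; apply/orP; left; apply/eqP.
    by field; rewrite ?expf_neq0 ?gt_eqF.
have Fd (s : R) : is_derive s 1 (fun s => c / 2 / 2 ^+ n * expR (2 * K * s)) (w s).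
  apply: is_deriveZ.
  apply: (@is_derive1_comp _ expR (fun s => 2 * K * s)).
  by apply: is_derive_eq; rewrite /GRing.scale /= ?mulr0 ?addr0 mulr1.
rewrite (Rintegral_segment_FTC t0 wc Fd) mulr0 expR0 exprS.
have := @divr_ge0 _ c (2 ^+ n) c0; rewrite exprn_ge0// => /(_ erefl) h.
rewrite (_ : c * expR _ / _ = c / 2 / 2 ^+ n * expR (2 * K * t)); last first.
  by field; rewrite ?expf_neq0 ?gt_eqF.
by lra.
Qed.

Lemma picard : exists q : R -> R, [/\ q 0 = x0,
  forall t : R, 0 < t -> is_derive t 1 q (v t (q t)) &
  forall s t, `|q t - q s| <= B * `|t - s| ].
Proof.
have qE t : exists l, forall n, `|q_ n t - l| <= 2 * (c * expR (2 * K * `|t|)) / 2 ^+ n.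
  by apply: geometric_cauchy => //; rewrite mulr_ge0// expR_ge0.
have [q Hq] := choice qE.
have Ct (t : R) : 0 <= 2 * (c * expR (2 * K * `|t|)) by rewrite mulr_ge0// mulr_ge0 ?expR_ge0.
have ql : Blip q.
  move=> s t; apply/ler_addgt0Pr => e e0; have e2 : 0 < e / 2 by rewrite divr_gt0.
  have [n Hn] := geometric_small (2 * (c * expR (2 * K * `|t|))) e2.
  have [m Hm] := geometric_small (2 * (c * expR (2 * K * `|s|))) e2.
  pose k := maxn n m.
  have mono (C : R) n' : 0 <= C -> (n' <= k)%N -> C / 2 ^+ k <= C / 2 ^+ n'.
    move=> C0 n'k; rewrite ler_wpM2l// lef_pV2 ?posrE ?exprn_gt0//.
    by rewrite ler_weXn2l// ler1n.
  have h1 := le_trans (le_trans (Hq t k) (mono _ n _ (leq_maxl _ _))) Hn.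
  have h2 := le_trans (le_trans (Hq s k) (mono _ m _ (leq_maxr _ _))) Hm.
  have h3 := @q_lip k s t.
  have {}h1 : `|q_ k t - q t| <= e / 2 := h1 (Ct t).
  have {}h2 : `|q_ k s - q s| <= e / 2 := h2 (Ct s).
  rewrite (_ : q t - q s = (q_ k s - q s) - (q_ k t - q t) + (q_ k t - q_ k s)); last by ring.
  have n1 := ler_normD ((q_ k s - q s) - (q_ k t - q t)) (q_ k t - q_ k s).
  have n2 := ler_normB (q_ k s - q s) (q_ k t - q t).
  lra.
have qfix t : q t = picard_map q t.
  apply/eqP; rewrite -subr_eq0 -normr_eq0 eq_le normr_ge0 andbT.
  apply/ler_addgt0Pr => e e0; rewrite add0r.
  pose A := 2 * (c * expR (2 * K * `|t|)).
  have A0 : 0 <= A := Ct t.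
  (* The first summand pays for replacing [q t] by an iterate, the second for replacing [q] by an
     iterate under the integral. *)
  have [n Hn] := geometric_small (A + K * A * `|t|) e0.
  have E n' : q_ n'.+1 t = picard_map (q_ n') t by [].
  rewrite (_ : q t - _ = - (q_ n.+1 t - q t) + (picard_map (q_ n) t - picard_map q t)); last first.
    by rewrite E; ring.
  rewrite (le_trans (ler_normD _ _))// normrN (le_trans _ Hn)// mulrDl lerD//.
    rewrite (le_trans (Hq t n.+1))// -/A ler_wpM2l// lef_pV2 ?posrE ?exprn_gt0//.
    by rewrite ler_weXn2l// ler1n.
  have [t0|t0] := ltP t 0.
    by rewrite !picard_map_neg// subrr normr0 divr_ge0 ?exprn_ge0// mulr_ge0// mulr_ge0// ltW.
  rewrite /picard_map opprD addrACA subrr add0r -RintegralB//; first last.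
  - exact: continuous_integrable_segment (along_continuous ql).
  - exact: continuous_integrable_segment (along_continuous (@q_lip n)).
  rewrite (ger0_norm t0) (_ : K * A * t / _ = K * (A / 2 ^+ n) * (t - 0)); last by rewrite subr0; ring.
  apply: Rintegral_segment_norm_le => //.
    apply: continuous_integrable_segment => s.
    by apply: continuousB; apply: along_continuous.
  move=> s /andP[s0 st]; rewrite (le_trans (vlip _ _ _))// ler_wpM2l ?(ltW K0)//.
  rewrite (le_trans (Hq s n))// ler_wpM2r ?invr_ge0 ?exprn_ge0// /A.
  rewrite ler_wpM2l// ler_wpM2l// ler_expR ler_wpM2l ?mulr_ge0 ?(ltW K0)//.
  by rewrite !ger0_norm.
exists q; split=> [|t t0|//].
- by rewrite qfix /picard_map Rintegral_segment1 addr0.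
- have -> : q = fun t => x0 + \int[mu]_(s in `[0, t]) v s (q s).
    by apply/funext => s; exact: qfix.
  have := Rintegral_segment_deriv (along_continuous ql) t0.
  rewrite -/(picard_map q t) -qfix => h.
  rewrite -[v t (q t)]add0r; exact: is_deriveD.
Qed.

End picard.

(** The squared negative part is differentiable across [0], with error at most [(y - x) ^+ 2]
    whatever the signs; a lower bound can thus be proved by differentiation without tracking sign
    changes. *)
Lemma is_derive_min0_sqr (R : realType) (x : R) :
  is_derive x 1 (fun y => Num.min y 0 ^+ 2) (2 * Num.min x 0).
Proof.
apply/is_deriveP => e e0; exists e => // y yx.
apply: (@le_trans _ _ ((y - x) ^+ 2)); last first.
  by rewrite -(real_normK (num_real _)) expr2 ler_wpM2r// ltW.
have s0 := sqr_ge0 (y - x); have s1 := sqr_ge0 x; have s2 := sqr_ge0 y.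
rewrite ler_norml; have [y0|/ltW y0] := leP y 0; have [x0|/ltW x0] := leP x 0.
- by apply/andP; split; lra.
- by have := mulr_le0_ge0 y0 x0; move=> h; apply/andP; split; lra.
- by have := mulr_ge0_le0 y0 x0; move=> h; apply/andP; split; lra.
- by apply/andP; split; lra.
Qed.

(* Gronwall for the squared negative part. *)
Lemma gronwall_lower (R : realType) (y c err : R -> R) (T C e : R) :
  0 < T -> 0 <= C -> 0 <= e -> {within `[0, T], continuous y} ->
  (forall t : R, 0 < t < T -> is_derive t 1 y (c t * y t + err t)) ->
  (forall t, 0 < t < T -> `|c t| <= C) -> (forall t, 0 < t < T -> `|err t| <= e) ->
  0 <= y 0 -> - (e * (expR ((2 * C + 1) * T) * (T + 1))) <= y T.
Proof.
move=> T0 C0 e0 yc yd cC erre y0.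
(* In this rate, [2 * C] absorbs the linear term and [1] absorbs the square in
   [2 * m * err <= m ^+ 2 + err ^+ 2]; what remains is [e ^+ 2] per unit of time. *)
pose k := 2 * C + 1.
pose f t := expR (- k * t) * Num.min (y t) 0 ^+ 2 - e ^+ 2 * t.
pose df t := expR (- k * t) * (2 * Num.min (y t) 0 * (c t * y t + err t)) +
   Num.min (y t) 0 ^+ 2 * (expR (- k * t) * (- k)) - e ^+ 2.
have fd (t : R) : 0 < t < T -> is_derive t 1 (fun t => - f t) (- df t).
  move=> tT; have ydt := yd t tT.
  apply: is_deriveN; apply: is_deriveB.
    have h1 : is_derive t 1 (fun t => expR (- k * t)) (expR (- k * t) * (- k)).
      apply: (@is_derive1_comp _ expR (fun t => - k * t)).
      by apply: is_derive_eq; rewrite /GRing.scale /= ?mulr0 ?addr0 mulr1.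
    apply: is_deriveM.
    apply: (@is_derive1_comp _ (fun z => Num.min z 0 ^+ 2) y).
    exact: is_derive_min0_sqr.
  by apply: is_derive_eq; rewrite /GRing.scale /= ?mulr0 ?addr0 mulr1.
have f0 : - f 0 <= - f T.
  apply: (derive_ge0_le (df := fun t => - df t) (ltW T0) fd).
  - move=> t tT; rewrite oppr_ge0 /df.
    have h1 := cC t tT; have h2 := erre t tT.
    have E1 : expR (- k * t) <= 1.
      by rewrite -expR0 ler_expR mulNr oppr_le0 mulr_ge0 /k//; lra.
    have E0 := expR_ge0 (- k * t).
    set m := Num.min (y t) 0.
    have my : m * y t = m ^+ 2.
      by rewrite /m expr2; have [y1|y1] := leP (y t) 0; rewrite ?mul0r.
    have a1 : 2 * (c t * (m ^+ 2)) <= 2 * (C * m ^+ 2).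
      rewrite ler_wpM2l// ler_wpM2r ?sqr_ge0//.
      by rewrite (le_trans (ler_norm _)).
    have a2 : 2 * (m * err t) <= m ^+ 2 + e ^+ 2.
      have : err t ^+ 2 <= e ^+ 2.
        by rewrite -(real_normK (num_real (err t))) lerXn2r// ?nnegrE.
      have := sqr_ge0 (m - err t); rewrite sqrrB mulr2n; lra.
    have -> : expR (- k * t) * (2 * m * (c t * y t + err t)) + m ^+ 2 * (expR (- k * t) * - k) - e ^+ 2
      = expR (- k * t) * (2 * (c t * (m * y t)) + 2 * (m * err t) - k * m ^+ 2) - e ^+ 2.
      by ring.
    rewrite my subr_le0.
    have a3 : 2 * (c t * m ^+ 2) + 2 * (m * err t) - k * m ^+ 2 <= e ^+ 2 by rewrite /k; lra.
    rewrite (le_trans (ler_wpM2l E0 a3))//.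
    by rewrite ler_piMl// sqr_ge0.
  - have c1 : {within `[0, T], continuous (fun t => expR (- k * t))}.
      apply: continuous_subspaceT => t.
      apply: (@continuous_comp _ _ _ (fun s => - k * s) expR); last exact: continuous_expR.
      by apply: cvgM; [exact: cvg_cst|exact: cvg_id].
    have c2 : {within `[0, T], continuous (fun t => Num.min (y t) 0 ^+ 2)}.
      move=> t.
      apply: (@continuous_comp (subspace `[0, T]) R R y (fun z : R => Num.min z 0 ^+ 2)); first exact: yc.
      exact: is_derive_continuous (is_derive_min0_sqr _).
    have c3 : {within `[0, T], continuous (fun t : R => e ^+ 2 * t)}.
      by apply: continuous_subspaceT => t; apply: cvgM; [exact: cvg_cst|exact: cvg_id].
    move=> t; apply: cvgN; apply: cvgB; last exact: c3.
    by apply: cvgM; [exact: c1|exact: c2].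
move: f0; rewrite lerN2 /f !mulr0 expR0 mul1r subr0 (min_idPr y0) expr0n /= => fT.
have {}fT : Num.min (y T) 0 ^+ 2 <= e ^+ 2 * T * expR (k * T).
  rewrite -ler_pdivrMr ?expR_gt0// mulrC -expRN -mulNr; lra.
(* Square roots are avoided: [T <= (T + 1) ^+ 2] and [1 <= expR (k * T)] make
   [e ^+ 2 * T * expR (k * T)] at most the square of [e * A]. *)
set A := expR (k * T) * (T + 1).
have A1 : T * expR (k * T) <= A ^+ 2.
  have E1 : 1 <= expR (k * T) by rewrite -expR0 ler_expR mulr_ge0 /k//; lra.
  have h : T <= (T + 1) ^+ 2 by nra.
  have h2 : expR (k * T) <= expR (k * T) ^+ 2 by rewrite expr2 ler_peMl// expR_ge0.
  rewrite /A exprMn mulrC ler_pM ?expR_ge0//; lra.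
have {}fT : Num.min (y T) 0 ^+ 2 <= (e * A) ^+ 2.
  rewrite (le_trans fT)// exprMn -mulrA ler_wpM2l ?sqr_ge0//.
have A0 : 0 <= A by rewrite mulr_ge0 ?expR_ge0//; lra.
rewrite -/k -/A; have [y1|y1] := leP 0 (y T); first by rewrite (le_trans _ y1)// oppr_le0 mulr_ge0.
have ny : 0 <= - y T by rewrite oppr_ge0 ltW.
have eA0 : 0 <= e * A by exact: mulr_ge0.
by move: fT; rewrite (min_idPl (ltW y1)) -sqrrN ler_sqr ?nnegrE// => h; lra.
Qed.

Section characteristics.
Context {R : realType} {b : R} {W U V P Q : R -> R -> R}.
Hypothesis hb : 0 < b < 3.
Hypothesis H : bfam b W U V P Q.
Variables (T K : R).
Hypothesis T0 : 0 < T.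
Hypothesis K0 : 0 < K.
Hypothesis HK : forall t x, 0 <= t <= T -> `|U t x| <= K /\ `|V t x| <= K.

(** No derivative is asked at [0] and [T]; the Lipschitz clause carries the curve continuously to
    these ends. *)
Definition characteristic (q : R -> R) :=
  (forall t : R, 0 < t < T -> is_derive t 1 q (U t (q t))) /\
  (forall s t, `|q t - q s| <= K * `|t - s|).

(** The forward iteration of [picard] is run from [x] on the time-reversed field. Clipping the time
    to [[0, T]] makes the bound [K] valid on the whole line and changes nothing strictly inside. *)
Lemma characteristic_ending (x : R) : exists2 q, characteristic q & q T = x.
Proof.
pose clip s := Num.max 0 (Num.min T s).
have clip_itv s : 0 <= clip s <= T.
  by rewrite /clip le_max lexx ge_max ge_min lexx (ltW T0).
have clip_lip s t : `|clip s - clip t| <= `|s - t|.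
  rewrite /clip; wlog st : s t / s <= t.
    by move=> h; have [/h//|/ltW/h] := leP s t; rewrite distrC (distrC s).
  rewrite -normrN opprB -(normrN (s - t)) opprB [leRHS]ger0_norm ?subr_ge0//.
  have [a1|a1] := leP T s; have [a2|a2] := leP T t.
  - by rewrite subrr normr0; lra.
  - lra.
  - have [a3|a3] := leP 0 s; have [a4|a4] := leP 0 T; rewrite ger0_norm; lra.
  - have [a3|a3] := leP 0 s; have [a4|a4] := leP 0 t; rewrite ger0_norm; lra.
pose v s x := - U (clip (T - s)) x.
have [|||q [q0 qd ql]] := @picard R v K K x K0.
- move=> t y z; rewrite /v -opprD normrN.
  apply: (derive_bound_lip (df := V (clip (T - t)))) => w.
    by apply: (bfam_U H); have /andP[] := clip_itv (T - t).
  by have [] := HK w (clip_itv (T - t)).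
- move=> y t; apply/continuousP_eps => e e0.
  have /andP[c0 _] := clip_itv (T - t).
  have [dl dl0 Hdl] := bfam_cont H c0 e0.
  exists dl => // s st.
  have /andP[c0' _] := clip_itv (T - s).
  rewrite /v -opprD normrN; have [||//] := Hdl (clip (T - s)) y y c0'.
    by rewrite (le_lt_trans (clip_lip _ _))// opprD addrACA subrr add0r -opprD normrN.
  by rewrite subrr normr0.
- by move=> t y; rewrite normrN; have [] := HK y (clip_itv (T - t)).
exists (fun t => q (T - t)); last by rewrite subrr.
split=> [t /andP[t0 tT]|s t].
- have Tt : 0 < T - t by rewrite subr_gt0.
  have -> : U t (q (T - t)) = v (T - t) (q (T - t)) * (-1).
    rewrite /v mulrN1 opprK; congr (U _ _).
    by rewrite /clip opprB addrC subrK (min_idPr (ltW tT)) (max_idPr (ltW t0)).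
  apply: (@is_derive1_comp _ q (fun t => T - t)); first exact: qd.
  by rewrite -[- 1]sub0r; apply: is_deriveB.
- by rewrite (le_trans (ql _ _))// opprD addrACA subrr add0r -opprD normrN.
Qed.

(** For the gap [D], [expR (2 * K * s) * D ^+ 2] is nondecreasing and [expR (- 2 * K * s) * D ^+ 2]
    nonincreasing. The lower estimate keeps characteristics from meeting, the upper one keeps them
    close when their ends are close. *)
Lemma characteristic_gap (q1 q2 : R -> R) : characteristic q1 -> characteristic q2 ->
  forall t, 0 <= t <= T ->
  expR (- (K * T)) * `|q2 T - q1 T| <= `|q2 t - q1 t| <= expR (K * T) * `|q2 T - q1 T|.
Proof.
move=> [d1 l1] [d2 l2] t /andP[t0 tT].
pose D s := q2 s - q1 s.
pose dD s := U s (q2 s) - U s (q1 s).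
have Dd (s : R) : 0 < s < T -> is_derive s 1 D (dD s).
  by move=> sT; apply: is_deriveB; [exact: d2|exact: d1].
have dDle s : 0 < s < T -> `|dD s| <= K * `|D s|.
  move=> /andP[s0 sT]; apply: (derive_bound_lip (df := V s)) => z.
    by apply: (bfam_U H); exact: ltW.
  by have [] := HK z (introT andP (conj (ltW s0) (ltW sT))).
have Dc : {within `[t, T], continuous D}.
  apply/within_continuousP_eps => s _ e e0.
  exists (e / (2 * K)); first by rewrite divr_gt0// mulr_gt0.
  move=> z _; rewrite ltr_pdivlMr ?mulr_gt0// => h.
  rewrite /D (_ : _ - _ = (q2 z - q2 s) - (q1 z - q1 s)); last by ring.
  rewrite (le_trans (ler_normB _ _))//; have := l1 s z; have := l2 s z; lra.
pose f s a := expR (2 * a * s) * D s ^+ 2.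
have fd a (s : R) : 0 < s < T -> is_derive s 1 (f^~ a)
    (expR (2 * a * s) * (2 * (a * D s ^+ 2 + D s * dD s))).
  move=> sT; have hD := Dd s sT.
  have h1 : is_derive s 1 (fun s => expR (2 * a * s)) (expR (2 * a * s) * (2 * a)).
    apply: (@is_derive1_comp _ expR (fun t => 2 * a * t)).
    by apply: is_derive_eq; rewrite /GRing.scale /= ?mulr0 ?addr0 mulr1.
  have h2 : is_derive s 1 (fun s => D s ^+ 2) (2 * D s ^+ 1 * dD s).
    exact: (@is_deriveX _ _ D 2).
  rewrite (_ : _ * _ = expR (2 * a * s) * (2 * D s ^+ 1 * dD s) +
     D s ^+ 2 * (expR (2 * a * s) * (2 * a))); last by rewrite expr1; ring.
  exact: is_deriveM.
have fc a : {within `[t, T], continuous (f^~ a)}.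
  have c1 : {within `[t, T], continuous (fun s => expR (2 * a * s))}.
    apply: continuous_subspaceT => s.
    apply: (@continuous_comp _ _ _ (fun s => 2 * a * s) expR); last exact: continuous_expR.
    by apply: cvgM; [exact: cvg_cst|exact: cvg_id].
  move=> s; apply: cvgM; first exact: c1.
  by rewrite expr2; apply: cvgM; exact: Dc.
have DdD s : 0 < s < T -> `|D s * dD s| <= K * D s ^+ 2.
  move=> sT; rewrite normrM -(real_normK (num_real (D s))) expr2 mulrCA.
  by rewrite ler_wpM2l// dDle.
have sub s : t < s < T -> 0 < s < T by move=> /andP[ts ->]; rewrite (le_lt_trans t0 ts).
have up : f t K <= f T K.
  apply: (derive_ge0_le tT (fun s h => fd K s (sub s h)) _ (fc K)) => s /sub sT.
  rewrite mulr_ge0 ?expR_ge0// mulr_ge0//.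
  by have := DdD s sT; rewrite ler_norml; lra.
have dn : - f t (- K) <= - f T (- K).
  apply: (derive_ge0_le tT (f := fun s => - f s (- K))
    (df := fun s => - (expR (2 * - K * s) * (2 * (- K * D s ^+ 2 + D s * dD s))))).
  - by move=> s /sub sT; apply: is_deriveN; exact: fd.
  - move=> s /sub sT; rewrite -mulrN mulr_ge0 ?expR_ge0// -mulrN mulr_ge0//.
    by have := DdD s sT; rewrite ler_norml; lra.
  - by move=> s; apply: cvgN; exact: fc.
have sqE a s : f s a = (expR (a * s) * `|D s|) ^+ 2.
  by rewrite /f exprMn (real_normK (num_real _)) -expRM_natl mulrA.
move: up dn; rewrite lerN2 !sqE ler_sqr ?nnegrE ?mulr_ge0 ?expR_ge0//.
rewrite ler_sqr ?nnegrE ?mulr_ge0 ?expR_ge0// => up dn.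
have e1 : 1 <= expR (K * t) by rewrite -expR0 ler_expR mulr_ge0// ltW.
have e2 : expR (- K * t) <= 1 by rewrite -expR0 ler_expR mulNr oppr_le0 mulr_ge0// ltW.
apply/andP; split.
  by rewrite -mulNr (le_trans dn)// ler_piMl.
by rewrite (le_trans _ up)// ler_peMl.
Qed.

End characteristics.

(** * Persistence of the sign of the momentum *)

Section momentum_sign.
Context {R : realType} {b : R} {W U V P Q : R -> R -> R}.
Hypothesis hb : 0 < b < 3.
Hypothesis H : bfam b W U V P Q.

(** Two points [x] and [y] appear because the quotients of [Q] and of [U] between two
    characteristics are derivatives at different intermediate points. *)
Lemma bfam_PUV_cont (t0 x0 e : R) : 0 <= t0 -> 0 < e -> exists2 dl : R, 0 < dl &
  forall t x y, 0 <= t -> `|t - t0| < dl -> `|x - x0| < dl -> `|y - x0| < dl ->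
    `|b_source b (U t x) (V t x) - P t x - V t y ^+ 2 -
      (b_source b (U t0 x0) (V t0 x0) - P t0 x0 - V t0 x0 ^+ 2)| <= e.
Proof.
move=> t00 e0; have [K K0 HK] := bfam_UV_bdd H (t0 + 1).
pose a := e / (5 * K + 1).
have D0 : 0 < 5 * K + 1 by rewrite ltr_wpDl// mulr_ge0// ltW.
have a0 : 0 < a by rewrite divr_gt0.
have [dl dl0 Hdl] := bfam_cont H t00 a0.
have [dl' dl'0 Hdl'] := bfam_PQ_cont hb H t00 a0.
exists (Num.min (Num.min dl 1) dl'); first by rewrite !lt_min dl0 ltr01.
move=> t x y t_ge0; rewrite !lt_min => /andP[/andP[td t1] td'].
move=> /andP[/andP[xd _] xd'] /andP[/andP[yd _] yd'].
have tT : 0 <= t <= t0 + 1.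
  by rewrite t_ge0 /= -lerBlDl (le_trans (ler_norm _))// ltW.
have t0T : 0 <= t0 <= t0 + 1 by rewrite t00 lerDl ler01.
have [h1 h2] := Hdl t x x0 t_ge0 td xd; have [h3 _] := Hdl' t x x0 t_ge0 td' xd'.
have [_ h4] := Hdl t y x0 t_ge0 td yd.
have [k1 k2] := HK t x tT; have [k3 k4] := HK t0 x0 t0T; have [_ k5] := HK t y tT.
have p1 := b_source_lip hb k1 k2 k3 k4 h1 h2.
have p2 := sqr_lip k5 k4 h4.
rewrite (_ : _ - _ = (b_source b (U t x) (V t x) - b_source b (U t0 x0) (V t0 x0)) -
  (P t x - P t0 x0) - (V t y ^+ 2 - V t0 x0 ^+ 2)); last by ring.
have aE : a * (5 * K + 1) = e by rewrite /a divfK// gt_eqF.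
have n1 := ler_normB (b_source b (U t x) (V t x) - b_source b (U t0 x0) (V t0 x0) -
  (P t x - P t0 x0)) (V t y ^+ 2 - V t0 x0 ^+ 2).
have n2 := ler_normB (b_source b (U t x) (V t x) - b_source b (U t0 x0) (V t0 x0))
  (P t x - P t0 x0).
lra.
Qed.

Lemma bfam_F_cont (t x e : R) : 0 < t -> 0 < e -> exists2 dl : R, 0 < dl &
  forall w z, `|w - t| < dl -> `|z - x| < dl ->
    `|- (2^-1 * U w z ^+ 2 + P w z) - - (2^-1 * U t x ^+ 2 + P t x)| <= e.
Proof.
move=> t0 e0; have [dl dl0 Hdl] := bfam_flux_cont hb H (ltW t0) e0.
exists (Num.min dl t); first by rewrite lt_min dl0.
move=> w z; rewrite !lt_min => /andP[w1 w2] /andP[z1 _].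
rewrite -opprD normrN; apply: Hdl => //.
by move: w2; rewrite ltr_norml; lra.
Qed.

Lemma bfam_W_curve (q : R -> R) (t dq : R) : 0 < t -> is_derive t 1 q dq ->
  is_derive t 1 (fun s => W s (q s))
    (- (2^-1 * U t (q t) ^+ 2 + P t (q t)) + U t (q t) * dq).
Proof.
move=> t0 qd.
apply: (is_derive_curve (ft := fun t x => - (2^-1 * U t x ^+ 2 + P t x)) (r := t)) => //.
- move=> w x wz; apply: (bfam_Wt H).
  by move: wz; rewrite ltr_norml; lra.
- by move=> e e0; exact: bfam_F_cont.
- by apply: (bfam_W H); exact: ltW.
Qed.

Variables (T K : R).
Hypothesis T0 : 0 < T.
Hypothesis K0 : 0 < K.
Hypothesis HK : forall t x, 0 <= t <= T -> `|U t x| <= K /\ `|V t x| <= K.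

(* [U_xx] need not exist pointwise, so [V] is differentiated along the flow as
   the limit of the quotients [(U t (q2 t) - U t (q t)) / (q2 t - q t)]. *)
Lemma characteristic_V (q : R -> R) (t : R) : characteristic (U := U) T K q -> 0 < t < T ->
  is_derive t 1 (fun s => V s (q s))
    (b_source b (U t (q t)) (V t (q t)) - P t (q t) - V t (q t) ^+ 2).
Proof.
move=> qch /andP[t0 tT]; have [qd ql] := qch; have t0' := ltW t0.
set psi := b_source _ _ _ - _ - _.
apply/is_deriveP => e e0.
have [dl dl0 Hdl] := bfam_PUV_cont (q t) t0' e0.
pose d1 := Num.min (Num.min dl (dl / 2 / K)) (Num.min t (T - t)).
have d10 : 0 < d1 by rewrite !lt_min dl0 !divr_gt0//= t0 subr_gt0.
exists d1 => // s; rewrite !lt_min => /andP[/andP[s1 s2] /andP[s3 s4]].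
have between z : `|z - t| <= `|s - t| -> 0 < z < T.
  move=> zs; have := le_lt_trans zs s3; have := le_lt_trans zs s4.
  by rewrite !ltr_norml; lra.
have sT := between s (lexx _).
(* The neighbouring characteristic is chosen after [s]: taken close enough, its quotient [r] is
   within [d / 2] of [V] along [q] at both times [s] and [t]. *)
apply/ler_addgt0Pr => d dd0.
have d4 : 0 < d / 2 by rewrite divr_gt0.
have [m m0 Hm] := bfam_modulus H T d4.
(* the auxiliary characteristic ends at distance [eta] from [q] *)
pose G := expR (K * T).
have G0 : 0 < G by exact: expR_gt0.
pose eta := Num.min m (dl / 2) / (2 * G).
have mm0 : 0 < Num.min m (dl / 2) by rewrite lt_min m0 divr_gt0.
have eta0 : 0 < eta by rewrite divr_gt0// mulr_gt0.
have [q2 q2ch q2T] := characteristic_ending H T0 K0 HK (q T + eta).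
have [q2d q2l] := q2ch.
have gap z : 0 <= z <= T -> 0 < `|q2 z - q z| < Num.min m (dl / 2).
  move=> zT; have /andP[g1 g2] := characteristic_gap H K0 HK qch q2ch zT.
  rewrite q2T addrAC subrr add0r (gtr0_norm eta0) in g1 g2.
  rewrite (lt_le_trans _ g1) ?(mulr_gt0 (expR_gt0 _) eta0)//=.
  rewrite (le_lt_trans g2)// -/G.
  have -> : G * eta = Num.min m (dl / 2) / 2 by rewrite /eta; field; rewrite gt_eqF.
  by rewrite ltr_pdivrMr// ltr_pMr// ltr1n.

pose r z := (U z (q2 z) - U z (q z)) / (q2 z - q z).
pose dr z := - ((Q z (q2 z) - Q z (q z)) / (q2 z - q z)) - r z ^+ 2.
have rd (z : R) : `|z - t| <= `|s - t| -> is_derive z 1 r (dr z).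
  move=> /between zT; have /andP[z0 zT'] := zT.
  (* Along its own characteristic [U] has derivative [- (U * V + Q) + V * U = - Q]; the quotient
     rule then gives [dr], with [- r ^+ 2] coming from the derivative of the gap. *)
  have Uq (p : R -> R) : characteristic (U := U) T K p -> is_derive z 1 (fun s => U s (p s)) (- Q z (p z)).
    move=> [pd pl].
    rewrite (_ : - _ = - (U z (p z) * V z (p z) + Q z (p z)) + V z (p z) * U z (p z)); last by ring.
    apply: (is_derive_curve (ft := fun t x => - (U t x * V t x + Q t x)) (r := z)) => //.
    - move=> w x wz; apply: (bfam_Ut hb H).
      by move: wz; rewrite ltr_norml; lra.
    - move=> e' e'0; have [dl2 dl20 Hdl2] := bfam_Ux_cont hb H (p z) (ltW z0) e'0.
      exists (Num.min dl2 z); first by rewrite lt_min dl20.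
      move=> w x; rewrite !lt_min => /andP[w1 w2] /andP[x1 _].
      rewrite -opprD normrN; apply: Hdl2 => //.
      by move: w2; rewrite ltr_norml; lra.
    - by apply: (bfam_U H); exact: ltW.
    - exact: pd.
  have D0 : q2 z - q z != 0.
    by rewrite -normr_gt0; have /andP[] := gap z (introT andP (conj (ltW z0) (ltW zT'))).
  have h1 : is_derive z 1 (fun z => U z (q2 z) - U z (q z)) (- Q z (q2 z) - - Q z (q z)).
    by apply: is_deriveB; exact: Uq.
  have h2 : is_derive z 1 (fun z => q2 z - q z) (U z (q2 z) - U z (q z)).
    by apply: is_deriveB; [exact: q2d|exact: qd].
  have h3 : is_derive z 1 (fun z => (q2 z - q z)^-1)
      (- (q2 z - q z) ^- 2 *: (U z (q2 z) - U z (q z))).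
    exact: is_deriveV.
  rewrite (_ : dr z = (U z (q2 z) - U z (q z)) *: (- (q2 z - q z) ^- 2 *: (U z (q2 z) - U z (q z))) +
     (q2 z - q z)^-1 *: (- Q z (q2 z) - - Q z (q z))); last first.
    by rewrite /dr /r /GRing.scale /=; field.
  exact: is_deriveM.
have rV z : 0 <= z <= T -> exists y, `|y - q z| <= `|q2 z - q z| /\ r z = V z y.
  move=> zT; have /andP[gz _] := gap z zT; have /andP[z0 _] := zT.
  have [y [y1 _ E]] := mvt_unordered (x := q z) (y := q2 z) (fun y _ _ => bfam_U H y z0).
  by exists y; split => //; rewrite /r E mulfK// -normr_gt0.
(* By the mean value theorem [r] is a value of [V] and the quotient of [Q] a value of
   [P - b_source], both at points near [q z], so [dr] is near [psi]. *)
have drpsi z : `|z - t| <= `|s - t| -> `|dr z - psi| <= e.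
  move=> zs; have /andP[z0 zT'] := between z zs.
  have zT : 0 <= z <= T by rewrite !ltW.
  have /andP[gz1] := gap z zT; rewrite lt_min => /andP[_ gz2].
  have [y [y1 Ey]] := rV z zT.
  have [x [x1 _ Ex]] := mvt_unordered (x := q z) (y := q2 z) (fun y _ _ => bfam_Q H y (ltW z0)).
  rewrite /dr Ey Ex mulfK -?normr_gt0// opprB.
  have far w : `|w - q z| <= `|q2 z - q z| -> `|w - q t| < dl.
    move=> wz; rewrite (_ : w - q t = (w - q z) + (q z - q t)); last by ring.
    have n1 := ler_normD (w - q z) (q z - q t).
    have n2 := ql t z.
    have n3 : K * `|z - t| <= dl / 2.
      have := le_lt_trans zs s2; rewrite ltr_pdivlMr// mulrC => /ltW//.
    lra.
  apply: Hdl; [exact: ltW|exact: le_lt_trans zs s1|exact: far|exact: far].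
have [c [c1 _ Ec]] := mvt_unordered (x := t) (y := s) (fun z h _ => rd z h).
have rs z : 0 <= z <= T -> `|r z - V z (q z)| <= d / 2.
  move=> zT; have [y [y1 ->]] := rV z zT.
  have /andP[_] := gap z zT; rewrite lt_min => /andP[g1 _].
  by have [] := Hm z y (q z) zT (le_lt_trans y1 g1).
have sT' : 0 <= s <= T by move: sT => /andP[/ltW -> /ltW ->].
have tT' : 0 <= t <= T by rewrite !ltW.
have n1 := rs s sT'; have n2 := rs t tT'.
rewrite (_ : _ - _ - _ = (r t - V t (q t)) - (r s - V s (q s)) + (r s - r t - psi * (s - t))); last by ring.
have n3 : `|r s - r t - psi * (s - t)| <= e * `|s - t|.
  by rewrite Ec -mulrBl normrM ler_wpM2r// drpsi.
have n4 := ler_normD ((r t - V t (q t)) - (r s - V s (q s))) (r s - r t - psi * (s - t)).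
have n5 := ler_normB (r t - V t (q t)) (r s - V s (q s)).
lra.
Qed.

Lemma characteristic_W (q : R -> R) (t : R) : characteristic (U := U) T K q -> 0 < t < T ->
  is_derive t 1 (fun s => W s (q s)) (2^-1 * U t (q t) ^+ 2 - P t (q t)).
Proof.
move=> [qd ql] tT.
rewrite (_ : _ - _ = - (2^-1 * U t (q t) ^+ 2 + P t (q t)) + U t (q t) * U t (q t)); last by field.
by apply: bfam_W_curve; [case/andP: tT|exact: qd].
Qed.

End momentum_sign.

Section momentum_monotone.
Context {R : realType} {b : R} {W U V P Q : R -> R -> R}.
Hypothesis hb : 0 < b < 3.
Hypothesis H : bfam b W U V P Q.

Lemma bfam_W_cont (t0 x e : R) : 0 <= t0 -> 0 < e -> exists2 dl : R, 0 < dl &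
  forall t, 0 <= t -> `|t - t0| < dl -> `|W t x - W t0 x| <= e.
Proof.
rewrite le_eqVlt => /predU1P[<-|t00] e0.
  have [dl dl0 Hdl] := bfam_W0 H x e0; exists dl => // t t_ge0.
  by rewrite subr0 ger0_norm// => td; apply: Hdl; rewrite t_ge0.
have /is_derive_continuous/continuousP_eps/(_ _ e0)[dl dl0 Hdl] := bfam_Wt H x t00.
by exists dl => // t _; exact: Hdl.
Qed.

Let M t x := W t x - V t x.

Lemma bfam_W_curve_cont (T K : R) (q : R -> R) : 0 < K ->
  (forall t x, 0 <= t <= T -> `|U t x| <= K) ->
  (forall s t, `|q t - q s| <= K * `|t - s|) ->
  {within `[0, T], continuous (fun t => W t (q t))}.
Proof.
move=> K0 HK ql; apply/within_continuousP_eps => t0 /andP[t00 t0T] e e0.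
have e2 : 0 < e / 2 by rewrite divr_gt0.
have [d1 d10 H1] := bfam_W_cont (q t0) t00 e2.
have KK : 0 < K * K by rewrite mulr_gt0.
exists (Num.min d1 (e / 2 / (K * K))); first by rewrite lt_min d10 !divr_gt0.
move=> t /andP[t_ge0 tT]; rewrite lt_min => /andP[a1 a4].
have h1 := H1 t t_ge0 a1.
have h3 : `|W t (q t) - W t (q t0)| <= e / 2.
  apply: (@le_trans _ _ (K * `|q t - q t0|)).
    apply: (derive_bound_lip (df := U t)) => z; first exact: (bfam_W H).
    exact: HK t z (introT andP (conj t_ge0 tT)).
  have h : K * (K * `|t - t0|) <= e / 2.
    by rewrite mulrA mulrC -ler_pdivlMr// ltW.
  by rewrite (le_trans _ h)// ler_wpM2l// ltW.
rewrite (_ : _ - _ = (W t (q t) - W t (q t0)) + (W t (q t0) - W t0 (q t0))); last by ring.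
rewrite (le_trans (ler_normD _ _))//; lra.
Qed.

Lemma characteristic_M_cont (T K : R) (q : R -> R) : 0 < K ->
  (forall t x, 0 <= t <= T -> `|U t x| <= K /\ `|V t x| <= K) ->
  characteristic (U := U) T K q -> {within `[0, T], continuous (fun t => M t (q t))}.
Proof.
move=> K0 HK [qd ql].
have Wc : {within `[0, T], continuous (fun t => W t (q t))}.
  by apply: (bfam_W_curve_cont K0) => // t x tT; have [] := HK t x tT.
suff Vc : {within `[0, T], continuous (fun t => V t (q t))}.
  by move=> t; apply: cvgB; [exact: Wc|exact: Vc].
apply/within_continuousP_eps => t0 /andP[t00 t0T] e e0.
have [d2 d20 H2] := bfam_cont H t00 e0.
exists (Num.min d2 (d2 / K)); first by rewrite lt_min d20 divr_gt0.
move=> t /andP[t_ge0 tT]; rewrite lt_min => /andP[a2 a3].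
have qq : `|q t - q t0| < d2 by rewrite (le_lt_trans (ql _ _))// mulrC -ltr_pdivlMr.
by have [_ h2] := H2 t (q t) (q t0) t_ge0 a2 qq.
Qed.

(** For smooth solutions the momentum [N] in a short segment moving with the flow satisfies
    [N' = (1 - b) * u_x * N] to leading order. Here the increment of [W - V] between characteristics
    ending at [x1 < x2] plays the role of [N]; it is shown to be at least [- eta * (x2 - x1)], which
    is the Dini estimate for [- M T]. *)
Lemma momentum_monotone : (forall x y, x <= y -> M 0 x <= M 0 y) ->
  forall T, 0 <= T -> forall x y, x <= y -> M T x <= M T y.
Proof.
move=> M0 T; rewrite le_eqVlt => /predU1P[<-//|T0] x y xy.
have [K K0 HK] := bfam_UV_bdd H T.
rewrite -lerN2.
apply: (@dini_nonincreasing _ (fun x => - M T x) x y xy).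
  apply: continuous_subspaceT => z; apply: cvgN; apply: cvgB.
    exact: is_derive_continuous (bfam_W H z (ltW T0)).
  apply/continuousP_eps => e e0.
  have [dl dl0 Hdl] := bfam_modulus H T e0; exists dl => // w wz.
  have TT : 0 <= T <= T by rewrite lexx ltW.
  by have [] := Hdl T w z TT wz.
move=> eta eta0 x2 _.
(* [A] is the factor of [gronwall_lower] for a coefficient bounded by [2 * K], and [G] below bounds
   the growth of the gap backwards in time. The modulus [m] is such that [4 * K * m * G = eta / A],
   the allowed remainder per unit of [x2 - x1]. *)
pose A := expR ((2 * (2 * K) + 1) * T) * (T + 1).
have A0 : 0 < A by rewrite mulr_gt0 ?expR_gt0// addr_gt0.
pose G := expR (K * T).
have G0 : 0 < G by exact: expR_gt0.
pose m := eta / (4 * K * G * A).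
have D0 : 0 < 4 * K * G * A by rewrite mulr_gt0// mulr_gt0// mulr_gt0.
have m0 : 0 < m by rewrite divr_gt0.
have [dl dl0 Hdl] := bfam_modulus H T m0.
exists (dl / G); first by rewrite divr_gt0.
move=> x1 /andP[_ x12]; rewrite ltrBlDr -ltrBlDl ltr_pdivlMr// => x12d.
have [q1 c1 q1T] := characteristic_ending H T0 K0 HK x1.
have [q2 c2 q2T] := characteristic_ending H T0 K0 HK x2.
have gap := characteristic_gap H K0 HK c1 c2.
rewrite q1T q2T gtr0_norm ?subr_gt0// in gap.
pose N t := M t (q2 t) - M t (q1 t).
have Nc : {within `[0, T], continuous N}.
  move=> t; apply: cvgB.
    exact: (characteristic_M_cont K0 HK c2).
  exact: (characteristic_M_cont K0 HK c1).
have Nd (t : R) : 0 < t < T -> is_derive t 1 N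
   ((1 - b) / 2 * (U t (q2 t) ^+ 2 - V t (q2 t) ^+ 2) -
    (1 - b) / 2 * (U t (q1 t) ^+ 2 - V t (q1 t) ^+ 2)).
  move=> tT.
  have Md q : characteristic (U := U) T K q -> is_derive t 1 (fun t => M t (q t))
      ((1 - b) / 2 * (U t (q t) ^+ 2 - V t (q t) ^+ 2)).
    move=> qc; rewrite (_ : _ * _ = (2^-1 * U t (q t) ^+ 2 - P t (q t)) -
      (b_source b (U t (q t)) (V t (q t)) - P t (q t) - V t (q t) ^+ 2)); last first.
      by rewrite /b_source; field.
    apply: is_deriveB; first exact: (characteristic_W hb H qc tT).
    exact: (characteristic_V hb H T0 K0 HK qc tT).
  by apply: is_deriveB; exact: Md.
pose c t := (1 - b) / 2 * (V t (q1 t) + V t (q2 t)).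
pose err t := (1 - b) / 2 * ((U t (q2 t) - U t (q1 t)) * (U t (q1 t) + U t (q2 t)) -
   (W t (q2 t) - W t (q1 t)) * (V t (q1 t) + V t (q2 t))).
have b1 : `|(1 - b) / 2| <= 1 by rewrite ler_norml; move: hb; lra.
(* The initial monotonicity can be used only if the order persists back to time [0]: a reversal
   would force a meeting by the intermediate value theorem, against the lower gap estimate. *)
have q_lt : q1 0 <= q2 0.
  rewrite leNgt; apply/negP => q21.
  have qc : {within `[0, T], continuous (fun t => q2 t - q1 t)}.
    apply: continuous_subspaceT => t; apply/continuousP_eps => e e0.
    exists (e / (2 * K)); first by rewrite divr_gt0// mulr_gt0.
    move=> z; rewrite ltr_pdivlMr ?mulr_gt0// => h.
    rewrite (_ : _ - _ = (q2 z - q2 t) - (q1 z - q1 t)); last by ring.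
    rewrite (le_trans (ler_normB _ _))//; have := c1.2 t z; have := c2.2 t z; lra.
  have [|z] := @IVT _ _ 0 T 0 (ltW T0) qc.
    by rewrite q1T q2T ge_min le_max; apply/andP; split; apply/orP; [left|right]; lra.
  rewrite in_itv /= => zT /eqP z0; have /andP[g1 _] := gap z zT.
  move: g1; rewrite (eqP z0) normr0 leNgt mulr_gt0 ?expR_gt0 ?subr_gt0//.
have := @gronwall_lower _ N c err T (2 * K) (eta / A * (x2 - x1)) T0.
have -> : 0 <= 2 * K by rewrite mulr_ge0// ltW.
have -> : 0 <= eta / A * (x2 - x1) by rewrite mulr_ge0 ?subr_ge0 ?ltW// divr_gt0.
move=> /(_ erefl erefl Nc).
have h1 (t : R) : 0 < t < T -> is_derive t 1 N (c t * N t + err t).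
  move=> tT; have := Nd t tT; congr is_derive.
  by rewrite /c /err /N /M; ring.
have h2 t : 0 < t < T -> `|c t| <= 2 * K.
  move=> /andP[t0 tT]; have tT' : 0 <= t <= T by rewrite !ltW.
  have [_ k1] := HK t (q1 t) tT'; have [_ k2] := HK t (q2 t) tT'.
  rewrite /c normrM -[leRHS]mul1r ler_pM// (le_trans (ler_normD _ _))//; lra.
have h3 t : 0 < t < T -> `|err t| <= eta / A * (x2 - x1).
  move=> /andP[t0 tT]; have tT' : 0 <= t <= T by rewrite !ltW.
  have /andP[_ g2] := gap t tT'.
  rewrite -/G in g2.
  have gd : `|q2 t - q1 t| < dl by rewrite (le_lt_trans g2)// mulrC.
  have [xi [xi1 xi2 Exi]] := mvt_unordered (x := q1 t) (y := q2 t)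
    (fun y _ _ => bfam_U H y (ltW t0)).
  have [ze [ze1 ze2 Eze]] := mvt_unordered (x := q1 t) (y := q2 t)
    (fun y _ _ => bfam_W H y (ltW t0)).
  have [_ k1] := HK t xi tT'; have [k2 _] := HK t ze tT'.
  have [u1 _] := Hdl t (q1 t) ze tT' (le_lt_trans (eq_ind _ (fun z => z <= _) ze1 _ (distrC _ _)) gd).
  have [u2 _] := Hdl t (q2 t) ze tT' (le_lt_trans (eq_ind _ (fun z => z <= _) ze2 _ (distrC _ _)) gd).
  have [_ v1] := Hdl t (q1 t) xi tT' (le_lt_trans (eq_ind _ (fun z => z <= _) xi1 _ (distrC _ _)) gd).
  have [_ v2] := Hdl t (q2 t) xi tT' (le_lt_trans (eq_ind _ (fun z => z <= _) xi2 _ (distrC _ _)) gd).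
  (* The increments of [U] and [W] are [V t xi] and [U t ze] times the gap, so the leading terms
     [2 * V t xi * U t ze] cancel; four oscillation terms of size [K * m] remain. *)
  pose br := V t xi * (U t (q1 t) - U t ze) + V t xi * (U t (q2 t) - U t ze) -
    (U t ze * (V t (q1 t) - V t xi) + U t ze * (V t (q2 t) - V t xi)).
  have -> : err t = (1 - b) / 2 * (br * (q2 t - q1 t)).
    by rewrite /err Exi Eze /br; ring.
  have p1 : `|V t xi * (U t (q1 t) - U t ze)| <= K * m by rewrite normrM ler_pM.
  have p2 : `|V t xi * (U t (q2 t) - U t ze)| <= K * m by rewrite normrM ler_pM.
  have p3 : `|U t ze * (V t (q1 t) - V t xi)| <= K * m by rewrite normrM ler_pM.
  have p4 : `|U t ze * (V t (q2 t) - V t xi)| <= K * m by rewrite normrM ler_pM.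
  have brle : `|br| <= 4 * K * m.
    rewrite /br (le_trans (ler_normB _ _))//.
    have := ler_normD (V t xi * (U t (q1 t) - U t ze)) (V t xi * (U t (q2 t) - U t ze)).
    have := ler_normD (U t ze * (V t (q1 t) - V t xi)) (U t ze * (V t (q2 t) - V t xi)).
    lra.
  rewrite !(normrM _ (br * _)) (normrM br).
  apply: (@le_trans _ _ (1 * ((4 * K * m) * (G * (x2 - x1))))).
    by rewrite ler_pM ?mulr_ge0// ler_pM.
  rewrite mul1r /m le_eqVlt; apply/orP; left; apply/eqP; field.
  by rewrite ?gt_eqF.
have h4 : 0 <= N 0 by rewrite subr_ge0 M0.
move=> /(_ h1 h2 h3 h4); rewrite -/A /N q1T q2T.
have -> : eta / A * (x2 - x1) * A = eta * (x2 - x1) by field; rewrite gt_eqF.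
lra.
Qed.

End momentum_monotone.

(* [w - v] is a primitive of the momentum [u - u_xx]. *)
Lemma momentum_cone (R : realType) (w u v : R -> R) :
  (forall x : R, is_derive x 1 w (u x)) -> (forall x : R, is_derive x 1 u (v x)) ->
  continuous v -> (forall x y, x <= y -> w x - v x <= w y - v y) ->
  (forall e, 0 < e -> exists L, forall x, L <= `|x| -> `|u x| <= e /\ `|v x| <= e) ->
  forall x, 0 <= u x + v x.
Proof.
move=> wd ud vc mono decay x.
(* Formally [k' = - expR (- z) * (u - u_xx) <= 0]; as [k] tends to [0] at [+oo], it is
   nonnegative. *)
pose k z := expR (- z) * (u z + v z).
have Ec : continuous (fun z : R => expR (- z)).
  move=> z; apply: (@continuous_comp _ _ _ (fun z : R => - z) expR); last exact: continuous_expR.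
  by apply: cvgN; exact: cvg_id.
have Ed (z : R) : is_derive z 1 (fun z => expR (- z)) (- expR (- z)).
  rewrite -mulrN1; apply: (@is_derive1_comp _ expR (fun z => - z)).
have kc : continuous k.
  move=> z; apply: cvgM; first exact: Ec.
  by apply: cvgD; [exact: is_derive_continuous (ud z)|exact: vc].
have kdec y : x <= y -> k y <= k x.
  move=> xy; apply: (@dini_nonincreasing _ k x y xy); first exact: continuous_subspaceT.
  move=> eta eta0 t _.
  (* [Phi s] is [k t - k s] with [v t - v s] replaced by the larger [w t - w s]. Unlike [k], it is
     known to be differentiable at [t], with value and derivative [0] there. *)
  pose Phi s := expR (- t) * u t - expR (- s) * u s + expR (- s) * (w t - w s) +
    (expR (- t) - expR (- s)) * v t.
  have Pd : is_derive t 1 Phi 0.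
    rewrite (_ : 0 = 0 - (expR (- t) * v t + u t * (- expR (- t))) +
      (expR (- t) * (0 - u t) + (w t - w t) * (- expR (- t))) +
      (v t * (0 - (- expR (- t))) )); last by ring.
    apply: is_deriveD.
      apply: is_deriveD; first by apply: is_deriveB; apply: is_deriveM.
      by apply: is_deriveM; apply: is_deriveB.
    rewrite (_ : (fun s => _ * v t) = v t \*: (fun s => expR (- t) - expR (- s))); last first.
      by apply/funext => s; rewrite /GRing.scale /= mulrC.
    by apply: is_deriveZ; apply: is_deriveB.
  have /is_deriveP/(_ _ eta0)[dl dl0 Hdl] := Pd.
  exists dl => // s /andP[_ st] ts.
  have := Hdl s; rewrite distrC gtr0_norm ?subr_gt0// ltrBlDr -ltrBlDl => /(_ ts).
  rewrite mul0r subr0 (_ : Phi t = 0) ?subr0; last by rewrite /Phi; ring.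
  rewrite ler_norml => /andP[_].
  apply: le_trans; rewrite /Phi /k.
  have vm : v t - v s <= w t - w s by have := mono s t (ltW st); lra.
  have := ler_wpM2l (expR_ge0 (- s)) vm; lra.
have : 0 <= k x.
  rewrite -oppr_le0; apply/ler_addgt0Pr => e e0; rewrite add0r.
  have e2 : 0 < e / 2 by rewrite divr_gt0.
  have [L HL] := decay _ e2.
  pose y := Num.max x (Num.max L 0).
  have y0 : 0 <= y by rewrite !le_max lexx !orbT.
  have [|uy vy] := HL y; first by rewrite ger0_norm// !le_max lexx orbT.
  have := kdec y; rewrite /y le_max lexx -/y => /(_ erefl) h.
  rewrite lerNl (le_trans _ h)// /k.
  have E1 : expR (- y) <= 1 by rewrite -expR0 ler_expR oppr_le0.
  have E0 := expR_ge0 (- y).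
  move: uy vy; rewrite !ler_norml => /andP[uy _] /andP[vy _].
  have s : - e <= u y + v y by lra.
  rewrite (@le_trans _ _ (expR (- y) * (- e)))//; last by rewrite ler_wpM2l.
  by rewrite mulrN lerN2 ler_piMl// ltW.
by rewrite pmulr_rge0// expR_gt0.
Qed.

(** The bound on [v] from above is the cone inequality for the mirror image of [u], whose
    antiderivative is [- w (- x)]. *)
Lemma momentum_cone_norm (R : realType) (w u v : R -> R) :
  (forall x : R, is_derive x 1 w (u x)) -> (forall x : R, is_derive x 1 u (v x)) ->
  continuous v -> (forall x y, x <= y -> w x - v x <= w y - v y) ->
  (forall e, 0 < e -> exists L, forall x, L <= `|x| -> `|u x| <= e /\ `|v x| <= e) ->
  forall x, `|v x| <= u x.
Proof.
move=> wd ud vc mono decay x.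
have h1 := momentum_cone wd ud vc mono decay x.
have := @momentum_cone _ (fun x => - w (- x)) (fun x => u (- x)) (fun x => - v (- x)).
have a1 (z : R) : is_derive z 1 (fun x => - w (- x)) (u (- z)).
  by rewrite -[u _]opprK; apply: is_deriveN; exact: is_derive_reflect.
have a2 (z : R) : is_derive z 1 (fun x => u (- x)) (- v (- z)) by exact: is_derive_reflect.
have a3 : continuous (fun z : R => - v (- z)).
  move=> z; apply: cvgN; apply: (@continuous_comp _ _ _ (fun z : R => - z) v); last exact: vc.
  by apply: cvgN; exact: cvg_id.
have a4 y z : y <= z -> - w (- y) - - v (- y) <= - w (- z) - - v (- z).
  by move=> yz; have := mono (- z) (- y); rewrite lerN2 => /(_ yz); lra.
have a5 e : 0 < e -> exists L, forall x, L <= `|x| -> `|u (- x)| <= e /\ `|- v (- x)| <= e.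
  move=> /decay[L HL]; exists L => y; rewrite -normrN => /HL[? ?].
  by rewrite normrN.
move=> /(_ a1 a2 a3 a4 a5 (- x)); rewrite opprK ler_norml; lra.
Qed.

Lemma is_derive_mull (R : realType) (c x : R) : is_derive x 1 (fun s => c * s) (c * 1).
Proof. exact: (@is_deriveZ _ _ _ id c x 1 1 (is_derive_id x 1)). Qed.

(** * Finite speed of the mass *)

Section spreading.
Context {R : realType} {b : R} {W U V P Q : R -> R -> R} {A : R}.
Hypothesis hb : 0 < b < 3.
Hypothesis H : bfam b W U V P Q.
Hypothesis M0 : forall x y, x <= y -> W 0 x - V 0 x <= W 0 y - V 0 y.
Hypothesis A0 : 0 <= A.
Hypothesis W0A : forall x y, W 0 y - W 0 x <= A.

Lemma bfam_V_le_U (t x : R) : 0 <= t -> `|V t x| <= U t x.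
Proof.
move=> t0; apply: (momentum_cone_norm (w := W t)) => [z|z|z|y z yz|e e0].
- exact: (bfam_W H).
- exact: (bfam_U H).
- apply/continuousP_eps => e e0.
  have [dl dl0 Hdl] := bfam_cont H t0 e0; exists dl => // y yz.
  by have [] := Hdl t y z t0 _ yz; rewrite ?subrr ?normr0.
- exact: (momentum_monotone hb H M0).
- exact: (bfam_decay H t0 e0).
Qed.

Lemma bfam_U_ge0 (t x : R) : 0 <= t -> 0 <= U t x.
Proof. by move=> t0; exact: le_trans (normr_ge0 _) (bfam_V_le_U x t0). Qed.

Lemma bfam_W_homo (t : R) : 0 <= t -> {homo W t : x y / x <= y}.
Proof.
move=> t0; apply: (derive_ge0_homo (df := U t)) => x; first exact: (bfam_W H).
exact: bfam_U_ge0.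
Qed.

Let F t x := 2^-1 * U t x ^+ 2 + P t x.

Lemma bfam_F_ge0 (t x : R) : 0 <= t -> 0 <= F t x.
Proof.
move=> t0; rewrite addr_ge0//; last exact: (bfam_P_ge0 hb H).
by rewrite mulr_ge0 ?sqr_ge0// invr_ge0.
Qed.

Lemma bfam_F_decay (T e : R) : 0 < e -> exists2 L : R, 0 <= L &
  forall t x, 0 <= t <= T -> L <= `|x| -> F t x <= e.
Proof.
move=> e0; have [K K0 HK] := bfam_UV_bdd H T.
(* Where [U] and [V] are at most [d], the source is at most [2 * d ^+ 2 <= 2 * d]; farther out the
   decay estimate gives [P <= 4 * d], and half of [U ^+ 2 <= d] keeps the flux below
   [5 * d <= e]. *)
pose d := Num.min 1 (e / 5).
have d0 : 0 < d by rewrite lt_min ltr01 divr_gt0.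
have d1 : d <= 1 by rewrite ge_min lexx.
have d5 : d <= e / 5 by rewrite ge_min lexx orbT.
have [L L0 HL] := bfam_decay_unif H T d0.
have d2 : 0 < 2 * d by rewrite mulr_gt0.
have dd : d ^+ 2 <= d by rewrite expr2 ler_piMl// ltW.
pose C := 2 * K ^+ 2.
have C0 : 0 <= C by rewrite mulr_ge0 ?sqr_ge0.
exists (L + 2 * C / (2 * d)); first by rewrite addr_ge0// divr_ge0 ?mulr_ge0// ltW.
move=> t x tT Lx; have /andP[t0 _] := tT.
have PQ := bfam_PQ_bdd hb H t0 (fun x => HK t x tT).
have Lx' : L <= `|x| by rewrite (le_trans _ Lx)// lerDl divr_ge0 ?mulr_ge0// ltW.
have gd y : L <= `|y| -> b_source b (U t y) (V t y) <= 2 * d.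
  move=> /(HL t y tT)[h1 h2]; rewrite (le_trans (b_source_le hb h1 h2))//; lra.
have := green_decay (fun x => bfam_P H x t0) (fun x => bfam_Q H x t0)
  (fun y => (PQ y).1) (fun y => (PQ y).2) C0 d2 L0 gd Lx.
have [h1 _] := HL t x tT Lx'.
have : U t x ^+ 2 <= d.
  rewrite (le_trans _ dd)// -(real_normK (num_real (U t x))).
  by rewrite ler_sqr ?nnegrE ?normr_ge0 ?(ltW d0).
rewrite /F; lra.
Qed.

(** The mass in [[- X, X]] changes at the rate [F (- X) - F X]. The outflow [F X] is nonnegative,
    and for large [X] the inflow at [- X] is at most [e / (t + 1)], which adds at most [e] up to
    time [t]. *)
Lemma bfam_mass_le (t x y : R) : 0 <= t -> W t y - W t x <= A.
Proof.
move=> t0; apply/ler_addgt0Pr => e e0.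
have d0 : 0 < e / (t + 1) by rewrite divr_gt0// ltr_wpDl.
have [L L0 HL] := bfam_F_decay t d0.
pose X := Num.max L (Num.max `|x| `|y|).
have X0 : 0 <= X by rewrite le_max L0.
have xX : - X <= x.
  by rewrite lerNl (le_trans (ler_norm _))// normrN !le_max lexx !orbT.
have yX : y <= X by rewrite (le_trans (ler_norm _))// !le_max lexx !orbT.
have h : W t y - W t x <= W t X - W t (- X) by rewrite lerB// bfam_W_homo.
apply: (le_trans h).
have c z : {within `[0, t], continuous (fun s => W s z)}.
  apply/within_continuousP_eps => s /andP[s0 st] e' e'0.
  have [dl dl0 Hdl] := bfam_W_cont H z s0 e'0; exists dl => // r /andP[r0 _].
  exact: Hdl.
have := @derive_ge0_le _ (fun s => e / (t + 1) * s - (W s X - W s (- X)))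
  (fun s => e / (t + 1) * 1 - (- F s X - - F s (- X))) 0 t t0.
have -> : e / (t + 1) * 0 - (W 0 X - W 0 (- X)) = - (W 0 X - W 0 (- X)) by rewrite mulr0 sub0r.
have a1 (s : R) : 0 < s < t -> is_derive s 1 (fun s => e / (t + 1) * s - (W s X - W s (- X)))
    (e / (t + 1) * 1 - (- F s X - - F s (- X))).
  move=> /andP[s0 _]; apply: is_deriveB.
  by apply: is_deriveB; exact: (bfam_Wt H).
have a2 s : 0 < s < t -> 0 <= e / (t + 1) * 1 - (- F s X - - F s (- X)).
  move=> /andP[s0 st].
  have st' : 0 <= s <= t by rewrite !ltW.
  have := HL s (- X) st'; rewrite normrN ger0_norm// le_max lexx => /(_ erefl).
  have := bfam_F_ge0 X (ltW s0); rewrite -/(F s (- X)); lra.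
have a3 : {within `[0, t], continuous (fun s => e / (t + 1) * s - (W s X - W s (- X)))}.
  move=> s; apply: cvgB.
    by apply: continuous_subspaceT => r; apply: cvgM; [exact: cvg_cst|exact: cvg_id].
  by apply: cvgB; exact: c.
move=> /(_ a1 a2 a3).
have := W0A (- X) X.
have : e / (t + 1) * t <= e.
  by rewrite mulrAC ler_pdivrMr ?ltr_wpDl// ler_pM2l// lerDl.
lra.
Qed.

(** [W + U] is nondecreasing because [U + V >= 0], and [U] vanishes at [+oo]; comparing [x] with a
    far point trades the value of [U] for mass. *)
Lemma bfam_U_le_mass (t x n : R) : 0 <= t -> (forall y, x <= y -> W t y - W t x <= n) ->
  U t x <= n.
Proof.
move=> t0 nW; apply/ler_addgt0Pr => e e0.
have [L HL] := bfam_decay H t0 e0.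
pose y := Num.max x (Num.max L 0).
have xy : x <= y by rewrite le_max lexx.
have y0 : 0 <= y by rewrite !le_max lexx !orbT.
have [|uy _] := HL y; first by rewrite ger0_norm// !le_max lexx orbT.
have h : W t x + U t x <= W t y + U t y.
  apply: (@derive_ge0_homo _ (fun z => W t z + U t z) (fun z => U t z + V t z)) => // z.
    by apply: is_deriveD; [exact: (bfam_W H)|exact: (bfam_U H)].
  by have := bfam_V_le_U z t0; rewrite ler_norml; lra.
have := nW y xy; have := ler_norm (U t y); lra.
Qed.

Lemma b_source_le_sqr (u v : R) : `|v| <= u -> b_source b u v <= 3 / 2 * u ^+ 2.
Proof.
move=> vu; have u0 : 0 <= u := le_trans (normr_ge0 _) vu.
have v2 : v ^+ 2 <= u ^+ 2 by rewrite -(real_normK (num_real v)) ler_sqr ?nnegrE.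
have : (3 - b) / 2 * v ^+ 2 <= (3 - b) / 2 * u ^+ 2 by rewrite ler_wpM2l//; move: hb; lra.
rewrite /b_source; lra.
Qed.

(* As [|U_x| <= U], one has [exp (- |x - y|) U(y)^2 <= U(x) U(y)], whence
   [P = G (b_source b U V)] is bounded by a multiple of [U] itself.  The two
   halves of the kernel are handled through the equations of [P + Q], [P - Q]. *)
Lemma bfam_P_le_U (t x : R) : 0 <= t -> P t x <= 3 * A * U t x.
Proof.
move=> t0; have [C HC] := bfam_bdd H t0.
have C0 : 0 <= C by have [c _ _ _] := HC 0; exact: le_trans (normr_ge0 _) c.
(* By the mass bound, the shifts by [A] make [n1] and [n2] nonnegative and at most [2 * A]; moreover
   [n1' = - U] and [n2' = U]. *)
pose n1 z := W t 0 + A - W t z.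
pose n2 z := W t z - (W t 0 - A).
have n1b z : 0 <= n1 z <= 2 * A.
  by have := bfam_mass_le 0 z t0; have := bfam_mass_le z 0 t0; rewrite /n1; lra.
have n2b z : 0 <= n2 z <= 2 * A.
  by have := bfam_mass_le 0 z t0; have := bfam_mass_le z 0 t0; rewrite /n2; lra.
have n1d (z : R) : is_derive z 1 n1 (0 - U t z).
  by apply: is_deriveB; exact: (bfam_W H).
have n2d (z : R) : is_derive z 1 n2 (U t z - 0).
  by apply: is_deriveB; exact: (bfam_W H).
have Ud (z : R) := bfam_U H z t0.
have Pd (z : R) := bfam_P H z t0.
have Qd (z : R) := bfam_Q H z t0.
have src z := b_source_le_sqr (bfam_V_le_U z t0).
have Un z a : 0 <= a <= 2 * A -> U t z * a <= 2 * A * U t z.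
  by move=> /andP[_ a2]; rewrite mulrC ler_wpM2r// bfam_U_ge0.
(* For [H = P + Q - 3 / 2 * U * n1], [H' - H = (3 / 2 * U ^+ 2 - b_source) + 3 / 2 * n1 * (U - V)],
   and both terms are nonnegative. [E2] is the mirror computation with [n2] and [U + V]. *)
have E1 : P t x + Q t x - 3 / 2 * (U t x * n1 x) <= 0.
  apply: (@supersol_bounded_le0 _ (fun z => P t z + Q t z - 3 / 2 * (U t z * n1 z))
    (fun z => Q t z + (P t z - b_source b (U t z) (V t z)) -
      3 / 2 * (U t z * (0 - U t z) + n1 z * V t z)) x (C + C)) => // z _.
  - have /andP[n0 _] := n1b z; have := src z.
    have : 0 <= n1 z * (U t z - V t z).
      by rewrite mulr_ge0//; have := bfam_V_le_U z t0; rewrite ler_norml; lra.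
    lra.
  - have [_ _ p q] := HC z.
    have /andP[n0 _] := n1b z.
    have : 0 <= U t z * n1 z by rewrite mulr_ge0// bfam_U_ge0.
    by move: p q; rewrite !ler_norml; lra.
have E2 : P t x - Q t x - 3 / 2 * (U t x * n2 x) <= 0.
  pose Hm z := P t (- z) - Q t (- z) - 3 / 2 * (U t (- z) * n2 (- z)).
  suff : Hm (- x) <= 0 by rewrite /Hm opprK.
  apply: (@supersol_bounded_le0 _ Hm
    (fun z => - Q t (- z) - - (P t (- z) - b_source b (U t (- z)) (V t (- z))) -
      3 / 2 * (U t (- z) * (- (U t (- z) - 0)) + n2 (- z) * (- V t (- z)))) (- x) (C + C)) => // z _.
  - apply: is_deriveB; first by apply: is_deriveB; exact: is_derive_reflect.
    apply: is_deriveZ.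
    by apply: (@is_deriveM _ _ (fun z => U t (- z)) (fun z => n2 (- z))); exact: is_derive_reflect.
  - have /andP[n0 _] := n2b (- z); have := src (- z).
    have : 0 <= n2 (- z) * (U t (- z) + V t (- z)).
      by rewrite mulr_ge0//; have := bfam_V_le_U (- z) t0; rewrite ler_norml; lra.
    rewrite /Hm; lra.
  - have [_ _ p q] := HC (- z).
    have /andP[n0 _] := n2b (- z).
    have : 0 <= U t (- z) * n2 (- z) by rewrite mulr_ge0// bfam_U_ge0.
    by move: p q; rewrite /Hm !ler_norml; lra.
have := Un x _ (n1b x); have := Un x _ (n2b x); lra.
Qed.

(** The local half of the flux is linear in [U] because [U <= A]; it contributes [A / 2] to the
    factor, and [P] contributes [3 * A]. *)
Lemma bfam_F_le_U (t x : R) : 0 <= t -> F t x <= 4 * A * U t x.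
Proof.
move=> t0; have := bfam_P_le_U x t0.
have U0 := bfam_U_ge0 x t0.
have UA : U t x <= A by apply: bfam_U_le_mass => // y _; exact: bfam_mass_le.
have : U t x * U t x <= A * U t x by rewrite ler_wpM2r.
have : 0 <= A * U t x by rewrite mulr_ge0.
rewrite /F expr2; lra.
Qed.

(** The left end, moving at speed [4 * A], sweeps mass out of the window at the rate [4 * A * U], at
    least the flux [F] that brings mass in; at the fixed right end mass can only leave. *)
Lemma bfam_mass_moving (t x y : R) : 0 <= t ->
  W t y - W t (x + 4 * A * t) <= W 0 y - W 0 x.
Proof.
move=> t0; have [K K0 HK] := bfam_UV_bdd H t.
pose q s := x + 4 * A * s.
have qd (s : R) : is_derive s 1 q (0 + 4 * A * 1).
  by apply: is_deriveD; exact: is_derive_mull.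
pose B := Num.max K (4 * A).
have B0 : 0 < B by rewrite lt_max K0.
have ql s r : `|q r - q s| <= B * `|r - s|.
  rewrite /q opprD addrACA subrr add0r -mulrBr normrM ger0_norm ?mulr_ge0//.
  by rewrite ler_wpM2r// le_max lexx orbT.
have UB s z : 0 <= s <= t -> `|U s z| <= B.
  by move=> st; have [h _] := HK s z st; rewrite le_max h.
have qc := bfam_W_curve_cont H B0 UB ql.
have yc := @bfam_W_curve_cont _ _ _ _ _ _ _ H t B (fun=> y) B0 UB.
have := @derive_ge0_le _ (fun s => W s (q s) - W s y)
  (fun s => (- F s (q s) + U s (q s) * (0 + 4 * A * 1)) - - F s y) 0 t t0.
have q0 : q 0 = x by rewrite /q mulr0 addr0.
rewrite /= q0 => h.
suff : W 0 x - W 0 y <= W t (q t) - W t y by rewrite /q; lra.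
apply: h.
- move=> s /andP[s0 _]; apply: is_deriveB; last exact: (bfam_Wt H).
  exact: (bfam_W_curve hb H s0).
- move=> s /andP[s0 _]; have := bfam_F_le_U (q s) (ltW s0); have := bfam_F_ge0 y (ltW s0); lra.
- move=> s; apply: cvgB; first exact: qc.
  by apply: yc => r z; rewrite subrr normr0 mulr_ge0// ltW.
Qed.

(** Since [(4 * A + 1) * t = t + 4 * A * t], the mass beyond the ray at time [t] is at most the
    initial mass beyond [t]; it suffices that [t] exceeds a point [x0] with initial mass less than
    [e] to its right. *)
Lemma bfam_spreading (e : R) : 0 < e -> exists2 t0 : R, 0 <= t0 &
  forall t x, t0 <= t -> (4 * A + 1) * t <= x ->
    U t x <= e /\ forall y, W t y - W t x <= e.
Proof.
move=> e0; have hS : has_sup (range (W 0)).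
  split; first by exists (W 0 0); exists 0.
  by exists (W 0 0 + A) => _ [y _ <-]; have := W0A 0 y; lra.
have [_ [x0 _ <-] x0S] := sup_adherent e0 hS.
exists (Num.max 0 x0); first by rewrite le_max lexx.
move=> t x; rewrite ge_max => /andP[t0 tx0] tx.
have key y : W t y - W t x <= e.
  have h1 : W t (t + 4 * A * t) <= W t x.
    by apply: bfam_W_homo => //; move: tx; lra.
  have h2 := bfam_mass_moving t y t0.
  have h3 : W 0 y <= sup (range (W 0)) by apply: ub_le_sup; [exact: hS.2|exists y].
  have h4 := bfam_W_homo (lexx 0) tx0.
  lra.
by split => //; apply: bfam_U_le_mass.
Qed.

End spreading.

Lemma bfam_reflect (R : realType) (b : R) (W U V P Q : R -> R -> R) :
  bfam b W U V P Q ->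
  bfam b (fun t x => W t (- x)) (fun t x => - U t (- x)) (fun t x => V t (- x))
    (fun t x => P t (- x)) (fun t x => - Q t (- x)).
Proof.
case=> -[HU HP HQ Hc Hd Hb] HW HWt HW0; split; first split.
- move=> t x t0; rewrite -[V _ _]opprK; apply: is_deriveN.
  exact: is_derive_reflect (HU t (- x) t0).
- by move=> t x t0; exact: is_derive_reflect (HP t (- x) t0).
- move=> t x t0; rewrite (_ : _ - _ = - - (P t (- x) - b_source b (U t (- x)) (V t (- x)))).
    by apply: is_deriveN; exact: is_derive_reflect (HQ t (- x) t0).
  by rewrite opprK /b_source sqrrN.
- move=> t0 e t00 e0; have [dl dl0 Hdl] := Hc t0 e t00 e0; exists dl => // t x y t_ge0 td xy.
  have [|h1 h2] := Hdl t (- x) (- y) t_ge0 td; first by rewrite -opprD normrN.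
  by rewrite -opprD normrN.
- move=> t e t0 e0; have [L HL] := Hd t e t0 e0; exists L => x.
  by rewrite -normrN => /HL[h1 h2]; rewrite normrN.
- move=> t t0; have [C HC] := Hb t t0; exists C => x.
  by have [c1 c2 c3 c4] := HC (- x); rewrite !normrN.
- by move=> t x t0; exact: is_derive_reflect (HW t (- x) t0).
- by move=> t x t0; rewrite sqrrN; exact: HWt.
- by move=> x; exact: HW0.
Qed.

(** * Test functions *)

Section class_C_closure.
Context {R : realType}.
Implicit Types V : normedModType R.

Lemma class_C_continuous V n (f : V -> R^o) : class_C n f -> continuous f.
Proof. by case: n => [|n] []. Qed.

Lemma class_CW V n (f : V -> R^o) : class_C n.+1 f -> class_C n f.
Proof.
elim: n f => [|n IH] f [fc fd]; split => // v; have [fdv fdC] := fd v.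
by split=> //; exact: IH.
Qed.

Lemma class_CD V n (f g : V -> R^o) : class_C n f -> class_C n g -> class_C n (f + g).
Proof.
elim: n f g => [|n IH] f g [fc fd] [gc gd]; split.
- by move=> x; apply: cvgD; [exact: fc|exact: gc].
- by [].
- by move=> x; apply: cvgD; [exact: fc|exact: gc].
- move=> v; have [fdv fdC] := fd v; have [gdv gdC] := gd v; split.
    by move=> p; exact: derivableD.
  rewrite (_ : 'D_v (f + g) = 'D_v f + 'D_v g); first exact: IH.
  by apply/funext => p; rewrite deriveD.
Qed.

Lemma class_CM V n (f g : V -> R^o) : class_C n f -> class_C n g ->
  class_C n (f * g : V -> R^o).
Proof.
elim: n f g => [|n IH] f g.
  by move=> [fc _] [gc _]; split=> // x; apply: cvgM; [exact: fc|exact: gc].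
move=> fC gC; have [fc fd] := fC; have [gc gd] := gC; split.
  by move=> x; apply: cvgM; [exact: fc|exact: gc].
move=> v; have [fdv fdC] := fd v; have [gdv gdC] := gd v; split.
  by move=> p; exact: derivableM.
rewrite (_ : 'D_v _ = (f * 'D_v g : V -> R^o) + (g * 'D_v f : V -> R^o)).
  by apply: class_CD; apply: IH => //; exact: class_CW.
by apply/funext => p; rewrite deriveM.
Qed.

Lemma class_C_cst V n (c : R) : class_C n (fun _ : V => c : R^o).
Proof.
elim: n c => [|n IH] c; split => //; try by move=> x; exact: cvg_cst.
move=> v; split=> [p|]; first exact: derivable_cst.
rewrite (_ : 'D_v _ = fun=> 0)//; apply/funext => p; exact: derive_cst.
Qed.

(** [L] is the linear part of the affine map [l]: a derivative of [th \o l] in direction [v] is one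
    of [th] in direction [L v], which lets the induction run. *)
Lemma class_C_affine V V' n (th : V' -> R^o) (l L : V -> V') :
  continuous l -> (forall (h : R) v p, l (h *: v + p) = h *: L v + l p) ->
  class_C n th -> class_C n (th \o l).
Proof.
move=> lc lL; elim: n th => [|n IH] th [thc thd]; split => //.
- by move=> x; apply: continuous_comp; [exact: lc|exact: thc].
- by move=> x; apply: continuous_comp; [exact: lc|exact: thc].
move=> v; have [dv dC] := thd (L v).
have E p : (fun h : R => h^-1 *: ((th \o l) (h *: v + p) - (th \o l) p)) =
    (fun h : R => h^-1 *: (th (h *: L v + l p) - th (l p))).
  by apply/funext => h /=; rewrite lL.
split=> [p|].
  by rewrite /derivable E; exact: dv.
rewrite (_ : 'D_v _ = 'D_(L v) th \o l); first exact: IH.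
by apply/funext => p; rewrite /derive E.
Qed.

(** On the line, the derivative in direction [v] is [v] times the one in direction [1], so a single
    function [g] accounts for all directions. *)
Lemma class_C_derive n (f g : R^o -> R^o) :
  (forall x : R, is_derive x 1 f (g x)) -> class_C n g -> class_C n.+1 f.
Proof.
move=> fd gC.
have fdiff (x : R) : differentiable (f : R^o -> R^o) x.
  by apply/derivable1_diffP; have [] := fd x.
split; first by move=> x; exact/differentiable_continuous.
move=> v; split=> [p|]; first exact: diff_derivable.
rewrite (_ : 'D_v f = (fun=> v : R^o) * g); first by apply: class_CM => //; exact: class_C_cst.
apply/funext => p; rewrite deriveE//.
have -> : v = v *: (1 : R^o) by rewrite /GRing.scale /= mulr1.
rewrite linearZ /= -deriveE//; have [_ ->] := fd p.
by rewrite /GRing.scale /= mulr1.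
Qed.

Lemma smooth_derive (f g : R^o -> R^o) :
  (forall x : R, is_derive x 1 f (g x)) -> smooth g -> smooth f.
Proof. by move=> fd gs n; apply: class_CW; exact: class_C_derive fd (gs n). Qed.

End class_C_closure.

(** * Smoothness of the functions p(1/y) exp(-1/y) *)

Section flat_function.
Context {R : realType}.

(** Each additional factor [z] is paid for by half of the rate, through
    [z <= 2 / k * expR (k / 2 * z)]. *)
Lemma poly_expR_bound (p : {poly R}) (k : R) : 0 < k ->
  exists2 C, 0 <= C & forall z, 0 <= z -> `|p.[z]| <= C * expR (k * z).
Proof.
elim/poly_ind: p k => [|p c IH] k k0.
  by exists 0 => // z _; rewrite horner0 normr0 mul0r.
have k2 : 0 < k / 2 by rewrite divr_gt0.
have [C C0 HC] := IH _ k2.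
exists (C * (2 / k) + `|c|); first by rewrite addr_ge0// mulr_ge0// divr_ge0// ltW.
move=> z z0; rewrite hornerMXaddC (le_trans (ler_normD _ _))// mulrDl lerD//; last first.
  by rewrite ler_peMr// -expR0 ler_expR mulr_ge0// ltW.
rewrite normrM (ger0_norm z0) (_ : k * z = k / 2 * z + k / 2 * z); last by field.
rewrite expRD (_ : _ * (_ * _) = C * expR (k / 2 * z) * (2 / k * expR (k / 2 * z))); last by ring.
rewrite ler_pM//; first exact: HC.
have -> : z = 2 / k * (k / 2 * z) by field; rewrite gt_eqF.
rewrite (_ : k / 2 * (2 / k * (k / 2 * z)) = k / 2 * z); last by field; rewrite gt_eqF.
rewrite ler_wpM2l ?divr_ge0 ?(ltW k0)//.
by have := expR_ge1Dx (k / 2 * z); lra.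
Qed.

(** The polynomial closes the family under differentiation, which sends [p] to [X ^ 2 * (p - p')];
    smoothness then follows by induction for all [p] at once. The classical [exp (- 1 / y)] is
    [flat 1]. *)
Definition flat (p : {poly R}) (y : R) : R :=
  if 0 < y then p.[y^-1] * expR (- y^-1) else 0.

(** A quadratic bound is what the derivative at the junction [0] needs: it sends the difference
    quotient there to [0]. *)
Lemma flat_bound p : exists2 C, 0 <= C & forall y, `|flat p y| <= C * y ^+ 2.
Proof.
have [C C0 HC] := @poly_expR_bound (p * 'X^2) 1 ltr01.
exists C => // y; rewrite /flat; case: ifPn => y0; last first.
  by rewrite normr0 mulr_ge0 ?sqr_ge0.
have := HC y^-1; rewrite invr_ge0 (ltW y0) => /(_ erefl).
rewrite hornerM hornerXn normrM (ger0_norm (_ : 0 <= y^-1 ^+ 2)) ?sqr_ge0// mul1r => h.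
rewrite normrM (ger0_norm (expR_ge0 _)) expRN ler_pdivrMr ?expR_gt0//.
rewrite mulrAC -ler_pdivrMr ?exprn_gt0//; by rewrite exprVn in h.
Qed.

Lemma flat_derive p (y : R) : is_derive y 1 (flat p) (flat ('X^2 * (p - p^`())) y).
Proof.
have [y0|y0|->] := ltgtP y 0.
- rewrite {2}/flat ltNge (ltW y0) /=; apply/is_deriveP => e e0.
  exists (- y); first by rewrite oppr_gt0.
  move=> z; rewrite ltr_norml => /andP[_ zy].
  rewrite /flat !ltNge (ltW y0) (_ : z <= 0) /=; last by lra.
  by rewrite mul0r !subrr normr0 mulr_ge0// ltW.
- have h : is_derive y 1 (fun y => p.[y^-1] * expR (- y^-1)) (flat ('X^2 * (p - p^`())) y).
    have yn : y != 0 by rewrite gt_eqF.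
    have i : is_derive y 1 (fun y : R => y^-1) (- y ^- 2 *: 1).
      exact: (@is_deriveV _ id).
    have h1 : is_derive y 1 (fun y => p.[y^-1]) (p^`().[y^-1] * (- y ^- 2 *: 1)).
      exact: (@is_derive1_comp _ (horner p) (fun y => y^-1)).
    have h2 : is_derive y 1 (fun y => expR (- y^-1)) (expR (- y^-1) * - (- y ^- 2 *: 1)).
      by apply: (@is_derive1_comp _ expR (fun y => - y^-1)).
    rewrite /flat y0 hornerM hornerXn hornerD hornerN.
    rewrite (_ : _ * _ * _ = p.[y^-1] *: (expR (- y^-1) * - (- y ^- 2 *: 1)) +
      expR (- y^-1) *: (p^`().[y^-1] * (- y ^- 2 *: 1))); first exact: is_deriveM.
    by rewrite /GRing.scale /= exprVn; ring.
  apply/is_deriveP => e e0; have /is_deriveP/(_ _ e0)[dl dl0 Hdl] := h.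
  exists (Num.min dl y); first by rewrite lt_min dl0.
  move=> z; rewrite lt_min => /andP[zd]; rewrite ltr_norml => /andP[zy _].
  have z0 : 0 < z by lra.
  have fE w : 0 < w -> flat p w = p.[w^-1] * expR (- w^-1) by rewrite /flat => ->.
  by rewrite (fE y)// (fE z)//; exact: Hdl.
- have [C C0 HC] := flat_bound p.
  rewrite {2}/flat ltxx; apply/is_deriveP => e e0.
  have C1 : 0 < C + 1 by rewrite ltr_wpDl.
  exists (e / (C + 1)); first by rewrite divr_gt0.
  move=> z; rewrite subr0 ltr_pdivlMr// => h.
  rewrite mul0r {2}/flat ltxx !subr0 (le_trans (HC z))//.
  rewrite -(real_normK (num_real z)) expr2 mulrA ler_wpM2r//.
  by have := normr_ge0 z; lra.
Qed.

Lemma flat_smooth p : smooth (flat p : R^o -> R^o).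
Proof.
move=> n; elim: n p => [|n IH] p.
  by split=> // x; exact: is_derive_continuous (flat_derive p x).
exact: class_C_derive (flat_derive p) (IH _).
Qed.

End flat_function.

(** * Smooth steps, cutoffs and mollifiers *)

Section smooth_step.
Context {R : realType}.
Notation mu := (@lebesgue_measure R).

Definition bump (x : R) : R := flat 1 (1 + x) * flat 1 (1 - x).

Lemma flat1_ge0 (y : R) : 0 <= flat 1 y.
Proof. by rewrite /flat; case: ifP => // _; rewrite hornerC mul1r expR_ge0. Qed.

Lemma flat1_le1 (y : R) : flat 1 y <= 1.
Proof.
rewrite /flat; case: ifP => // y0; rewrite hornerC mul1r -expR0 ler_expR.
by rewrite oppr_le0 invr_ge0 ltW.
Qed.

Lemma flat1_gt0 (y : R) : 0 < y -> 0 < flat 1 y.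
Proof. by move=> y0; rewrite /flat y0 hornerC mul1r expR_gt0. Qed.

Lemma bump_ge0 x : 0 <= bump x. Proof. by rewrite mulr_ge0 ?flat1_ge0. Qed.

Lemma bump_le1 x : bump x <= 1.
Proof. by rewrite -[leRHS]mul1r ler_pM ?flat1_ge0 ?flat1_le1. Qed.

Lemma bump_out x : 1 <= `|x| -> bump x = 0.
Proof.
rewrite ler_normr => /orP[x1|x1]; rewrite /bump /flat.
- by rewrite (ltNge _ (1 - x)) subr_le0 x1 mulr0.
- by rewrite (ltNge _ (1 + x)) (_ : 1 + x <= 0) ?mul0r//; lra.
Qed.

Lemma bump_smooth : smooth (bump : R^o -> R^o).
Proof.
move=> n; apply: class_CM.
- apply: (@class_C_affine _ _ _ n _ (fun x : R^o => (1 + x : R^o)) id).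
  + by move=> x; apply: cvgD; [exact: cvg_cst|exact: cvg_id].
  + by move=> h v p; rewrite addrCA.
  + exact: flat_smooth.
- apply: (@class_C_affine _ _ _ n _ (fun x : R^o => (1 - x : R^o)) (fun v => - v)).
  + by move=> x; apply: cvgB; [exact: cvg_cst|exact: cvg_id].
  + by move=> h v p; rewrite opprD scalerN addrCA.
  + exact: flat_smooth.
Qed.

Lemma bump_continuous : continuous bump.
Proof. exact: (class_C_continuous (bump_smooth 0)). Qed.

(** The base point [-2] lies strictly to the left of the support [[-1, 1]]: either [-2 < x] and the
    fundamental theorem applies, or the integral vanishes on a neighbourhood of [x]. *)
Let step0 (x : R) : R := \int[mu]_(y in `[-2, x]) bump y.

Let step0_le (x : R) : x <= -1 -> step0 x = 0.
Proof.
move=> x1; rewrite /step0 -[RHS](@Rintegral_set0 _ _ _ mu bump).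
rewrite Rintegral_mkcond [RHS]Rintegral_mkcond; apply: eq_Rintegral => y _.
rewrite !patchE in_set0; case: ifPn => //; rewrite inE /= in_itv /= => /andP[_ yx].
by rewrite bump_out// ler_normr; apply/orP; right; lra.
Qed.

Let step0_deriv (x : R) : is_derive x 1 step0 (bump x).
Proof.
have [x1|x1] := ltP (-2) x; first exact: Rintegral_segment_deriv bump_continuous x1.
rewrite bump_out; last by rewrite ler_normr; apply/orP; right; lra.
apply/is_deriveP => e e0; exists 1 => // y; rewrite ltr_norml => /andP[_ yx].
rewrite !step0_le; [|lra|lra].
by rewrite mul0r !subr0 normr0 mulr_ge0// ltW.
Qed.

Let step0_homo : {homo step0 : x y / x <= y}.
Proof. exact: derive_ge0_homo step0_deriv bump_ge0. Qed.

Definition step_mass : R := step0 1.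

Lemma step_mass_gt0 : 0 < step_mass.
Proof.
have [c [c1 c2 E]] := mvt_unordered (x := - 2^-1) (y := 2^-1) (fun z _ _ => step0_deriv z).
have h1 : 0 < bump c.
  move: c1 c2; rewrite !ler_norml (_ : `|2^-1 - - 2^-1| = 1 :> R); last by rewrite ger0_norm; lra.
  by move=> /andP[_ c1] /andP[c2 _]; rewrite mulr_gt0// flat1_gt0//; lra.
have h2 : 0 <= step0 (- 2^-1) by apply: Rintegral_ge0 => y _; exact: bump_ge0.
have h3 : step0 2^-1 <= step_mass by apply: step0_homo; lra.
move: E; rewrite (_ : 2^-1 - - 2^-1 = 1); last by field.
lra.
Qed.

Definition smooth_step (x : R) : R := step_mass^-1 * step0 x.
Definition mollifier (x : R) : R := step_mass^-1 * bump x.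

Lemma smooth_step_deriv (x : R) : is_derive x 1 smooth_step (mollifier x).
Proof. exact: is_deriveZ. Qed.

Lemma mollifier_smooth : smooth (mollifier : R^o -> R^o).
Proof. by move=> n; apply: class_CM; [exact: class_C_cst|exact: bump_smooth]. Qed.

Lemma mollifier_ge0 x : 0 <= mollifier x.
Proof. by rewrite mulr_ge0 ?bump_ge0// invr_ge0 ltW// step_mass_gt0. Qed.

Lemma mollifier_le x : mollifier x <= step_mass^-1.
Proof. by rewrite ler_piMr ?bump_le1// invr_ge0 ltW// step_mass_gt0. Qed.

Lemma mollifier_out x : 1 <= `|x| -> mollifier x = 0.
Proof. by move=> /bump_out; rewrite /mollifier => ->; rewrite mulr0. Qed.

Lemma smooth_step_le x : x <= -1 -> smooth_step x = 0.
Proof. by move=> /step0_le; rewrite /smooth_step => ->; rewrite mulr0. Qed.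

Lemma smooth_step_ge x : 1 <= x -> smooth_step x = 1.
Proof.
move=> x1; rewrite /smooth_step (_ : step0 x = step_mass) ?mulVf ?gt_eqF ?step_mass_gt0//.
have [c [c1 c2 E]] := mvt_unordered (x := 1) (y := x) (fun z _ _ => step0_deriv z).
rewrite bump_out ?mul0r in E; first by move/eqP: E; rewrite subr_eq0 => /eqP.
rewrite (ger0_norm (_ : 0 <= x - 1)) ?subr_ge0// in c2.
by rewrite ler_normr; apply/orP; left; move: c2; rewrite ler_norml; lra.
Qed.

Lemma smooth_step_homo : {homo smooth_step : x y / x <= y}.
Proof. exact: derive_ge0_homo smooth_step_deriv mollifier_ge0. Qed.

Lemma smooth_step_itv x : 0 <= smooth_step x <= 1.
Proof.
apply/andP; split.
- have [x1|/ltW x1] := leP x (-1); first by rewrite smooth_step_le.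
  by rewrite -(smooth_step_le (lexx (-1))) smooth_step_homo.
- have [x1|/ltW x1] := leP 1 x; first by rewrite smooth_step_ge.
  by rewrite -(smooth_step_ge (lexx 1)) smooth_step_homo.
Qed.

(** As a difference of two smooth steps it has as derivative exactly a mollifier at [a] minus a
    mollifier at [b]: an equation tested with it reads off an increment between two points. *)
Definition cutoff (e a b x : R) : R := smooth_step ((x - a) / e) - smooth_step ((x - b) / e).
Definition dirac_approx (e a x : R) : R := e^-1 * mollifier ((x - a) / e).

Lemma affine_smooth (f : R^o -> R^o) (e a : R) : smooth f ->
  smooth ((fun x => f ((x - a) / e)) : R^o -> R^o).
Proof.
move=> fs n.
apply: (@class_C_affine _ _ _ n f (fun x : R^o => ((x - a) / e : R^o)) (fun v => v / e)) => //.
- by move=> x; apply: cvgM; [apply: cvgB; [exact: cvg_id|exact: cvg_cst]|exact: cvg_cst].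
- by move=> h v p; rewrite /GRing.scale /=; ring.
Qed.

Lemma dirac_approx_continuous e a : continuous (dirac_approx e a).
Proof.
apply: (@class_C_continuous _ _ 0); apply: class_CM; first exact: class_C_cst.
exact: affine_smooth mollifier_smooth _.
Qed.

Lemma smooth_step_affine_deriv (e a x : R) :
  is_derive x 1 (fun x => smooth_step ((x - a) / e)) (dirac_approx e a x).
Proof.
rewrite /dirac_approx mulrC.
apply: (@is_derive1_comp _ smooth_step (fun x => (x - a) / e)).
  exact: smooth_step_deriv.
rewrite (_ : (fun x => _) = e^-1 \*: (fun x : R => x - a)); last first.
  by apply/funext => y; rewrite /GRing.scale /= mulrC.
by apply: is_derive_eq; rewrite /GRing.scale /= subr0 mulr1.
Qed.

Lemma cutoff_deriv (e a b x : R) :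
  is_derive x 1 (cutoff e a b) (dirac_approx e a x - dirac_approx e b x).
Proof. by apply: is_deriveB; exact: smooth_step_affine_deriv. Qed.

Lemma cutoff_smooth e a b : smooth (cutoff e a b : R^o -> R^o).
Proof.
apply: (smooth_derive (cutoff_deriv e a b)) => n.
rewrite (_ : (fun x => _) = (dirac_approx e a : R^o -> R^o) +
  ((fun=> -1) * (dirac_approx e b) : R^o -> R^o)); last first.
  by apply/funext => x; rewrite -[RHS]/(_ + -1 * _) mulN1r.
apply: class_CD; first by apply: class_CM; [exact: class_C_cst|exact: affine_smooth mollifier_smooth _].
apply: class_CM; first exact: class_C_cst.
by apply: class_CM; [exact: class_C_cst|exact: affine_smooth mollifier_smooth _].
Qed.

Variables (e a b : R).
Hypothesis e0 : 0 < e.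
Hypothesis ab : a <= b.

Lemma dirac_approx_out x c : e <= `|x - c| -> dirac_approx e c x = 0.
Proof.
move=> h; rewrite /dirac_approx mollifier_out ?mulr0//.
by rewrite normrM normfV (gtr0_norm e0) ler_pdivlMr// mul1r.
Qed.

Lemma dirac_approx_ge0 x c : 0 <= dirac_approx e c x.
Proof. by rewrite mulr_ge0 ?mollifier_ge0// invr_ge0 ltW. Qed.

Lemma dirac_approx_le x c : dirac_approx e c x <= step_mass^-1 / e.
Proof. by rewrite /dirac_approx mulrC ler_wpM2r ?mollifier_le// invr_ge0 ltW. Qed.

Lemma cutoff_itv x : 0 <= cutoff e a b x <= 1.
Proof.
have /andP[h1 h2] := smooth_step_itv ((x - a) / e).
have /andP[h3 h4] := smooth_step_itv ((x - b) / e).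
have : smooth_step ((x - b) / e) <= smooth_step ((x - a) / e).
  by apply: smooth_step_homo; rewrite ler_pM2r ?invr_gt0//; move: ab; lra.
rewrite /cutoff; lra.
Qed.

Lemma cutoff_out x : x <= a - e \/ b + e <= x -> cutoff e a b x = 0.
Proof.
case=> xe; rewrite /cutoff.
- have h1 : (x - a) / e <= -1 by rewrite ler_pdivrMr//; move: ab e0; lra.
  have h2 : (x - b) / e <= -1 by rewrite ler_pdivrMr//; move: ab e0; lra.
  by rewrite !smooth_step_le ?subrr.
- have h1 : 1 <= (x - a) / e by rewrite ler_pdivlMr//; move: ab e0; lra.
  have h2 : 1 <= (x - b) / e by rewrite ler_pdivlMr//; move: ab e0; lra.
  by rewrite !smooth_step_ge ?subrr.
Qed.

Lemma cutoff_in x : a + e <= x -> x <= b - e -> cutoff e a b x = 1.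
Proof.
move=> ax xb; rewrite /cutoff smooth_step_ge; last by rewrite ler_pdivlMr//; move: ab e0; lra.
by rewrite smooth_step_le ?subr0// ler_pdivrMr//; move: ab e0; lra.
Qed.

Lemma cutoff_support : closure [set x : R^o | cutoff e a b x != 0] `<=` `[a - e, b + e].
Proof.
have cl : closed (`[a - e, b + e]%classic : set R) by exact: itv_closed.
rewrite [X in _ `<=` X](iffLR (closure_id _) cl); apply: closure_subset => x /=; rewrite in_itv /= => h.
rewrite leNgt (leNgt x); apply/andP; split; apply/negP => hx; move: h.
  by rewrite cutoff_out ?eqxx//; left; exact: ltW.
by rewrite cutoff_out ?eqxx//; right; exact: ltW.
Qed.

Lemma cutoff_test : test_function setT (cutoff e a b : R^o -> R^o).
Proof.
split=> //; first exact: cutoff_smooth.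
apply: (subclosed_compact _ _ cutoff_support); first exact: closed_closure.
exact: segment_compact.
Qed.

End smooth_step.

Section product_test.
Context {R : realType}.
Variables (e e' a b c d : R).
Hypothesis e0 : 0 < e.
Hypothesis e'0 : 0 < e'.
Hypothesis ea : e < a.

Definition cutoff2 (p : R^o * R^o) : R^o := cutoff e a b p.1 * cutoff e' c d p.2.

Lemma cutoff2_smooth : smooth cutoff2.
Proof.
move=> n.
have h1 : class_C n ((cutoff e a b : R^o -> R^o) \o (fst : R^o * R^o -> R^o)).
  apply: (@class_C_affine _ _ _ n _ (fst : R^o * R^o -> R^o) (fst : R^o * R^o -> R^o)) => //.
    by move=> x; exact: cvg_fst.
  exact: cutoff_smooth.
have h2 : class_C n ((cutoff e' c d : R^o -> R^o) \o (snd : R^o * R^o -> R^o)).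
  apply: (@class_C_affine _ _ _ n _ (snd : R^o * R^o -> R^o) (snd : R^o * R^o -> R^o)) => //.
    by move=> x; exact: cvg_snd.
  exact: cutoff_smooth.
exact: class_CM h1 h2.
Qed.

Lemma cutoff2_test : a <= b -> c <= d ->
  test_function ([set p | 0 < p.1] : set (R^o * R^o)%type) cutoff2.
Proof.
move=> ab cd.
have sub : closure [set p | cutoff2 p != 0] `<=` `[a - e, b + e] `*` `[c - e', d + e'].
  have cl : closed (`[a - e, b + e]%classic `*` `[c - e', d + e']%classic : set (R^o * R^o)).
    rewrite (_ : _ `*` _ = fst @^-1` `[a - e, b + e]%classic `&` snd @^-1` `[c - e', d + e']%classic)//.
    apply: closedI; apply: preimage_closed; try exact: itv_closed.
      by move=> x _; exact: cvg_fst.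
    by move=> x _; exact: cvg_snd.
  rewrite [X in _ `<=` X](iffLR (closure_id _) cl); apply: closure_subset => -[x y] /=.
  rewrite /cutoff2 mulf_eq0 negb_or /= => /andP[h1 h2]; split.
    by apply: (cutoff_support e0 ab); exact: subset_closure.
  by apply: (cutoff_support e'0 cd); exact: subset_closure.
split; first exact: cutoff2_smooth.
- apply: (subclosed_compact _ _ sub); first exact: closed_closure.
  by apply: compact_setX; exact: segment_compact.
- move=> p /sub[/=]; rewrite in_itv /= => /andP[h _] _.
  by rewrite (lt_le_trans _ h)// subr_gt0.
Qed.

Lemma cutoff2_Dt (t x : R) : 'D_((1, 0) : R^o * R^o) cutoff2 (t, x) =
  (dirac_approx e a t - dirac_approx e b t) * cutoff e' c d x.
Proof.
have h := @is_deriveZ _ _ _ (cutoff e a b) (cutoff e' c d x) t 1 _ (cutoff_deriv e a b t).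
have [_ E] := h; rewrite mulrC -[RHS]E /derive.
suff -> : (fun h : R => h^-1 *: (cutoff2 (h *: ((1, 0) : R^o * R^o) + (t, x)) - cutoff2 (t, x))) =
  (fun h => h^-1 *: ((cutoff e' c d x \*: cutoff e a b) (h *: (1 : R^o) + t) -
     (cutoff e' c d x \*: cutoff e a b) t)) by [].
apply/funext => k; rewrite /cutoff2 /= scaler0 add0r.
by rewrite /GRing.scale /= (mulrC (cutoff e a b _)) (mulrC (cutoff e a b t)).
Qed.

Lemma cutoff2_Dx (t x : R) : 'D_((0, 1) : R^o * R^o) cutoff2 (t, x) =
  cutoff e a b t * (dirac_approx e' c x - dirac_approx e' d x).
Proof.
have h := @is_deriveZ _ _ _ (cutoff e' c d) (cutoff e a b t) x 1 _ (cutoff_deriv e' c d x).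
have [_ E] := h; rewrite -[RHS]E /derive.
suff -> : (fun h : R => h^-1 *: (cutoff2 (h *: ((0, 1) : R^o * R^o) + (t, x)) - cutoff2 (t, x))) =
  (fun h => h^-1 *: ((cutoff e a b t \*: cutoff e' c d) (h *: (1 : R^o) + x) -
     (cutoff e a b t \*: cutoff e' c d) x)) by [].
by apply/funext => k; rewrite /cutoff2 /= scaler0 add0r.
Qed.

End product_test.

(** * Weak derivatives and continuous representatives *)

Section square_integrable.
Context {R : realType}.
Notation mu := (@lebesgue_measure R).
Implicit Types (f g : R -> R) (a b e : R).

Lemma Lfun_measurable f p : f \in Lfun mu p -> measurable_fun setT f.
Proof. by rewrite inE => /andP[]; rewrite inE. Qed.

Lemma integrable_EFinD (D : set R) f g : measurable D -> mu.-integrable D (EFin \o f) ->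
  mu.-integrable D (EFin \o g) -> mu.-integrable D (EFin \o (fun x => f x + g x)).
Proof.
by move=> mD fi gi; rewrite (_ : EFin \o _ = ((EFin \o f) \+ (EFin \o g))%E)//; exact: integrableD.
Qed.

Lemma integrable_EFinB (D : set R) f g : measurable D -> mu.-integrable D (EFin \o f) ->
  mu.-integrable D (EFin \o g) -> mu.-integrable D (EFin \o (fun x => f x - g x)).
Proof.
by move=> mD fi gi; rewrite (_ : EFin \o _ = ((EFin \o f) \- (EFin \o g))%E)//; exact: integrableB.
Qed.

Lemma integrable_EFinZl (D : set R) f c : measurable D -> mu.-integrable D (EFin \o f) ->
  mu.-integrable D (EFin \o (fun x => c * f x)).
Proof. by move=> mD fi; exact: (integrableZl _ c fi). Qed.

Lemma integrable_EFin_cst a b (c : R) : mu.-integrable `[a, b] (EFin \o (fun=> c)).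
Proof. by apply: continuous_integrable_segment => x; exact: cvg_cst. Qed.

Lemma Lfun2_sqr_segment f a b : f \in Lfun mu 2%:E ->
  mu.-integrable `[a, b] (EFin \o (fun x => f x ^+ 2)).
Proof.
move=> f2; apply: (@integrableS _ _ _ mu setT) => //.
exact: Lfun2_integrable_sqr.
Qed.

Lemma Lfun2_segment f a b : f \in Lfun mu 2%:E ->
  mu.-integrable `[a, b] (EFin \o f).
Proof.
move=> f2; have mf := Lfun_measurable f2.
have i1 : mu.-integrable `[a, b] (EFin \o (fun x => 1 + f x ^+ 2)).
  by apply: integrable_EFinD => //; [exact: integrable_EFin_cst|exact: Lfun2_sqr_segment].
apply: (le_integrable _ _ _ i1) => //.
  by apply/measurable_EFinP; exact: measurable_funTS.
move=> x _ /=; rewrite lee_fin [leRHS]ger0_norm ?addr_ge0 ?sqr_ge0//.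
have := sqr_ge0 (`|f x| - 1); rewrite sqrrB mulr1 expr1n -(real_normK (num_real (f x))).
have := normr_ge0 (f x); lra.
Qed.

(** Young's inequality [|f| <= lam / 2 * f ^+ 2 + 1 / (2 * lam)], integrated. The free [lam] takes
    the place of the square root in the Cauchy-Schwarz inequality. *)
Lemma Lfun2_norm_segment_le f a b lam : a <= b -> 0 < lam -> f \in Lfun mu 2%:E ->
  \int[mu]_(x in `[a, b]) `|f x| <=
  lam / 2 * \int[mu]_(x in `[a, b]) (f x ^+ 2) + (b - a) / (2 * lam).
Proof.
move=> ab l0 f2.
have i2 := Lfun2_sqr_segment a b f2; have i1 := Lfun2_segment a b f2.
have ic := @integrable_EFin_cst a b (2 * lam)^-1.
have i3 := @integrable_EFinZl `[a, b]%classic _ (lam / 2) (measurable_itv _) i2.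
rewrite -RintegralZl// [(b - a) / _]mulrC -(Rintegral_segment_cst (2 * lam)^-1 ab) -RintegralD//.
apply: le_Rintegral => //.
- exact: integrable_norm.
- exact: integrable_EFinD.
- move=> x _; rewrite -subr_ge0.
  rewrite (_ : _ - _ = (lam * `|f x| - 1) ^+ 2 / (2 * lam)).
    by rewrite divr_ge0 ?sqr_ge0// mulr_ge0// ltW.
  by rewrite -(real_normK (num_real (f x))); field; rewrite gt_eqF.
Qed.

Lemma Lfun2_sqr_segment_le f a b : f \in Lfun mu 2%:E ->
  \int[mu]_(x in `[a, b]) (f x ^+ 2) <= \int[mu]_x (f x ^+ 2).
Proof.
move=> f2; have i := Lfun2_integrable_sqr f2.
have i' := Lfun2_sqr_segment a b f2.
rewrite /Rintegral fine_le//.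
- exact: integrable_fin_num.
- exact: integrable_fin_num.
- apply: ge0_subset_integral => //; first exact: (measurable_int _ i).
  by move=> x _; rewrite lee_fin sqr_ge0.
Qed.

Lemma locally_integrable_segment f : measurable_fun setT f ->
  (forall a b, mu.-integrable `[a, b] (EFin \o f)) -> locally_integrable setT f.
Proof.
move=> mf fi; split => //; first exact: openT.
move=> K _ Kc; have [M [_ HM]] := compact_bounded Kc.
have sub : K `<=` `[- (`|M| + 1), `|M| + 1]%classic.
  move=> x Kx; rewrite /= in_itv /= -ler_norml.
  by apply: HM => //; rewrite (le_lt_trans (ler_norm M))// ltrDl.
have /integrableP[_ foo] := fi (- (`|M| + 1)) (`|M| + 1).
apply: (le_lt_trans _ foo).
apply: ge0_subset_integral => //; first exact: compact_measurable.
by apply/measurable_EFinP; apply: measurableT_comp => //; exact: measurable_funTS.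
Qed.

Lemma lebesgue_ptP f x : (forall a b, mu.-integrable `[a, b] (EFin \o f)) ->
  lebesgue_pt f x -> forall eta, 0 < eta -> exists2 dl : R, 0 < dl &
    forall r, 0 < r < dl -> \int[mu]_(y in `[x - r, x + r]) `|f y - f x| <= eta * r.
Proof.
move=> fi fx eta eta0.
have eta2 : 0 < eta / 2 by rewrite divr_gt0.
have /fine_cvgP[ffin /cvgrPdist_lt/(_ _ eta2) fsmall] : davg f x r @[r --> (0%R:R)^'+] --> 0%:E by [].
have := filterI ffin fsmall => -[dl /= dl0 Hdl].
exists dl => // r /andP[r0 rdl].
have [|fin] := Hdl r _ r0; first by rewrite /ball /= sub0r normrN gtr0_norm.
rewrite /= sub0r normrN ger0_norm ?fine_ge0 ?davg_ge0// => small.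
have ic : mu.-integrable `[x - r, x + r] (EFin \o (fun y => f y - f x)).
  by apply: integrable_EFinB => //; exact: integrable_EFin_cst.
have E : (\int[mu]_(y in `[(x - r)%R, (x + r)%R]) `|f y - f x|%:E =
    (2 * r)%:E * davg f x r)%E.
  rewrite /davg /iavg lebesgue_measure_ball ?ltW// ball_itv muleA.
  rewrite (_ : (2 * r)%:E * _ = 1)%E ?mul1e; last first.
    rewrite -[r *+ 2]mulr_natl inver gt_eqF ?mulr_gt0// -EFinM divff// gt_eqF// mulr_gt0//.
  rewrite integral_itv_bndoo//; apply/measurable_EFinP; apply: measurableT_comp => //.
  have /integrableP[/measurable_EFinP h _] := ic.
  by apply: measurable_funS h => //; exact: subset_itv_oo_cc.
rewrite /Rintegral E -(fineK fin) -EFinM /=.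
have := ler_wpM2l (ltW r0) (ltW small); rewrite /=; lra.
Qed.

End square_integrable.

(** * The lemma of du Bois-Reymond *)

Section du_bois_reymond.
Context {R : realType}.
Notation mu := (@lebesgue_measure R).
Implicit Types (f g h : R -> R) (a b e : R).

Definition locint f := forall a b, mu.-integrable `[a, b] (EFin \o f).

(** The Lebesgue point condition, without normalization. It holds almost everywhere for functions in
    [L^2] and everywhere for continuous ones, so one lemma serves both the weak derivative in space
    and the evolution in time. *)
Definition mean_continuous f x := forall eta, 0 < eta -> exists2 dl : R, 0 < dl &
  forall r, 0 < r < dl -> \int[mu]_(y in `[x - r, x + r]) `|f y - f x| <= eta * r.

Lemma continuous_locint f : continuous f -> locint f.
Proof. by move=> fc a b; exact: continuous_integrable_segment. Qed.

Lemma continuous_mean f x : continuous f -> mean_continuous f x.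
Proof.
move=> fc eta eta0; have e2 : 0 < eta / 2 by rewrite divr_gt0.
have /continuousP_eps/(_ _ e2)[dl dl0 Hdl] := fc x.
exists dl => // r /andP[r0 rdl].
have gc : continuous (fun y => `|f y - f x|).
  by move=> y; apply: cvg_norm; apply: cvgB; [exact: fc|exact: cvg_cst].
apply: le_trans (ler_norm _) _.
rewrite (_ : eta * r = eta / 2 * (x + r - (x - r))); last by field.
apply: Rintegral_segment_norm_le; [lra|exact: continuous_integrable_segment|].
move=> y /andP[y1 y2]; rewrite normr_id; apply: Hdl.
by rewrite ltr_norml; apply/andP; split; lra.
Qed.

Lemma Rintegral_support f a b : (forall x, x <= a \/ b <= x -> f x = 0) ->
  \int[mu]_x f x = \int[mu]_(x in `[a, b]) f x.
Proof.
move=> f0; rewrite [RHS]Rintegral_mkcond; apply: eq_Rintegral => x _.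
rewrite patchE; case: ifPn => //; rewrite notin_setE /= in_itv /= => /negP.
by rewrite negb_and -!ltNge => /orP[/ltW|/ltW] h; apply: f0; [left|right].
Qed.

Lemma integrable_mul_bounded (D : set R) f h (C : R) : measurable D -> continuous h ->
  (forall x, `|h x| <= C) -> mu.-integrable D (EFin \o f) ->
  mu.-integrable D (EFin \o (fun x => f x * h x)).
Proof.
move=> mD hc hC fi.
have hm : measurable_fun D h by apply: measurable_funTS; exact: continuous_measurable_fun.
have hb : [bounded h x | x in D].
  exists C; split; first exact: num_real.
  by move=> M CM x _; apply: (le_trans (hC x)); exact: ltW.
rewrite (_ : EFin \o _ = ((EFin \o f) \* (EFin \o h))%E)//; exact: integrableMl.
Qed.

Lemma dirac_approx_norm e a x : 0 < e -> `|dirac_approx e a x| <= step_mass^-1 / e.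
Proof. by move=> e0; rewrite ger0_norm ?dirac_approx_le// dirac_approx_ge0. Qed.

Lemma dirac_approx_mass e a : 0 < e ->
  \int[mu]_(x in `[a - e, a + e]) dirac_approx e a x = 1.
Proof.
move=> e0; rewrite (Rintegral_segment_FTC _ (@dirac_approx_continuous R e a)
  (smooth_step_affine_deriv e a)); last by lra.
rewrite [a + e - a]addrAC subrr add0r divff ?gt_eqF// smooth_step_ge//.
by rewrite [a - e - a]addrAC subrr add0r mulNr divff ?gt_eqF// smooth_step_le// subr0.
Qed.

Lemma dirac_approx_err f a e c : 0 < e -> locint f ->
  `|\int[mu]_x (f x * dirac_approx e a x) - c| <=
  step_mass^-1 / e * \int[mu]_(x in `[a - e, a + e]) `|f x - c|.
Proof.
move=> e0 fi.
have dc := @dirac_approx_continuous R e a.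
have db x := dirac_approx_norm a x e0.
rewrite (@Rintegral_support _ (a - e) (a + e)); last first.
  move=> x hx; rewrite dirac_approx_out ?mulr0// ler_normr.
  by case: hx => hx; apply/orP; [right|left]; lra.
have i1 := integrable_mul_bounded (measurable_itv `[a - e, a + e]) dc db (fi (a - e) (a + e)).
have i2 := @continuous_integrable_segment R _ (a - e) (a + e) dc.
have i3 := integrable_EFinZl c (measurable_itv `[a - e, a + e]) i2.
have i4 : mu.-integrable `[a - e, a + e] (EFin \o (fun x => f x - c)).
  by apply: integrable_EFinB => //; exact: integrable_EFin_cst.
have E : c = \int[mu]_(x in `[a - e, a + e]) (c * dirac_approx e a x).
  by rewrite RintegralZl// dirac_approx_mass// mulr1.
rewrite {1}E -RintegralB//.
rewrite (le_trans (le_normr_Rintegral _ _))//; first exact: integrable_EFinB.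
have i5 : mu.-integrable `[a - e, a + e] (EFin \o (fun x => `|f x - c|)) by exact: integrable_norm.
rewrite -RintegralZl//; apply: le_Rintegral => //.
- by apply: integrable_norm; exact: integrable_EFinB.
- exact: integrable_EFinZl.
- by move=> x _; rewrite -mulrBl normrM mulrC ler_wpM2r.
Qed.

Lemma dirac_approx_limit f a : locint f -> mean_continuous f a ->
  forall eta, 0 < eta -> exists2 dl : R, 0 < dl & forall e, 0 < e < dl ->
    `|\int[mu]_x (f x * dirac_approx e a x) - f a| <= eta.
Proof.
move=> fi fa eta eta0.
have m0 := @step_mass_gt0 R.
have h0 : 0 < eta * step_mass by rewrite mulr_gt0.
have [dl dl0 Hdl] := fa _ h0; exists dl => // e /andP[e0 edl].
rewrite (le_trans (dirac_approx_err a (f a) e0 fi))//.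
rewrite -ler_pdivlMl ?divr_gt0 ?invr_gt0// invf_div invrK.
rewrite (le_trans (Hdl e _)) ?e0// le_eqVlt; apply/orP; left; apply/eqP; ring.
Qed.

Lemma locint_small f a : locint f -> forall eta, 0 < eta -> exists2 dl : R, 0 < dl &
  forall e, 0 < e < dl -> \int[mu]_(x in `[a - e, a + e]) `|f x| <= eta.
Proof.
move=> fi eta eta0.
have ni : locint (fun x => `|f x|) by move=> c d; exact: integrable_norm.
have a2 : a - 1 <= a + 1 by lra.
have /within_continuousP_eps Gc := @parameterized_integral_continuous R (a - 1) (a + 1) _ a2 (ni _ _).
have eta2 : 0 < eta / 2 by rewrite divr_gt0.
have aa : a - 1 <= a <= a + 1 by apply/andP; split; lra.
have [dl dl0 Hdl] := Gc a aa _ eta2.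
exists (Num.min dl 1); first by rewrite lt_min dl0 ltr01.
move=> e; rewrite lt_min => /and3P[e0 edl e1].
have h1 := Hdl (a + e); have h2 := Hdl (a - e).
have E1 : `|a + e - a| < dl by rewrite [a + e - a]addrAC subrr add0r gtr0_norm.
have E2 : `|a - e - a| < dl by rewrite [a - e - a]addrAC subrr add0r normrN gtr0_norm.
have {}h1 := h1 (ltac:(apply/andP; split; lra)) E1.
have {}h2 := h2 (ltac:(apply/andP; split; lra)) E2.
have l1 : a - 1 <= a - e by lra.
have l2 : a - e <= a + e by lra.
have := Rintegral_segment_cat l1 l2 (ni _ _).
move: h1 h2; rewrite /parameterized_integral !ler_norml => /andP[_ h1] /andP[h2 _].
lra.
Qed.

Lemma cutoff_continuous e a b : continuous (@cutoff R e a b).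
Proof. by move=> x; exact: is_derive_continuous (cutoff_deriv e a b x). Qed.

(** The cutoff is [1] on the inner segment, so only the two windows of width [2 * e] around the ends
    contribute; there both integrals are dominated by that of the absolute value. *)
Lemma cutoff_err f a b e : 0 < e -> a + e <= b - e -> locint f ->
  `|\int[mu]_x (f x * cutoff e a b x) - \int[mu]_(x in `[a, b]) f x| <=
  2 * (\int[mu]_(x in `[a - e, a + e]) `|f x| + \int[mu]_(x in `[b - e, b + e]) `|f x|).
Proof.
move=> e0 abe fi; have ab : a <= b by lra.
have cc := @cutoff_continuous e a b.
have cb x : `|cutoff e a b x| <= 1.
  by have /andP[c0 c1] := cutoff_itv e0 ab x; rewrite ger0_norm.
have gi : locint (fun x => f x * cutoff e a b x).
  by move=> c d; exact: (integrable_mul_bounded _ cc cb).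
have ni : locint (fun x => `|f x|) by move=> c d; exact: integrable_norm.
have p1 : a - e <= a by lra.
have p2 : a <= a + e by lra.
have p3 : b - e <= b by lra.
have p4 : b <= b + e by lra.
rewrite (@Rintegral_support _ (a - e) (b + e)); last first.
  by move=> x hx; rewrite cutoff_out ?mulr0.
rewrite (@Rintegral_segment_cat _ _ (a - e) (a + e)) //; try lra.
rewrite (@Rintegral_segment_cat _ _ (a + e) (b - e)) //; try lra.
rewrite (@Rintegral_segment_cat _ f a (a + e)) //; try lra.
rewrite (@Rintegral_segment_cat _ f (a + e) (b - e)) //; try lra.
have -> : \int[mu]_(x in `[a + e, b - e]) (f x * cutoff e a b x) =
    \int[mu]_(x in `[a + e, b - e]) f x.
  apply: eq_Rintegral => x; rewrite inE /= in_itv /= => /andP[x1 x2].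
  by rewrite cutoff_in ?mulr1.
have gle c d : `|\int[mu]_(x in `[c, d]) (f x * cutoff e a b x)| <= \int[mu]_(x in `[c, d]) `|f x|.
  rewrite (le_trans (le_normr_Rintegral _ _))//; apply: le_Rintegral => //.
    exact: integrable_norm.
  by move=> x _; rewrite normrM ler_piMr.
have fle c d c' d' : c <= c' -> c' <= d' -> d' <= d ->
    `|\int[mu]_(x in `[c', d']) f x| <= \int[mu]_(x in `[c, d]) `|f x|.
  move=> cc' cd' dd'; rewrite (le_trans (le_normr_Rintegral _ _))//.
  rewrite (@Rintegral_segment_cat _ _ c c') //; last by exact: le_trans dd'.
  rewrite (@Rintegral_segment_cat _ _ c' d') //.
  have := @Rintegral_ge0 _ _ _ mu `[c, c']%classic (fun x => `|f x|) (fun x _ => normr_ge0 _).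
  have := @Rintegral_ge0 _ _ _ mu `[d', d]%classic (fun x => `|f x|) (fun x _ => normr_ge0 _).
  lra.
have g1 := gle (a - e) (a + e); have g2 := gle (b - e) (b + e).
have f1 : `|\int[mu]_(x in `[a, a + e]) f x| <= \int[mu]_(x in `[a - e, a + e]) `|f x| := fle _ _ _ _ p1 p2 (lexx _).
have f2 : `|\int[mu]_(x in `[b - e, b]) f x| <= \int[mu]_(x in `[b - e, b + e]) `|f x| := fle _ _ _ _ (lexx _) p3 p4.
move: g1 g2 f1 f2.
move: (\int[mu]_(x in `[a - e, a + e]) (f x * cutoff e a b x)) => X1.
move: (\int[mu]_(x in `[b - e, b + e]) (f x * cutoff e a b x)) => X2.
move: (\int[mu]_(x in `[a, a + e]) f x) (\int[mu]_(x in `[b - e, b]) f x) => X3 X4.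
move: (\int[mu]_(x in `[a - e, a + e]) `|f x|) (\int[mu]_(x in `[b - e, b + e]) `|f x|) => X5 X6.
move: (\int[mu]_(x in `[a + e, b - e]) f x) => X7.
clear gle fle; rewrite !ler_norml => /andP[? ?] /andP[? ?] /andP[? ?] /andP[? ?].
by apply/andP; split; lra.
Qed.

(** Only cutoffs at the two given points are tested, and only of small width: the restriction
    [e < r0] admits time cutoffs, which have to stay in the positive half-line. *)
Lemma du_bois_reymond f g a b r0 : a < b -> locint f -> locint g ->
  mean_continuous f a -> mean_continuous f b -> 0 < r0 ->
  (forall e, 0 < e < r0 ->
    \int[mu]_x (f x * (dirac_approx e a x - dirac_approx e b x)) =
    - \int[mu]_x (g x * cutoff e a b x)) ->
  f b - f a = \int[mu]_(x in `[a, b]) g x.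
Proof.
move=> ab fi gi fa fb r00 fg.
apply/eqP; rewrite -subr_eq0 -normr_le0; apply/ler_addgt0Pr => eta eta0; rewrite add0r.
(* Two mollifier errors of [eta / 6], and twice the sum of two window integrals of [eta / 6], add up
   to [eta]. *)
have h0 : 0 < eta / 6 by rewrite divr_gt0.
have [d1 d10 H1] := dirac_approx_limit fi fa h0.
have [d2 d20 H2] := dirac_approx_limit fi fb h0.
have [d3 d30 H3] := locint_small a gi h0.
have [d4 d40 H4] := locint_small b gi h0.
pose m := Num.min (Num.min (Num.min d1 d2) (Num.min d3 d4)) (Num.min r0 ((b - a) / 2)).
have m0 : 0 < m by rewrite !lt_min d10 d20 d30 d40 r00 divr_gt0// subr_gt0.
pose e := m / 2.
have e0 : 0 < e by rewrite divr_gt0.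
have : e < m by rewrite /e; lra.
rewrite !lt_min => /andP[/andP[/andP[e1 e2] /andP[e3 e4]] /andP[e5 e6]].
have {}H1 := H1 e; rewrite e0 e1 in H1; have {}H1 := H1 erefl.
have {}H2 := H2 e; rewrite e0 e2 in H2; have {}H2 := H2 erefl.
have {}H3 := H3 e; rewrite e0 e3 in H3; have {}H3 := H3 erefl.
have {}H4 := H4 e; rewrite e0 e4 in H4; have {}H4 := H4 erefl.
have abe : a + e <= b - e by lra.
have H5 := cutoff_err e0 abe gi.
have := fg e; rewrite e0 e5 => /(_ erefl).
have sup c x : x <= a - e \/ b + e <= x -> c = a \/ c = b -> f x * dirac_approx e c x = 0.
  move=> hx hc; rewrite dirac_approx_out ?mulr0// ler_normr.
  by case: hx => hx; apply/orP; [right|left]; case: hc => ->; lra.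
have di c : locint (fun x => f x * dirac_approx e c x).
  move=> x y; apply: integrable_mul_bounded => //; first exact: dirac_approx_continuous.
  by move=> z; exact: dirac_approx_norm.
rewrite (_ : \int[mu]_x (f x * (dirac_approx e a x - dirac_approx e b x)) =
  \int[mu]_x (f x * dirac_approx e a x) - \int[mu]_x (f x * dirac_approx e b x)).
  move=> E; move: H1 H2 H3 H4 H5 E.
  move: (\int[mu]_x (f x * dirac_approx e a x)) (\int[mu]_x (f x * dirac_approx e b x)) => X1 X2.
  move: (\int[mu]_x (g x * cutoff e a b x)) (\int[mu]_(x in `[a, b]) g x) => X3 X4.
  move: (\int[mu]_(x in `[a - e, a + e]) `|g x|) (\int[mu]_(x in `[b - e, b + e]) `|g x|) => X5 X6.
  move: (f a) (f b) => X7 X8; clear.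
  rewrite !ler_norml => /andP[? ?] /andP[? ?] ? ? /andP[? ?] ?.
  apply/andP; split; lra.
rewrite (@Rintegral_support (fun x => f x * (_ - _)) (a - e) (b + e)); last first.
  move=> x hx; rewrite mulrBr (sup a x hx) ?(sup b x hx) ?subrr//; [by right|by left].
rewrite (@Rintegral_support (fun x => f x * dirac_approx e a x) (a - e) (b + e)); last first.
  by move=> x hx; apply: sup => //; left.
rewrite (@Rintegral_support (fun x => f x * dirac_approx e b x) (a - e) (b + e)); last first.
  by move=> x hx; apply: sup => //; right.
rewrite -RintegralB//; [|exact: di|exact: di].
by apply: eq_Rintegral => x _; rewrite mulrBr.
Qed.

End du_bois_reymond.

(** * Absolutely continuous representatives *)

Section weak_primitive.
Context {R : realType}.
Notation mu := (@lebesgue_measure R).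
Implicit Types (f g h : R -> R) (a b e : R).

Lemma ae_nonempty (P : R -> Prop) : {ae mu, forall x, P x} -> exists x, P x.
Proof.
move=> [A [mA A0 PA]]; apply: contrapT => nP.
have : (mu setT <= mu A)%E.
  by apply: le_measure; rewrite ?inE// => x _; apply: PA => Px; apply: nP; exists x.
by rewrite A0 -set_itvE lebesgue_measure_itv.
Qed.

Lemma ae_mono (P Q : R -> Prop) : (forall x, P x -> Q x) ->
  {ae mu, forall x, P x} -> {ae mu, forall x, Q x}.
Proof. by move=> PQ; apply: filterS; first exact: (ae_filter_ringOfSetsType mu). Qed.

Lemma ae_eq_Rintegral (D : set R) f g : measurable D -> measurable_fun D f ->
  measurable_fun D g -> {ae mu, forall x, f x = g x} ->
  \int[mu]_(x in D) f x = \int[mu]_(x in D) g x.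
Proof.
move=> mD mf mg fg; congr fine; apply: ae_eq_integral => //.
- exact/measurable_EFinP.
- exact/measurable_EFinP.
- by apply: ae_mono fg => x fgx _; rewrite /= fgx.
Qed.

(** The increment formula holds between any two Lebesgue points of [f]. One of them, [a0], is fixed
    and [U] is defined everywhere by integrating [g] from there; it agrees with [f] at all Lebesgue
    points. *)
Lemma weak_primitive f g : f \in Lfun mu 2%:E -> g \in Lfun mu 2%:E ->
  weak_derivative f g -> exists2 U : R -> R, {ae mu, forall x, f x = U x} &
    forall x y, x <= y -> U y - U x = \int[mu]_(z in `[x, y]) g z.
Proof.
move=> f2 g2 fg.
have fi : locint f by move=> a b; exact: Lfun2_segment.
have gi : locint g by move=> a b; exact: Lfun2_segment.
have fm : {ae mu, forall x, mean_continuous f x}.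
  have := lebesgue_differentiation (locally_integrable_segment (Lfun_measurable f2) fi).
  by apply: ae_mono => x; exact: lebesgue_ptP.
have [a0 fa0] := ae_nonempty fm.
have key a b : a < b -> mean_continuous f a -> mean_continuous f b ->
    f b - f a = \int[mu]_(z in `[a, b]) g z.
  move=> ab fa fb; apply: (du_bois_reymond ab fi gi fa fb ltr01) => e /andP[e0 _].
  have := fg _ (cutoff_test e0 (ltW ab)).
  suff -> : derive1 (cutoff e a b : R^o -> R^o) =
    (fun x => dirac_approx e a x - dirac_approx e b x) by [].
  by apply/funext => x; have [_] := cutoff_deriv e a b x; rewrite derive1E.
pose U x := if a0 <= x then f a0 + \int[mu]_(z in `[a0, x]) g z
  else f a0 - \int[mu]_(z in `[x, a0]) g z.
exists U.
  apply: ae_mono fm => x fx; rewrite /U; case: ltgtP => [ax|xa|<-].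
  - by rewrite -(key _ _ ax fa0 fx) addrC subrK.
  - by rewrite -(key _ _ xa fx fa0) opprB addrC subrK.
  - by rewrite Rintegral_segment1 addr0.
move=> x y xy; rewrite /U; have [ax|xa] := leP a0 x.
  rewrite (le_trans ax xy) (Rintegral_segment_cat ax xy (gi _ _)); ring.
have [ay|ya] := leP a0 y.
  rewrite (Rintegral_segment_cat (ltW xa) ay (gi _ _)); ring.
rewrite (Rintegral_segment_cat xy (ltW ya) (gi _ _)); ring.
Qed.

Lemma primitive_le f U x y : locint f ->
  (forall x y, x <= y -> U y - U x = \int[mu]_(z in `[x, y]) f z) -> x <= y ->
  `|U y - U x| <= \int[mu]_(z in `[x, y]) `|f z|.
Proof. by move=> fi Uf xy; rewrite Uf// le_normr_Rintegral. Qed.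

Lemma primitive_uniform f U : f \in Lfun mu 2%:E ->
  (forall x y, x <= y -> U y - U x = \int[mu]_(z in `[x, y]) f z) ->
  forall e, 0 < e -> exists2 dl : R, 0 < dl & forall x y, `|x - y| < dl -> `|U x - U y| <= e.
Proof.
move=> f2 Uf e e0.
have fi : locint f by move=> a b; exact: Lfun2_segment.
pose I := \int[mu]_x (f x ^+ 2).
have I0 : 0 <= I by apply: Rintegral_ge0 => x _; exact: sqr_ge0.
have I1 : 0 < I + 1 by rewrite ltr_wpDl.
(* With [lam * (I + 1) = e] the quadratic part of Young's bound is at most [e / 2], and a length
   below [e * lam] does the same for the other part. *)
have [lam lam0 lamE] : exists2 lam : R, 0 < lam & lam * (I + 1) = e.
  by exists (e / (I + 1)); [rewrite divr_gt0|rewrite divfK// gt_eqF].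
exists (e * lam); first by rewrite mulr_gt0.
have key x y : x <= y -> y - x < e * lam -> `|U y - U x| <= e.
  move=> xy xyd; rewrite (le_trans (primitive_le fi Uf xy))//.
  rewrite (le_trans (Lfun2_norm_segment_le xy lam0 f2))//.
  have h1 : lam / 2 * \int[mu]_(x in `[x, y]) (f x ^+ 2) <= e / 2.
    apply: (@le_trans _ _ (lam / 2 * (I + 1))).
      rewrite ler_wpM2l//; first by move: lam0; clear; lra.
      by rewrite (le_trans (Lfun2_sqr_segment_le x y f2))// lerDl.
    by rewrite mulrAC lamE.
  have h2 : (y - x) / (2 * lam) <= e / 2.
    have l2 : 0 < 2 * lam by rewrite mulr_gt0.
    by rewrite ler_pdivrMr// mulrA divfK// ltW.
  by rewrite [leRHS]splitr lerD.
move=> x y; have [xy|/ltW xy] := leP x y => h.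
  by rewrite distrC key// -(ger0_norm (_ : 0 <= y - x)) ?subr_ge0// distrC.
by rewrite key// -(ger0_norm (_ : 0 <= x - y)) ?subr_ge0.
Qed.

Lemma uniform_continuous f :
  (forall e, 0 < e -> exists2 dl : R, 0 < dl & forall x y, `|x - y| < dl -> `|f x - f y| <= e) ->
  continuous f.
Proof.
move=> fu x; apply/continuousP_eps => e e0; have [dl dl0 Hdl] := fu e e0.
by exists dl => // y; exact: Hdl.
Qed.

Lemma primitive_derive f U : continuous f ->
  (forall x y, x <= y -> U y - U x = \int[mu]_(z in `[x, y]) f z) ->
  forall x : R, is_derive x 1 U (f x).
Proof.
move=> fc Uf x; apply/is_deriveP => e e0.
have /continuousP_eps/(_ e e0)[dl dl0 Hdl] := fc x.
exists dl => // y yx.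
have ci a b c : mu.-integrable `[a, b] (EFin \o (fun z => f z - c)).
  by apply: integrable_EFinB => //; [exact: continuous_integrable_segment|exact: integrable_EFin_cst].
have E a b c : a <= b -> \int[mu]_(z in `[a, b]) f z - c * (b - a) =
    \int[mu]_(z in `[a, b]) (f z - c).
  move=> ab; rewrite RintegralB//; [|exact: continuous_integrable_segment|exact: integrable_EFin_cst].
  by rewrite Rintegral_segment_cst.
have [xy|/ltW xy] := leP x y.
  rewrite Uf// E// (ger0_norm (_ : 0 <= y - x)) ?subr_ge0//.
  apply: Rintegral_segment_norm_le => // z /andP[xz zy]; apply: Hdl.
  by rewrite (le_lt_trans _ yx)// !ger0_norm ?subr_ge0// lerD2r.
rewrite -normrN (_ : - _ = U x - U y - f x * (x - y)); last by ring.
rewrite Uf// E// (distrC y) (ger0_norm (_ : 0 <= x - y)) ?subr_ge0//.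
apply: Rintegral_segment_norm_le => // z /andP[xz zy]; apply: Hdl.
by rewrite (le_lt_trans _ yx)// !ler0_norm ?subr_le0// !opprB lerD2l lerN2.
Qed.

(** For every [y] in [[x, x + 1]], [|U x|] is at most [|U y|] plus the integral of [|g|]; one
    averages over [y] and applies Young's inequality. The localization to a unit segment is what
    yields decay at infinity. *)
Lemma sobolev_segment f g U x lam : f \in Lfun mu 2%:E -> g \in Lfun mu 2%:E ->
  {ae mu, forall x, f x = U x} -> continuous U ->
  (forall x y, x <= y -> U y - U x = \int[mu]_(z in `[x, y]) g z) -> 0 < lam ->
  `|U x| <= lam / 2 * (\int[mu]_(z in `[x, x + 1]) (f z ^+ 2) +
     \int[mu]_(z in `[x, x + 1]) (g z ^+ 2)) + 1 / lam.
Proof.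
move=> f2 g2 fU Uc Ug lam0.
have gi : locint g by move=> a b; exact: Lfun2_segment.
have xx : x <= x + 1 by rewrite lerDl.
pose J := \int[mu]_(z in `[x, x + 1]) `|g z|.
have nUc : continuous (fun y => `|U y|) by move=> y; apply: cvg_norm; exact: Uc.
have i1 := @continuous_integrable_segment R _ x (x + 1) nUc.
have h : `|U x| <= \int[mu]_(z in `[x, x + 1]) `|U z| + J.
  rewrite (_ : `|U x| = \int[mu]_(z in `[x, x + 1]) `|U x|); last first.
    by rewrite Rintegral_segment_cst// addrAC subrr add0r mulr1.
  rewrite (_ : J = \int[mu]_(z in `[x, x + 1]) J); last first.
    by rewrite Rintegral_segment_cst// addrAC subrr add0r mulr1.
  rewrite -RintegralD//; last exact: integrable_EFin_cst.
  apply: le_Rintegral => //.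
  - exact: integrable_EFin_cst.
  - by apply: integrable_EFinD => //; exact: integrable_EFin_cst.
  - move=> y; rewrite /= in_itv /= => /andP[xy yx].
    have h1 : \int[mu]_(z in `[x, y]) `|g z| <= J.
      have ni : mu.-integrable `[x, x + 1] (EFin \o (fun z => `|g z|)) by exact: integrable_norm.
      by rewrite /J (Rintegral_segment_cat xy yx ni) lerDl Rintegral_ge0.
    have h2 := primitive_le gi Ug xy.
    rewrite -[U x](subKr (U y)) (le_trans (ler_normB _ _))// lerD2l.
    exact: le_trans h1.
have e1 : \int[mu]_(z in `[x, x + 1]) `|U z| = \int[mu]_(z in `[x, x + 1]) `|f z|.
  apply: ae_eq_Rintegral => //.
  - by have /integrableP[/measurable_EFinP] := i1.
  - by apply: measurableT_comp => //; apply: measurable_funTS; exact: Lfun_measurable f2.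
  - by apply: ae_mono fU => z ->.
rewrite (le_trans h)// e1.
have h1 := Lfun2_norm_segment_le xx lam0 f2; have h2 := Lfun2_norm_segment_le xx lam0 g2.
rewrite (le_trans (lerD h1 h2))// mulrDr addrACA lerD2l.
by rewrite addrAC subrr add0r invfM le_eqVlt; apply/orP; left; apply/eqP; field; rewrite gt_eqF.
Qed.

Lemma integral_tail_segment f : (forall x, 0 <= f x) ->
  mu.-integrable setT (EFin \o f) -> forall eta, 0 < eta ->
  exists L : R, forall x, L <= `|x| -> \int[mu]_(z in `[x, x + 1]) f z <= eta.
Proof.
move=> f0 fi eta eta0.
pose F (n : nat) : set R := `[- n%:R, n%:R]%classic.
have Fnd : {homo F : n m / (n <= m)%N >-> (n <= m)%O}.
  move=> n m nm; apply/subsetPset => x; rewrite /F /= !in_itv /= => /andP[h1 h2].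
  have := nm; rewrite -(ler_nat R) => nm'.
  by apply/andP; split; [rewrite (le_trans _ h1)// lerN2|exact: le_trans nm'].
have FT : \bigcup_i F i = setT.
  rewrite -subTset => x _; exists (Num.Def.archi_bound `|x|) => //.
  rewrite /F /= in_itv /= -ler_norml ltW// archi_boundP//.
have mf : measurable_fun setT (EFin \o f) by exact: (measurable_int _ fi).
have cv : (\int[mu]_(x in F n) (f x)%:E)%E @[n --> \oo] --> (\int[mu]_(x in \bigcup_i F i) (f x)%:E)%E.
  apply: ge0_nondecreasing_set_cvg_integral => //.
  - by move=> n; exact: measurable_itv.
  - by move=> n; exact: measurable_funTS.
  - by move=> n x _; rewrite lee_fin.
have fin : (\int[mu]_x (f x)%:E)%E \is a fin_num := integrable_fin_num measurableT fi.
pose I := \int[mu]_x f x.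
move: cv; rewrite FT -(fineK fin) => /fine_cvgP[_ /cvgrPdist_lt/(_ _ eta0)[n _ Hn]].
have {}Hn := Hn n (leqnn n); rewrite /= -/(Rintegral _ _ _) -/(Rintegral mu (F n) f) -/I in Hn.
have seg a b : mu.-integrable `[a, b] (EFin \o f) by exact: (@integrableS _ _ _ mu setT).
have leI a b : \int[mu]_(z in `[a, b]) f z <= I.
  rewrite /I /Rintegral fine_le//; first exact: integrable_fin_num.
  by apply: ge0_subset_integral => // x _; rewrite lee_fin.
have pos a b : 0 <= \int[mu]_(z in `[a, b]) f z by exact: Rintegral_ge0.
have nn : - n%:R <= n%:R :> R by rewrite lerNl (le_trans _ (ler0n _ n))// oppr_le0.
have {}Hn : I - \int[mu]_(z in `[- n%:R, n%:R]) f z <= eta.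
  by rewrite (le_trans (ler_norm _))// ltW.
have n0 : 0 <= n%:R :> R by [].
(* The extra [1] serves negative [x], where the unit segment extends towards the origin. *)
exists (n%:R + 1) => x; rewrite ler_normr => /orP[nx|nx].
- have l1 : n%:R <= x by lra.
  have l2 : x <= x + 1 by lra.
  have := leI (- n%:R) (x + 1).
  rewrite (Rintegral_segment_cat nn (le_trans l1 l2) (seg _ _)).
  rewrite (Rintegral_segment_cat l1 l2 (seg _ _)).
  have := pos n%:R x.
  move: Hn; move: (\int[mu]_(z in `[_, _]) f z) (\int[mu]_(z in `[_, _]) f z) (\int[mu]_(z in `[_, _]) f z) => X1 X2 X3.
  clear; lra.
- have l1 : x + 1 <= - n%:R by lra.
  have l2 : x <= x + 1 by lra.
  have := leI x n%:R.
  rewrite (Rintegral_segment_cat l2 (le_trans l1 nn) (seg _ _)).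
  rewrite (Rintegral_segment_cat l1 nn (seg _ _)).
  have := pos (x + 1) (- n%:R).
  move: Hn; move: (\int[mu]_(z in `[_, _]) f z) (\int[mu]_(z in `[_, _]) f z) (\int[mu]_(z in `[_, _]) f z) => X1 X2 X3.
  clear; lra.
Qed.

End weak_primitive.

Lemma integrable_setU d (T : measurableType d) (R : realType) (mu : {measure set T -> \bar R})
    (A B : set T) (f : T -> \bar R) : measurable A -> measurable B -> [disjoint A & B] ->
  mu.-integrable A f -> mu.-integrable B f -> mu.-integrable (A `|` B) f.
Proof.
move=> mA mB AB /integrableP[mfA iA] /integrableP[mfB iB].
have mf : measurable_fun (A `|` B) f by apply/measurable_funU.
apply/integrableP; split => //.
have mAf : measurable_fun (A `|` B) (fun x => `|f x|%E) by exact: measurableT_comp.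
rewrite (ge0_integral_setU _ mA mB mAf) => //.
by rewrite lte_add_pinfty.
Qed.

(** * The convolution with exp(-|x|)/2 as a solution of P - P'' = g *)

Section green_function.
Context {R : realType}.
Notation mu := (@lebesgue_measure R).
Implicit Types (g : R -> R) (a : R).

Lemma continuous_expRN : continuous (fun x : R => expR (- x)).
Proof.
move=> z; apply: (@continuous_comp _ _ _ (fun z : R => - z) expR); last exact: continuous_expR.
by apply: cvgN; exact: cvg_id.
Qed.

Lemma integral_expRN_ray a : (\int[mu]_(x in `[a, +oo[) (expR (- x))%:E = (expR (- a))%:E)%E.
Proof.
have d (x : R) : is_derive x 1 (fun x => - expR (- x)) (expR (- x)).
  rewrite -[X in is_derive _ _ _ X]opprK; apply: is_deriveN.
  rewrite -mulrN1; exact: (@is_derive1_comp _ expR (fun z => - z)).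
rewrite (@ge0_continuous_FTC2y _ (fun x => expR (- x)) (fun x => - expR (- x)) a 0).
- by rewrite -EFinB opprK add0r.
- by move=> x _; exact: expR_ge0.
- by apply: continuous_subspaceT; exact: continuous_expRN.
- by rewrite -oppr0; apply: cvgN; exact: cvgr_expR.
- by move=> x _; have [] := d x.
- by apply/cvg_at_right_filter; exact: is_derive_continuous (d a).
- by move=> x _; have [_] := d x; rewrite derive1E.
Qed.

Lemma integral_expR_ray a : (\int[mu]_(x in `]-oo, a]) (expR x)%:E = (expR a)%:E)%E.
Proof.
rewrite -[a in `]-oo, a]]opprK ge0_integration_by_substitutionNy.
- by rewrite integral_expRN_ray opprK.
- by apply: continuous_subspaceT; exact: continuous_expR.
- by move=> x _; exact: expR_ge0.
Qed.

Lemma integrable_expRN_ray a : mu.-integrable `[a, +oo[ (EFin \o (fun x => expR (- x))).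
Proof.
apply/integrableP; split.
  by apply/measurable_EFinP/measurable_funTS; exact: continuous_measurable_fun continuous_expRN.
under eq_integral do rewrite /= ger0_norm ?expR_ge0//.
by rewrite integral_expRN_ray ltry.
Qed.

Lemma integrable_expR_ray a : mu.-integrable `]-oo, a] (EFin \o expR).
Proof.
apply/integrableP; split.
  by apply/measurable_EFinP/measurable_funTS.
under eq_integral do rewrite /= ger0_norm ?expR_ge0//.
by rewrite integral_expR_ray ltry.
Qed.

Variables (g : R -> R) (C : R).
Hypothesis gc : continuous g.
Hypothesis gC : forall x, `|g x| <= C.

Let Kp a := \int[mu]_(y in `[a, +oo[) (expR (- y) * g y).
Let Km a := \int[mu]_(y in `]-oo, a]) (expR y * g y).

Let ip a : mu.-integrable `[a, +oo[ (EFin \o (fun y => expR (- y) * g y)).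
Proof. exact: integrable_mul_bounded gc gC (integrable_expRN_ray a). Qed.

Let im a : mu.-integrable `]-oo, a] (EFin \o (fun y => expR y * g y)).
Proof. exact: integrable_mul_bounded gc gC (integrable_expR_ray a). Qed.

Let Kp_prim x y : x <= y -> - Kp y - - Kp x = \int[mu]_(z in `[x, y]) (expR (- z) * g z).
Proof.
move=> xy; have := @Rintegral_itvB R _ (BLeft x) +oo%O y (ip x).
rewrite !bnd_simp => /(_ xy erefl) E.
have E2 : \int[mu]_(z in `]y, +oo[) (expR (- z) * g z) = Kp y.
  apply: Rintegral_itv_obnd_cbnd; apply: integrableS (ip y) => //.
  by apply: subset_itv; rewrite bnd_simp.
rewrite E2 -/(Kp x) in E.
by rewrite -E opprB opprK subrK.
Qed.

Let Km_prim x y : x <= y -> Km y - Km x = \int[mu]_(z in `[x, y]) (expR z * g z).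
Proof.
move=> xy; have := @Rintegral_itvB R _ -oo%O (BRight y) x (im y).
rewrite !bnd_simp => /(_ erefl xy) E.
rewrite -/(Km y) -/(Km x) in E; rewrite E.
apply: Rintegral_itv_obnd_cbnd; apply: integrableS (im y) => //.
by apply: subset_itv; rewrite bnd_simp.
Qed.

Let Kpd (x : R) : is_derive x 1 Kp (- (expR (- x) * g x)).
Proof.
rewrite (_ : Kp = fun x => - - Kp x); last by apply/funext => y; rewrite opprK.
apply: is_deriveN; apply: (primitive_derive (f := fun z => expR (- z) * g z)) => [z|]; last exact: Kp_prim.
by apply: cvgM; [exact: continuous_expRN|exact: gc].
Qed.

Let Kmd (x : R) : is_derive x 1 Km (expR x * g x).
Proof.
apply: (primitive_derive (f := fun z => expR z * g z)) => [z|]; last exact: Km_prim.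
by apply: cvgM; [exact: continuous_expR|exact: gc].
Qed.

(** With [Em], the two halves of the convolution, over [y >= x] and [y <= x]: the kernel factors on
    each side, so each half solves a first-order equation. *)
Let Ep x := expR x * Kp x.
Let Em x := expR (- x) * Km x.

Let C0 : 0 <= C. Proof. exact: le_trans (gC 0). Qed.

Let Ep_le x : `|Ep x| <= C.
Proof.
have h : `|Kp x| <= C * expR (- x).
  rewrite (le_trans (le_normr_Rintegral _ (ip x)))//.
  rewrite (_ : C * _ = \int[mu]_(y in `[x, +oo[) (C * expR (- y))); last first.
    by rewrite RintegralZl ?integrable_expRN_ray// /Rintegral integral_expRN_ray.
  apply: le_Rintegral => //.
  - exact: integrable_norm (ip x).
  - by apply: integrable_EFinZl => //; exact: integrable_expRN_ray.
  - by move=> y _; rewrite normrM ger0_norm ?expR_ge0// mulrC ler_wpM2r// expR_ge0.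
rewrite /Ep normrM ger0_norm ?expR_ge0//.
rewrite (le_trans (ler_wpM2l (expR_ge0 x) h))// mulrCA -expRD subrr expR0 mulr1//.
Qed.

Let Em_le x : `|Em x| <= C.
Proof.
have h : `|Km x| <= C * expR x.
  rewrite (le_trans (le_normr_Rintegral _ (im x)))//.
  rewrite (_ : C * _ = \int[mu]_(y in `]-oo, x]) (C * expR y)); last first.
    by rewrite RintegralZl ?integrable_expR_ray// /Rintegral integral_expR_ray.
  apply: le_Rintegral => //.
  - exact: integrable_norm (im x).
  - by apply: integrable_EFinZl => //; exact: integrable_expR_ray.
  - by move=> y _; rewrite normrM ger0_norm ?expR_ge0// mulrC ler_wpM2r// expR_ge0.
rewrite /Em normrM ger0_norm ?expR_ge0//.
rewrite (le_trans (ler_wpM2l (expR_ge0 (- x)) h))// mulrCA -expRD addNr expR0 mulr1//.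
Qed.

Let GconvE x : Gconv g x = 2^-1 * (Em x + Ep x).
Proof.
rewrite /Gconv; congr (_ * _).
have im' : mu.-integrable `]-oo, x] (EFin \o (fun y => expR (- `|x - y|) * g y)).
  apply: eq_integrable (integrable_EFinZl (expR (- x)) (measurable_itv _) (im x)) => //.
  move=> y; rewrite inE /= in_itv /= => yx.
  by rewrite /= mulrA -expRD ger0_norm ?subr_ge0// opprB addrC.
have ip' : mu.-integrable `[x, +oo[ (EFin \o (fun y => expR (- `|x - y|) * g y)).
  apply: eq_integrable (integrable_EFinZl (expR x) (measurable_itv _) (ip x)) => //.
  move=> y; rewrite inE /= in_itv /= andbT => xy.
  by rewrite /= mulrA -expRD ler0_norm ?subr_le0// opprK.
have ip'' : mu.-integrable `]x, +oo[ (EFin \o (fun y => expR (- `|x - y|) * g y)).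
  by apply: integrableS ip' => //; apply: subset_itv; rewrite bnd_simp.
have U : [set: R] = `]-oo, x]%classic `|` `]x, +oo[%classic.
  apply/esym; rewrite -subTset => y _ /=; rewrite !in_itv /= andbT.
  by have [h|h] := leP y x; [left|right].
have dis : [disjoint `]-oo, x]%classic & `]x, +oo[%classic].
  apply/disj_setPS => y /= []; rewrite !in_itv /= andbT => yx xy.
  by move: (lt_le_trans xy yx); rewrite ltxx.
rewrite U Rintegral_setU//.
- congr (_ + _).
    rewrite /Em /Km -RintegralZl//; apply: eq_Rintegral => y; rewrite inE /= in_itv /= => yx.
    by rewrite /= mulrA -expRD ger0_norm ?subr_ge0// opprB addrC.
  rewrite Rintegral_itv_obnd_cbnd// /Ep /Kp -RintegralZl//.
  apply: eq_Rintegral => y; rewrite inE /= in_itv /= andbT => xy.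
  by rewrite /= mulrA -expRD ler0_norm ?subr_le0// opprK.
- exact: integrable_setU.
Qed.

(** [Gconv g] is half the sum of [Em] and [Ep], and the witness [Q] is half of [Ep - Em]; both
    equations follow from [Em' = g - Em] and [Ep' = Ep - g]. *)
Lemma green_function_solves : exists Q : R -> R,
  [/\ forall x : R, is_derive x 1 (Gconv g) (Q x),
      forall x : R, is_derive x 1 Q (Gconv g x - g x),
      forall x, `|Gconv g x| <= C & forall x, `|Q x| <= C].
Proof.
have Emd (x : R) : is_derive x 1 Em (g x - Em x).
  have h := is_derive_reflect (is_derive_expR (- x)).
  rewrite (_ : g x - Em x = expR (- x) * (expR x * g x) + Km x * (- expR (- x))); last first.
    by rewrite /Em mulrA -expRD addNr expR0 mul1r; ring.
  exact: (@is_deriveM _ _ (fun x => expR (- x)) Km).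
have Epd (x : R) : is_derive x 1 Ep (Ep x - g x).
  rewrite (_ : Ep x - g x = expR x * (- (expR (- x) * g x)) + Kp x * expR x); last first.
    by rewrite mulrN mulrA -expRD subrr expR0 mul1r /Ep; ring.
  exact: (@is_deriveM _ _ expR Kp).
have -> : Gconv g = fun x => 2^-1 * (Em x + Ep x) by apply/funext => x; exact: GconvE.
exists (fun x => 2^-1 * (Ep x - Em x)); split=> x.
- rewrite (_ : Ep x - Em x = (g x - Em x) + (Ep x - g x)); last by ring.
  by apply: is_deriveZ; exact: is_deriveD.
- rewrite (_ : _ - _ = 2^-1 * ((Ep x - g x) - (g x - Em x))); last by field.
  by apply: is_deriveZ; exact: is_deriveB.
- rewrite normrM ger0_norm ?invr_ge0//; have := Ep_le x; have := Em_le x.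
  by have := ler_normD (Em x) (Ep x); lra.
- rewrite normrM ger0_norm ?invr_ge0//; have := Ep_le x; have := Em_le x.
  by have := ler_normB (Ep x) (Em x); lra.
Qed.

End green_function.

(** * Continuous representatives of functions in H^2 *)

Section H2_representatives.
Context {R : realType}.
Notation mu := (@lebesgue_measure R).
Implicit Types (f g U V : R -> R).

(** Continuity of [U] and [V] follows from the integral formulas once [f1] and [f2] are in [L^2];
    since [f1] agrees almost everywhere with the continuous [V], the latter is the classical
    derivative of [U]. *)
Definition H2_rep (f f1 f2 U V : R -> R) : Prop :=
  [/\ {ae mu, forall x, f x = U x}, {ae mu, forall x, f1 x = V x},
      (forall x y, x <= y -> U y - U x = \int[mu]_(z in `[x, y]) f1 z) &
      (forall x y, x <= y -> V y - V x = \int[mu]_(z in `[x, y]) f2 z)].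

Lemma H2_rep_exists f f1 f2 : H2_function f f1 f2 -> exists UV, H2_rep f f1 f2 UV.1 UV.2.
Proof.
move=> [[h0 h1 h2] w1 w2].
have [U fU Uf1] := weak_primitive h0 h1 w1.
have [V f1V Vf2] := weak_primitive h1 h2 w2.
by exists (U, V).
Qed.

Section H2_rep_properties.
Variables (f f1 f2 U V : R -> R).
Hypothesis H2 : [/\ f \in Lfun mu 2%:E, f1 \in Lfun mu 2%:E & f2 \in Lfun mu 2%:E].
Hypothesis rep : H2_rep f f1 f2 U V.

Lemma H2_rep_Vuniform e : 0 < e ->
  exists2 dl : R, 0 < dl & forall x y, `|x - y| < dl -> `|V x - V y| <= e.
Proof. by have [_ _ h2] := H2; have [_ _ _ r4] := rep; apply: (primitive_uniform h2 r4). Qed.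

Lemma H2_rep_Uuniform e : 0 < e ->
  exists2 dl : R, 0 < dl & forall x y, `|x - y| < dl -> `|U x - U y| <= e.
Proof. by have [_ h1 _] := H2; have [_ _ r3 _] := rep; apply: (primitive_uniform h1 r3). Qed.

Lemma H2_rep_deriv (x : R) : is_derive x 1 U (V x).
Proof.
have [_ h1 _] := H2; have [_ r2 r3 _] := rep.
have Vc := uniform_continuous (@H2_rep_Vuniform).
apply: primitive_derive => // y z yz; rewrite r3//.
apply: ae_eq_Rintegral => //.
  by apply: measurable_funTS; exact: Lfun_measurable h1.
by apply: measurable_funTS; exact: continuous_measurable_fun.
Qed.

Lemma H2_rep_sobolev lam x : 0 < lam ->
  `|U x| <= lam / 2 * (\int[mu]_(z in `[x, x + 1]) (f z ^+ 2) +
     \int[mu]_(z in `[x, x + 1]) (f1 z ^+ 2)) + 1 / lam /\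
  `|V x| <= lam / 2 * (\int[mu]_(z in `[x, x + 1]) (f1 z ^+ 2) +
     \int[mu]_(z in `[x, x + 1]) (f2 z ^+ 2)) + 1 / lam.
Proof.
move=> l0; have [h0 h1 h2] := H2; have [r1 r2 r3 r4] := rep.
have Vc := uniform_continuous (@H2_rep_Vuniform).
have Uc := uniform_continuous (@H2_rep_Uuniform).
by split; exact: sobolev_segment.
Qed.

Lemma H2_rep_le (s : R) x : 0 < s -> \int[mu]_z (f z ^+ 2) <= s ^+ 2 ->
  \int[mu]_z (f1 z ^+ 2) <= s ^+ 2 -> \int[mu]_z (f2 z ^+ 2) <= s ^+ 2 ->
  `|U x| <= 2 * s /\ `|V x| <= 2 * s.
Proof.
move=> s0 n0 n1 n2; have [h0 h1 h2] := H2.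
(* [lam = 1 / s] balances the Sobolev bound: [lam / 2 * (2 * s ^+ 2) + 1 / lam = 2 * s]. *)
have si : 0 < s^-1 by rewrite invr_gt0.
have [k1 k2] := H2_rep_sobolev x si.
have m0 := le_trans (Lfun2_sqr_segment_le x (x + 1) h0) n0.
have m1 := le_trans (Lfun2_sqr_segment_le x (x + 1) h1) n1.
have m2 := le_trans (Lfun2_sqr_segment_le x (x + 1) h2) n2.
have key X Y : X <= s ^+ 2 -> Y <= s ^+ 2 -> s^-1 / 2 * (X + Y) + 1 / s^-1 <= 2 * s.
  move=> X1 Y1; have XY : X + Y <= 2 * s ^+ 2 by lra.
  have p : 0 <= s^-1 / 2 by rewrite divr_ge0// ltW.
  have := ler_wpM2l p XY.
  rewrite (_ : s^-1 / 2 * (2 * s ^+ 2) = s); last by field; rewrite gt_eqF.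
  by rewrite div1r invrK; lra.
by split; [exact: le_trans k1 (key _ _ m0 m1)|exact: le_trans k2 (key _ _ m1 m2)].
Qed.

Lemma H2_rep_bdd : exists C, forall x, `|U x| <= C /\ `|V x| <= C.
Proof.
pose I := \int[mu]_z (f z ^+ 2) + \int[mu]_z (f1 z ^+ 2) + \int[mu]_z (f2 z ^+ 2).
have p0 : 0 <= \int[mu]_z (f z ^+ 2) by apply: Rintegral_ge0 => ? _; exact: sqr_ge0.
have p1 : 0 <= \int[mu]_z (f1 z ^+ 2) by apply: Rintegral_ge0 => ? _; exact: sqr_ge0.
have p2 : 0 <= \int[mu]_z (f2 z ^+ 2) by apply: Rintegral_ge0 => ? _; exact: sqr_ge0.
exists (2 * (I + 1)) => x; apply: H2_rep_le; rewrite /I;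
  move: p0 p1 p2; move: (\int[mu]_z (f z ^+ 2)) (\int[mu]_z (f1 z ^+ 2)) (\int[mu]_z (f2 z ^+ 2)) => X Y Z;
  clear; move=> ? ? ?; first lra.
- by rewrite expr2; nra.
- by rewrite expr2; nra.
- by rewrite expr2; nra.
Qed.

Lemma H2_rep_decay e : 0 < e -> exists L : R, forall x, L <= `|x| -> `|U x| <= e /\ `|V x| <= e.
Proof.
move=> e0; have [h0 h1 h2] := H2.
(* Tails of size [(e / 2) ^+ 2] and [lam = 2 / e] give [e / 2 + e / 2] in the Sobolev bound. *)
have d0 : 0 < (e / 2) ^+ 2 by rewrite exprn_gt0// divr_gt0.
have tail g : g \in Lfun mu 2%:E -> exists L : R, forall x, L <= `|x| ->
    \int[mu]_(z in `[x, x + 1]) (g z ^+ 2) <= (e / 2) ^+ 2.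
  move=> g2; apply: (integral_tail_segment _ (Lfun2_integrable_sqr g2) d0) => x.
  exact: sqr_ge0.
have [L0 H0] := tail f h0; have [L1 H1] := tail f1 h1; have [L2 H2'] := tail f2 h2.
exists (Num.max L0 (Num.max L1 L2)) => x; rewrite !ge_max => /and3P[/H0 k0 /H1 k1 /H2' k2].
have l0 : 0 < 2 / e by rewrite divr_gt0.
have [s1 s2] := H2_rep_sobolev x l0.
have key X Y : X <= (e / 2) ^+ 2 -> Y <= (e / 2) ^+ 2 -> 2 / e / 2 * (X + Y) + 1 / (2 / e) <= e.
  move=> X1 Y1; have XY : X + Y <= 2 * (e / 2) ^+ 2 by lra.
  have p : 0 <= 2 / e / 2 by rewrite divr_ge0// ltW.
  have := ler_wpM2l p XY.
  rewrite (_ : 2 / e / 2 * (2 * (e / 2) ^+ 2) = e / 2); last by field; rewrite gt_eqF.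
  rewrite (_ : 1 / (2 / e) = e / 2); last by field; rewrite gt_eqF.
  lra.
by split; [exact: le_trans s1 (key _ _ k0 k1)|exact: le_trans s2 (key _ _ k1 k2)].
Qed.

End H2_rep_properties.

(** Linearity lets the Sobolev bound act on the difference of two times, turning continuity in [H^2]
    into continuity of [U] and [V] uniformly in [x]. *)
Lemma H2_repB f f1 f2 U V g g1 g2 U' V' :
  [/\ f \in Lfun mu 2%:E, f1 \in Lfun mu 2%:E & f2 \in Lfun mu 2%:E] ->
  [/\ g \in Lfun mu 2%:E, g1 \in Lfun mu 2%:E & g2 \in Lfun mu 2%:E] ->
  H2_rep f f1 f2 U V -> H2_rep g g1 g2 U' V' ->
  H2_rep (f \- g) (f1 \- g1) (f2 \- g2) (U \- U') (V \- V').
Proof.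
move=> [h0 h1 h2] [k0 k1 k2] [r1 r2 r3 r4] [q1 q2 q3 q4].
have aeB a1 a2 A1 A2 : {ae mu, forall x : R, a1 x = A1 x :> R} ->
    {ae mu, forall x, a2 x = A2 x :> R} -> {ae mu, forall x, (a1 \- a2) x = (A1 \- A2) x}.
  move=> e1 e2; have := @filterI _ _ (ae_filter_ringOfSetsType mu) _ _ e1 e2.
  by apply: ae_mono => x [/= -> ->].
have seg a1 a2 A1 A2 : a1 \in Lfun mu 2%:E -> a2 \in Lfun mu 2%:E ->
    (forall x y, x <= y -> A1 y - A1 x = \int[mu]_(z in `[x, y]) a1 z) ->
    (forall x y, x <= y -> A2 y - A2 x = \int[mu]_(z in `[x, y]) a2 z) ->
    forall x y, x <= y -> (A1 \- A2) y - (A1 \- A2) x = \int[mu]_(z in `[x, y]) (a1 \- a2) z.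
  move=> i1 i2 e1 e2 x y xy /=; rewrite RintegralB//; [|exact: Lfun2_segment|exact: Lfun2_segment].
  by rewrite -e1// -e2//; ring.
by split; [exact: aeB|exact: aeB|exact: seg|exact: seg].
Qed.

Lemma Lp2_sqr_le f (s : R) : 0 <= s -> f \in Lfun mu 2%:E ->
  (Lp_norm_on 2%:E setT f <= s%:E)%E -> \int[mu]_x (f x ^+ 2) <= s ^+ 2.
Proof.
move=> s0 f2; rewrite /Lp_norm_on patch_setT => fs.
have : ('N[mu]_2%:E[EFin \o f] `^ 2 <= s%:E `^ 2)%E.
  by apply: gt0_ler_poweR => //; rewrite in_itv /= ?Lnorm_ge0 ?leey ?lee_fin ?s0.
rewrite powR_Lnorm// poweR_EFin powR_mulrn// => h.
have i := Lfun2_integrable_sqr f2.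
rewrite -lee_fin (_ : (\int[mu]_x (f x ^+ 2))%:E = (\int[mu]_x (f x ^+ 2)%:E)%E).
  apply: le_trans h; rewrite le_eqVlt; apply/orP; left; apply/eqP.
  apply: eq_integral => x _; rewrite /comp abse_EFin poweR_EFin powR_mulrn// real_normK//.
  exact: num_real.
by rewrite /Rintegral fineK//; exact: integrable_fin_num.
Qed.

End H2_representatives.

Section H2_path.
Context {R : realType}.
Notation mu := (@lebesgue_measure R).

Lemma Lfun2B (f g : R -> R) : f \in Lfun mu 2%:E -> g \in Lfun mu 2%:E ->
  f \- g \in Lfun mu 2%:E.
Proof.
move=> f2 g2; have p1 : (1 <= 2%:E :> \bar R)%E by rewrite lee_fin ler1n.
exact: (Lfun_addr_closed mu p1).2 f (- g) f2 (Lfun_oppr_closed g2).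
Qed.

Lemma H2_path_small (u ux uxx : R -> R -> R) (t0 s : R) : continuous_H2_path u ux uxx ->
  0 <= t0 -> 0 < s -> exists2 dl : R, 0 < dl & forall t, 0 <= t -> `|t - t0| < dl ->
   [/\ \int[mu]_x ((u t \- u t0) x ^+ 2) <= s ^+ 2, \int[mu]_x ((ux t \- ux t0) x ^+ 2) <= s ^+ 2 &
       \int[mu]_x ((uxx t \- uxx t0) x ^+ 2) <= s ^+ 2].
Proof.
move=> [hH hc] t00 s0.
have /fine_cvgP[ffin /cvgrPdist_lt/(_ s s0) fsm] := hc t0 t00.
have := filterI ffin fsm => -[dl /= dl0 Hdl].
exists dl => // t t_ge0 td.
have [|fin] := Hdl t _ t_ge0; first by rewrite /ball /= distrC.
rewrite /= sub0r normrN => sm.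
have {}sm : (H2_norm (u t \- u t0)%R (ux t \- ux t0)%R (uxx t \- uxx t0)%R <= s%:E)%E.
  by rewrite -(fineK fin) lee_fin (le_trans (ler_norm _))// ltW.
have [[a0 a1 a2] _ _] := hH t t_ge0; have [[b0 b1 b2] _ _] := hH t0 t00.
have n f : (0 <= Lp_norm_on 2%:E setT f)%E by exact: Lnorm_ge0.
split; apply: Lp2_sqr_le (ltW s0) (Lfun2B _ _) _ => //; apply: le_trans sm; rewrite /H2_norm.
- by rewrite -addeA leeDl// adde_ge0 ?n.
- by rewrite addeAC leeDr// adde_ge0 ?n.
- by rewrite leeDr// adde_ge0 ?n.
Qed.

Lemma H2_path_regular (b : R) (u ux uxx : R -> R -> R) : 0 < b < 3 ->
  continuous_H2_path u ux uxx -> exists U V P Q, [/\ bfam_reg b U V P Q,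
    forall t, 0 <= t -> H2_rep (u t) (ux t) (uxx t) (U t) (V t) &
    forall t, 0 <= t -> P t = Gconv (fun y => b_source b (U t y) (V t y))].
Proof.
move=> hb hu; have [hH hc] := hu.
have /choice[UV HUV] : forall t, exists UV : (R -> R) * (R -> R),
    0 <= t -> H2_rep (u t) (ux t) (uxx t) UV.1 UV.2.
  move=> t; have [t0|t0] := leP 0 t; last by exists (u t, u t).
  by have [UV h] := H2_rep_exists (hH t t0); exists UV.
pose U t := (UV t).1; pose V t := (UV t).2.
have rep t : 0 <= t -> H2_rep (u t) (ux t) (uxx t) (U t) (V t) := HUV t.
have L2 t : 0 <= t -> [/\ u t \in Lfun mu 2%:E, ux t \in Lfun mu 2%:E & uxx t \in Lfun mu 2%:E].
  by move=> t0; have [] := hH t t0.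
pose g t y := b_source b (U t y) (V t y).
have Uc t : 0 <= t -> continuous (U t).
  by move=> t0; apply: uniform_continuous => e; exact: (H2_rep_Uuniform (L2 t t0) (rep t t0)).
have Vc t : 0 <= t -> continuous (V t).
  by move=> t0; apply: uniform_continuous => e; exact: (H2_rep_Vuniform (L2 t t0) (rep t t0)).
have bdd t : 0 <= t -> exists C, forall x, `|U t x| <= C /\ `|V t x| <= C.
  by move=> t0; exact: (H2_rep_bdd (L2 t t0) (rep t t0)).
have /choice[Q HQ] : forall t, exists Q : R -> R, 0 <= t ->
    [/\ forall x : R, is_derive x 1 (Gconv (g t)) (Q x),
      forall x : R, is_derive x 1 Q (Gconv (g t) x - g t x) &
      exists C, forall x, `|Gconv (g t) x| <= C /\ `|Q x| <= C].
  move=> t; have [t0|t0] := leP 0 t; last by exists (u t).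
  have [C HC] := bdd t t0.
  have gc : continuous (g t).
    move=> x; rewrite /g /b_source; apply: cvgD; (apply: cvgM; first exact: cvg_cst);
      rewrite expr2; apply: cvgM; [exact: Uc|exact: Uc|exact: Vc|exact: Vc].
  have gC x : `|g t x| <= 2 * C ^+ 2 by have [? ?] := HC x; exact: b_source_norm_le.
  have [Q [q1 q2 q3 q4]] := green_function_solves gc gC.
  by exists Q => _; split => //; exists (2 * C ^+ 2) => x; split.
exists U, V, (fun t => Gconv (g t)), Q; split => //; split.
- by move=> t x t0; exact: (H2_rep_deriv (L2 t t0) (rep t t0)).
- by move=> t x t0; have [h _ _] := HQ t t0.
- by move=> t x t0; have [_ h _] := HQ t t0; exact: h.
- move=> t0 e t00 e0.
  (* The constant [2] of [H2_rep_le] turns [e / 4] into [e / 2]; the other half is the spatial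
     modulus at time [t0]. *)
  have e4 : 0 < e / 4 by rewrite divr_gt0.
  have e2 : 0 < e / 2 by rewrite divr_gt0.
  have [d1 d10 H1] := H2_path_small hu t00 e4.
  have [d2 d20 H2] := H2_rep_Uuniform (L2 _ t00) (rep _ t00) e2.
  have [d3 d30 H3] := H2_rep_Vuniform (L2 _ t00) (rep _ t00) e2.
  exists (Num.min d1 (Num.min d2 d3)); first by rewrite !lt_min d10 d20.
  move=> t x y t_ge0; rewrite !lt_min => /andP[td _] /and3P[_ xy2 xy3].
  have [n0 n1 n2] := H1 t t_ge0 td.
  have [s1 s2] : `|(U t \- U t0) x| <= 2 * (e / 4) /\ `|(V t \- V t0) x| <= 2 * (e / 4).
    apply: (@H2_rep_le _ (u t \- u t0) (ux t \- ux t0) (uxx t \- uxx t0)) => //.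
      have [a0 a1 a2] := L2 t t_ge0; have [b0 b1 b2] := L2 t0 t00.
      by split; exact: Lfun2B.
    exact: H2_repB (L2 _ t_ge0) (L2 _ t00) (rep _ t_ge0) (rep _ t00).
  have k2 := H2 x y xy2; have k3 := H3 x y xy3.
  have tri (f : R -> R -> R) : `|(f t \- f t0) x| <= 2 * (e / 4) -> `|f t0 x - f t0 y| <= e / 2 ->
      `|f t x - f t0 y| <= e.
    move=> /= f1 f2; rewrite (_ : _ - _ = (f t x - f t0 x) + (f t0 x - f t0 y)); last by ring.
    by rewrite (le_trans (ler_normD _ _))//; move: f1 f2; clear; lra.
  by split; apply: tri.
- by move=> t e t0 e0; exact: (H2_rep_decay (L2 t t0) (rep t t0) e0).
- move=> t t0; have [C HC] := bdd t t0; have [_ _ [C' HC']] := HQ t t0.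
  exists (Num.max C C') => x; have [c1 c2] := HC x; have [c3 c4] := HC' x.
  by rewrite !le_max c1 c2 c3 c4 !orbT.
Qed.

End H2_path.

(** * From the weak to the classical equation *)

Section weighted_integral.
Context {R : realType}.
Notation mu := (@lebesgue_measure R).

(* Truncating the time at [0] makes the integral continuous on the whole line. *)
Lemma weighted_integral_continuous (phi : R -> R -> R) (w : R -> R) (B c d : R) :
  (forall t, 0 <= t -> continuous (phi t)) ->
  (forall t0 e, 0 <= t0 -> 0 < e -> exists2 dl : R, 0 < dl & forall t x, 0 <= t ->
     `|t - t0| < dl -> `|phi t x - phi t0 x| <= e) ->
  continuous w -> (forall x, `|w x| <= B) -> (forall x, x <= c \/ d <= x -> w x = 0) ->
  c <= d -> continuous (fun t : R => \int[mu]_x (phi (Num.max 0 t) x * w x)).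
Proof.
move=> phic phit wc wB w0 cd.
have B0 : 0 <= B by exact: le_trans (wB 0).
have m0 t : 0 <= Num.max 0 t :> R by rewrite le_max lexx.
have E t : \int[mu]_x (phi (Num.max 0 t) x * w x) =
    \int[mu]_(x in `[c, d]) (phi (Num.max 0 t) x * w x).
  by apply: Rintegral_support => x /w0 ->; rewrite mulr0.
have ci t : mu.-integrable `[c, d] (EFin \o (fun x => phi (Num.max 0 t) x * w x)).
  by apply: continuous_integrable_segment => x; apply: cvgM; [exact: phic|exact: wc].
move=> t; apply/continuousP_eps => e e0.
have D0 : 0 < B * (d - c) + 1 by rewrite ltr_wpDl// mulr_ge0// subr_ge0.
have [dl dl0 Hdl] := phit (Num.max 0 t) (e / (B * (d - c) + 1)) (m0 t) (divr_gt0 e0 D0).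
exists dl => // s st; rewrite !E -RintegralB//.
have ms : `|Num.max 0 s - Num.max 0 t| < dl.
  apply: le_lt_trans st; have [s0|s0] := leP 0 s; have [t0|t0] := leP 0 t => //.
  - by rewrite subr0 !ger0_norm; lra.
  - by rewrite sub0r normrN -(normrN (s - t)) !ger0_norm; lra.
  - by rewrite subrr normr0.
apply: (@le_trans _ _ (e / (B * (d - c) + 1) * B * (d - c))).
  apply: Rintegral_segment_norm_le => //; first exact: integrable_EFinB.
  by move=> x _; rewrite -mulrBl normrM ler_pM// Hdl.
rewrite -mulrA mulrAC ler_pdivrMr// ler_pM2l//; move: D0; clear; lra.
Qed.

Lemma outside_segment (x1 x2 e x : R) : x1 <= x2 -> 0 < e -> x <= x1 - e \/ x2 + e <= x ->
  e <= `|x - x1| /\ e <= `|x - x2|.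
Proof.
by move=> x12 e0 [h|h]; split; rewrite ler_normr; apply/orP; [right|right|left|left]; lra.
Qed.

End weighted_integral.

Lemma small_eq0 {R : realType} (D C r : R) : 0 < r ->
  (forall e, 0 < e < r -> `|D| <= C * e) -> D = 0.
Proof.
move=> r0 h; apply/eqP; rewrite -normr_le0; apply/ler_addgt0Pr => e e0; rewrite add0r.
have C0 : 0 < `|C| + 1 by rewrite ltr_wpDl.
pose d := Num.min (e / (`|C| + 1)) (r / 2).
have d0 : 0 < d by rewrite lt_min !divr_gt0.
have dr : d < r by rewrite gt_min; apply/orP; right; lra.
have := h d; rewrite d0 dr => /(_ erefl) /le_trans; apply.
have : d <= e / (`|C| + 1) by rewrite ge_min lexx.
rewrite ler_pdivlMr// mulrC => /(le_trans _); apply.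
by rewrite ler_wpM2r ?(ltW d0)// (le_trans (ler_norm C))// lerDl.
Qed.

Lemma bfam_flux_time_cont {R : realType} {b : R} {U V P Q : R -> R -> R} x :
  0 < b < 3 -> bfam_reg b U V P Q ->
  continuous (fun s : R => 2^-1 * U (Num.max 0 s) x ^+ 2 + P (Num.max 0 s) x).
Proof.
move=> hb H s; apply/continuousP_eps => e e0.
have m0 t : 0 <= Num.max 0 t :> R by rewrite le_max lexx.
have [dl dl0 Hdl] := bfam_flux_cont hb H (m0 s) e0.
exists dl => // t ts; apply: Hdl => //; last by rewrite subrr normr0.
apply: le_lt_trans ts; have [s0|s0] := leP 0 s; have [t0|t0] := leP 0 t => //.
- by rewrite sub0r normrN -(normrN (t - s)) !ger0_norm; lra.
- by rewrite subr0 !ger0_norm; lra.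
- by rewrite subrr normr0.
Qed.

(** * The integrated conservation law on rectangles *)

Section evolution.
Context {R : realType} {b : R} {u ux uxx U V P Q : R -> R -> R}.
Notation mu := (@lebesgue_measure R).
Hypothesis hb : 0 < b < 3.
Hypothesis H : bfam_reg b U V P Q.
Hypothesis hu : forall t, 0 <= t ->
  u t \in Lfun mu 2%:E /\ ux t \in Lfun mu 2%:E.
Hypothesis rep : forall t, 0 <= t -> H2_rep (u t) (ux t) (uxx t) (U t) (V t).
Hypothesis hP : forall t, 0 <= t -> P t = Gconv (fun y => b_source b (U t y) (V t y)).
Hypothesis hsol : b_family_solution b u ux.

Let F t x := 2^-1 * U t x ^+ 2 + P t x.

Let Uc t : 0 <= t -> continuous (U t).
Proof. by move=> t0 x; exact: is_derive_continuous (bfam_U H x t0). Qed.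

Let Vc t : 0 <= t -> continuous (V t).
Proof.
move=> t0; apply: uniform_continuous => e e0; have [dl dl0 Hdl] := bfam_modulus H t e0.
have tt : 0 <= t <= t by rewrite t0 lexx.
by exists dl => // x y xy; have [] := Hdl t x y tt xy.
Qed.

Let Fc t : 0 <= t -> continuous (F t).
Proof. by move=> t0 x; exact: is_derive_continuous (bfam_flux_deriv H x t0). Qed.

(** The convolution ignores null sets, so at every [x] its value can be computed from the continuous
    representatives; the local term keeps [u] until it is integrated. *)
Lemma b_fluxE t x : 0 <= t -> b_flux b (u t) (ux t) x = 2^-1 * u t x ^+ 2 + P t x.
Proof.
move=> t0; have [r1 r2 _ _] := rep t0; have [u2 ux2] := hu t0.
have mexp : measurable_fun setT (fun y : R => expR (- `|x - y|)).
  by do 3 apply: measurableT_comp => //; apply: measurable_funB.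
have msrc (f f1 : R -> R) : measurable_fun setT f -> measurable_fun setT f1 ->
    measurable_fun setT (fun y : R => expR (- `|x - y|) * (b / 2 * f y ^+ 2 + (3 - b) / 2 * f1 y ^+ 2)).
  move=> mf mf1; apply: measurable_funM; first exact: mexp.
  by apply: measurable_funD; apply: measurable_funM => //; apply: measurable_funX.
have r12 := @filterI _ _ (ae_filter_ringOfSetsType mu) _ _ r1 r2.
rewrite /b_flux hP//; congr (_ + _).
rewrite /Gconv; congr (_ * _); apply: ae_eq_Rintegral => //.
- by apply: msrc; [exact: Lfun_measurable u2|exact: Lfun_measurable ux2].
- by apply: msrc; apply: continuous_measurable_fun; [exact: Uc|exact: Vc].
- by apply: ae_mono r12 => y [/= -> ->].
Qed.

Section space_cutoff.
Variables (x1 x2 e : R).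
Hypothesis x12 : x1 <= x2.
Hypothesis e0 : 0 < e.

Let pos (t : R) := Num.max 0 t.
Let posE t : 0 <= t -> pos t = t. Proof. exact: max_idPr. Qed.

Let psi := cutoff e x1 x2.
Let dpsi x := dirac_approx e x1 x - dirac_approx e x2 x.
Let a_ t := \int[mu]_x (U (pos t) x * psi x).
Let c_ t := \int[mu]_x (F (pos t) x * dpsi x).

Let psic : continuous psi. Proof. exact: cutoff_continuous. Qed.
Let dpsic : continuous dpsi.
Proof. by move=> x; apply: cvgB; exact: dirac_approx_continuous. Qed.

Let psiB x : `|psi x| <= 1.
Proof. by have /andP[h1 h2] := cutoff_itv e0 x12 x; rewrite ger0_norm. Qed.

Let dpsiB x : `|dpsi x| <= step_mass^-1 / e + step_mass^-1 / e.
Proof. by rewrite (le_trans (ler_normB _ _))// lerD// dirac_approx_norm. Qed.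

Let psi0 x : x <= x1 - e \/ x2 + e <= x -> psi x = 0.
Proof. exact: cutoff_out. Qed.

Let dpsi0 x : x <= x1 - e \/ x2 + e <= x -> dpsi x = 0.
Proof.
move=> hx; have [h1 h2] := outside_segment x12 e0 hx.
by rewrite /dpsi !dirac_approx_out ?subrr.
Qed.

Let supp_le : x1 - e <= x2 + e.
Proof. by move: x12 e0; lra. Qed.

Let a_cont : continuous a_.
Proof.
apply: (weighted_integral_continuous Uc _ psic psiB psi0 supp_le) => t0 e' t00 e'0.
have [dl dl0 Hdl] := bfam_cont H t00 e'0; exists dl => // t x t_ge0 td.
by have [] := Hdl t x x t_ge0 td _; rewrite ?subrr ?normr0.
Qed.

Let c_cont : continuous c_.
Proof.
apply: (weighted_integral_continuous Fc _ dpsic dpsiB dpsi0 supp_le) => t0 e' t00 e'0.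
have [dl dl0 Hdl] := bfam_flux_cont hb H t00 e'0; exists dl => // t x t_ge0 td.
by apply: Hdl => //; rewrite subrr normr0.
Qed.

(** [k1] and [k2] stand for the time factors of the two derivatives of the product cutoff; they are
    constants in the space integral, which leaves the scalar functions [a_] and [c_]. *)
Let inner (t k1 k2 : R) : 0 <= t ->
  \int[mu]_x (u t x * (k1 * psi x) + b_flux b (u t) (ux t) x * (k2 * dpsi x)) =
  k1 * a_ t + k2 * c_ t.
Proof.
move=> t0; have [r1 _ _ _] := rep t0; have [u2 _] := hu t0.
have mU : measurable_fun setT (U t) by exact: continuous_measurable_fun (Uc t0).
have mP : measurable_fun setT (P t).
  apply: continuous_measurable_fun => x; exact: is_derive_continuous (bfam_P H x t0).
have mpsi : measurable_fun setT psi by exact: continuous_measurable_fun.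
have mdpsi : measurable_fun setT dpsi by exact: continuous_measurable_fun.
have mtot (f : R -> R) : measurable_fun setT f -> measurable_fun setT
    (fun x => f x * (k1 * psi x) + (2^-1 * f x ^+ 2 + P t x) * (k2 * dpsi x)).
  move=> mf; apply: measurable_funD; apply: measurable_funM => //; try exact: measurable_funM.
  by apply: measurable_funD => //; apply: measurable_funM => //; exact: measurable_funX.
rewrite (_ : \int[mu]_x _ = \int[mu]_x
  (U t x * (k1 * psi x) + (2^-1 * U t x ^+ 2 + P t x) * (k2 * dpsi x))); last first.
  transitivity (\int[mu]_x (u t x * (k1 * psi x) + (2^-1 * u t x ^+ 2 + P t x) * (k2 * dpsi x))).
    by apply: eq_Rintegral => x _; rewrite b_fluxE.
  apply: ae_eq_Rintegral => //; [exact: mtot (Lfun_measurable u2)|exact: mtot|].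
  by apply: ae_mono r1 => x ->.
rewrite (@Rintegral_support _ _ (x1 - e) (x2 + e)); last first.
  by move=> x hx; rewrite psi0// dpsi0// !mulr0 addr0.
rewrite /a_ /c_ posE// (@Rintegral_support _ (fun x => U t x * psi x) (x1 - e) (x2 + e)); last first.
  by move=> x hx; rewrite psi0// mulr0.
rewrite (@Rintegral_support _ (fun x => F t x * dpsi x) (x1 - e) (x2 + e)); last first.
  by move=> x hx; rewrite dpsi0// mulr0.
have i1 : mu.-integrable `[x1 - e, x2 + e] (EFin \o (fun x => U t x * psi x)).
  apply: continuous_integrable_segment => x; apply: cvgM; [exact: Uc|exact: psic].
have i2 : mu.-integrable `[x1 - e, x2 + e] (EFin \o (fun x => F t x * dpsi x)).
  apply: continuous_integrable_segment => x; apply: cvgM; [exact: Fc|exact: dpsic].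
rewrite -!RintegralZl// -RintegralD//; [|exact: integrable_EFinZl|exact: integrable_EFinZl].
by apply: eq_Rintegral => x _; rewrite /F; ring.
Qed.

(** Against product cutoffs the weak equation says that [c_] is the weak time derivative of [a_]; as
    both are continuous, du Bois-Reymond's lemma applies at every pair of positive times. The width
    [r < t1] keeps the support in positive times. *)
Lemma evolution_cutoff t1 t2 : 0 < t1 -> t1 < t2 ->
  a_ t2 - a_ t1 = \int[mu]_(t in `[t1, t2]) c_ t.
Proof.
move=> t10 t12.
apply: (@du_bois_reymond R a_ c_ t1 t2 t1 t12 (continuous_locint a_cont) (continuous_locint c_cont)
  (continuous_mean t1 a_cont) (continuous_mean t2 a_cont) t10) => r /andP[r0 rt1].
have := hsol (cutoff2_test r0 e0 rt1 (ltW t12) x12).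
pose G t := a_ t * (dirac_approx r t1 t - dirac_approx r t2 t) + c_ t * cutoff r t1 t2 t.
have G0 t : t <= t1 - r \/ t2 + r <= t -> G t = 0.
  move=> ht; have [h1 h2] := outside_segment (ltW t12) r0 ht.
  by rewrite /G cutoff_out// ?(ltW t12)// !dirac_approx_out ?subrr ?mulr0 ?addr0.
rewrite (_ : \int[mu]_(t in `]0, +oo[) _ = \int[mu]_t G t); last first.
  rewrite (_ : \int[mu]_t G t = \int[mu]_(t in `]0, +oo[) G t); last first.
    rewrite [RHS]Rintegral_mkcond; apply: eq_Rintegral => t _; rewrite patchE.
    case: ifPn => //; rewrite notin_setE /= in_itv /= andbT => /negP; rewrite -leNgt => t0.
    by apply: G0; left; rewrite (le_trans t0)// subr_ge0 ltW.
  apply: eq_Rintegral => t; rewrite inE /= in_itv /= andbT => t0.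
  rewrite /G (mulrC (a_ t)) (mulrC (c_ t)) -(inner _ _ (ltW t0)).
  by apply: eq_Rintegral => x _; rewrite cutoff2_Dt cutoff2_Dx.
have dc c : continuous (@dirac_approx R r c) by exact: dirac_approx_continuous.
have c1 : continuous (fun t => a_ t * (dirac_approx r t1 t - dirac_approx r t2 t)).
  move=> t; apply: cvgM; first exact: a_cont.
  by apply: cvgB; exact: dc.
have c2 : continuous (fun t => c_ t * cutoff r t1 t2 t).
  by move=> t; apply: cvgM; [exact: c_cont|exact: cutoff_continuous].
rewrite (Rintegral_support G0) (@Rintegral_support _ (fun t => a_ t * _) (t1 - r) (t2 + r)); last first.
  move=> t ht; have [h1 h2] := outside_segment (ltW t12) r0 ht.
  by rewrite !dirac_approx_out ?subrr ?mulr0.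
rewrite (@Rintegral_support _ (fun t => c_ t * _) (t1 - r) (t2 + r)); last first.
  by move=> t ht; rewrite cutoff_out ?mulr0// ltW.
rewrite RintegralD//; [|exact: continuous_integrable_segment|exact: continuous_integrable_segment].
by move=> /eqP; rewrite addr_eq0 => /eqP.
Qed.

End space_cutoff.

Let flux_dirac_err (t x e L : R) : 0 <= t -> 0 < e -> (forall y, `|U t y * V t y + Q t y| <= L) ->
  `|\int[mu]_y (F t y * dirac_approx e x y) - F t x| <= 2 * (step_mass^-1 * L) * e.
Proof.
move=> t0 e0 HL; have m0 := @step_mass_gt0 R.
have Fi : locint (F t) by exact: continuous_locint (Fc t0).
apply: le_trans (dirac_approx_err x (F t x) e0 Fi) _.
rewrite (_ : 2 * _ * e = step_mass^-1 / e * (L * e * (x + e - (x - e)))); last first.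
  by field; rewrite (gt_eqF e0) (gt_eqF m0).
apply: ler_wpM2l; first by rewrite divr_ge0 ?invr_ge0 ?(ltW m0) ?(ltW e0).
apply: le_trans (ler_norm _) _; apply: Rintegral_segment_norm_le; first by move: e0; lra.
  apply: continuous_integrable_segment => y; apply: cvg_norm.
  by apply: cvgB; [exact: Fc|exact: cvg_cst].
move=> y /andP[y1 y2]; rewrite normr_id.
apply: le_trans (derive_bound_lip x y (fun z => bfam_flux_deriv H z t0) HL) _.
apply: ler_wpM2l; first exact: le_trans (HL x).
by rewrite ler_norml; apply/andP; split; lra.
Qed.

Let flux_dirac_split (t x1 x2 e : R) : 0 <= t -> x1 <= x2 -> 0 < e ->
  \int[mu]_x (F t x * (dirac_approx e x1 x - dirac_approx e x2 x)) =
  \int[mu]_x (F t x * dirac_approx e x1 x) - \int[mu]_x (F t x * dirac_approx e x2 x).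
Proof.
move=> t0 x12 e0.
have dc c : continuous (fun x => F t x * dirac_approx e c x).
  by move=> x; apply: cvgM; [exact: Fc|exact: dirac_approx_continuous].
have sup x : x <= x1 - e \/ x2 + e <= x ->
    F t x * dirac_approx e x1 x = 0 /\ F t x * dirac_approx e x2 x = 0.
  move=> hx; have [h1 h2] := outside_segment x12 e0 hx.
  by rewrite !dirac_approx_out// mulr0.
rewrite (Rintegral_support (fun x hx => (sup x hx).1)) (Rintegral_support (fun x hx => (sup x hx).2)).
rewrite (@Rintegral_support _ _ (x1 - e) (x2 + e)); last first.
  by move=> x hx; have [h1 h2] := sup x hx; rewrite mulrBr h1 h2 subrr.
rewrite -RintegralB//; [|exact: continuous_integrable_segment|exact: continuous_integrable_segment].
by apply: eq_Rintegral => x _; rewrite mulrBr.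
Qed.

Let segment_U_err (t x1 x2 e K : R) : 0 <= t -> 0 < e -> x1 + e <= x2 - e ->
  (forall x, `|U t x| <= K) ->
  `|\int[mu]_x (U t x * cutoff e x1 x2 x) - \int[mu]_(x in `[x1, x2]) U t x| <= 8 * K * e.
Proof.
move=> t0 e0 x12 HK.
have Ui : locint (U t) by exact: continuous_locint (Uc t0).
apply: le_trans (cutoff_err e0 x12 Ui) _.
have h x : \int[mu]_(y in `[x - e, x + e]) `|U t y| <= K * (x + e - (x - e)).
  apply: le_trans (ler_norm _) _; apply: Rintegral_segment_norm_le; first by move: e0; lra.
    by apply: continuous_integrable_segment => y; apply: cvg_norm; exact: Uc.
  by move=> y _; rewrite normr_id.
have := h x1; have := h x2.
move: (\int[mu]_(x in `[x1 - e, x1 + e]) _) (\int[mu]_(x in `[x2 - e, x2 + e]) _) => I1 I2.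
by move=> ? ?; lra.
Qed.

Let G x1 x2 (s : R) := F (Num.max 0 s) x1 - F (Num.max 0 s) x2.

Let G_int x1 x2 a c : mu.-integrable `[a, c] (EFin \o G x1 x2).
Proof.
by apply: continuous_integrable_segment => s; apply: cvgB; exact: (bfam_flux_time_cont hb H).
Qed.

Let evolution_pos t1 t2 x1 x2 : 0 < t1 -> t1 < t2 -> x1 < x2 ->
  \int[mu]_(x in `[x1, x2]) U t2 x - \int[mu]_(x in `[x1, x2]) U t1 x =
  \int[mu]_(s in `[t1, t2]) G x1 x2 s.
Proof.
move=> t10 t12 x12; have t20 := lt_trans t10 t12.
have [K K0 HK] := bfam_UV_bdd H t2.
pose L := 3 * K ^+ 2; pose m := @step_mass R.
apply/eqP; rewrite -subr_eq0; apply/eqP.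
(* [16 * K] collects the space cutoff errors at the times [t1] and [t2]; the other term collects the
   mollification errors of the flux at [x1] and [x2], integrated over time. *)
apply: (@small_eq0 _ _ (16 * K + 4 * (m^-1 * L) * (t2 - t1)) ((x2 - x1) / 2)).
  by rewrite divr_gt0// subr_gt0.
move=> e /andP[e0 ex]; have x12' := ltW x12.
have := evolution_cutoff x12' e0 t10 t12.
have pE (t : R) : 0 <= t -> Num.max 0 t = t by exact: max_idPr.
rewrite !(pE t1 (ltW t10)) !(pE t2 (ltW t20)).
have xe : x1 + e <= x2 - e by lra.
have a1 := segment_U_err (ltW t10) e0 xe (fun x => (HK t1 x (introT andP (conj (ltW t10) (ltW t12)))).1).
have a2 := segment_U_err (ltW t20) e0 xe (fun x => (HK t2 x (introT andP (conj (ltW t20) (lexx _)))).1).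
pose c_ (t : R) := \int[mu]_x (F (Num.max 0 t) x * (dirac_approx e x1 x - dirac_approx e x2 x)).
have ci : mu.-integrable `[t1, t2] (EFin \o c_).
  apply: continuous_integrable_segment => t.
  have dc : continuous (fun x => dirac_approx e x1 x - dirac_approx e x2 x).
    by move=> x; apply: cvgB; exact: dirac_approx_continuous.
  apply: (weighted_integral_continuous Fc _ dc (B := m^-1 / e + m^-1 / e) (c := x1 - e) (d := x2 + e)).
  - move=> t0 e' t00 e'0; have [dl dl0 Hdl] := bfam_flux_cont hb H t00 e'0; exists dl => // s x s0 st.
    by apply: Hdl => //; rewrite subrr normr0.
  - by move=> x; rewrite (le_trans (ler_normB _ _))// lerD// dirac_approx_norm.
  - move=> x hx; have [h1 h2] := outside_segment x12' e0 hx.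
    by rewrite !dirac_approx_out ?subrr.
  - by move: e0 x12'; lra.
have : `|\int[mu]_(t in `[t1, t2]) c_ t - \int[mu]_(t in `[t1, t2]) G x1 x2 t| <=
    4 * (m^-1 * L) * e * (t2 - t1).
  rewrite -RintegralB//; apply: Rintegral_segment_norm_le; first exact: ltW.
    exact: integrable_EFinB.
  move=> t /andP[h1 h2]; have t0 : 0 <= t by rewrite (le_trans _ h1)// ltW.
  rewrite /c_ /G !(pE t t0) flux_dirac_split//.
  have HL y : `|U t y * V t y + Q t y| <= L.
    by have [] := bfam_flux_bdd hb H y HK (introT andP (conj t0 h2)).
  have := flux_dirac_err x1 t0 e0 HL; have := flux_dirac_err x2 t0 e0 HL; rewrite -/m.
  move: (\int[mu]_x (F t x * dirac_approx e x1 x)) (\int[mu]_x (F t x * dirac_approx e x2 x)) => I1 I2.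
  move: (F t x1) (F t x2) (m^-1 * L) => F1 F2 Z.
  rewrite !ler_norml => /andP[? ?] /andP[? ?]; apply/andP; split; lra.
rewrite /c_ => a3 E; move: a1 a2 a3; rewrite -E.
move: (\int[mu]_x (U t1 x * _)) (\int[mu]_x (U t2 x * _)) (\int[mu]_(t in `[t1, t2]) _) => I1 I2 I3.
move: (\int[mu]_(x in `[x1, x2]) U t1 x) (\int[mu]_(x in `[x1, x2]) U t2 x) => I4 I5.
rewrite (_ : (16 * K + _) * e = 8 * K * e + 8 * K * e + 4 * (m^-1 * L) * e * (t2 - t1)); last by ring.
move: (8 * K * e) (4 * (m^-1 * L) * e * (t2 - t1)) => Z1 Z2.
rewrite !ler_norml => /andP[? ?] /andP[? ?] /andP[? ?]; apply/andP; split; lra.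
Qed.

(** The weak equation is tested at positive times only. The identity from [r] to [t] is extended to
    [0] by letting [r] tend to [0], using continuity of [U] at time [0] and boundedness of the
    flux. *)
Lemma evolution (t x1 x2 : R) : 0 <= t -> x1 <= x2 ->
  \int[mu]_(x in `[x1, x2]) U t x - \int[mu]_(x in `[x1, x2]) U 0 x =
  \int[mu]_(s in `[0, t]) (F (Num.max 0 s) x1 - F (Num.max 0 s) x2).
Proof.
move=> t_ge0 x12_; have [t0|t0|<-] := ltgtP 0 t; [|by rewrite ltNge t_ge0 in t0|by rewrite subrr Rintegral_segment1].
have [x12|x12|<-] := ltgtP x1 x2; [|by rewrite ltNge x12_ in x12|]; last first.
  rewrite !Rintegral_segment1 subrr; under eq_Rintegral do rewrite subrr.
  by rewrite Rintegral_segment_cst ?mul0r// ltW.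
have [K K0 HK] := bfam_UV_bdd H t.
apply/eqP; rewrite -subr_eq0; apply/eqP.
apply: (@small_eq0 _ _ (x2 - x1 + 6 * K ^+ 2) 1 ltr01) => e /andP[e0 e1].
have [dl dl0 Hdl] := bfam_cont H (lexx 0) e0.
pose r := Num.min (Num.min dl e) t / 2.
have mm : 0 < Num.min (Num.min dl e) t by rewrite !lt_min dl0 e0.
have r0 : 0 < r by rewrite divr_gt0.
have : r < Num.min (Num.min dl e) t by rewrite /r; lra.
rewrite !lt_min => /andP[/andP[rdl re] rt].
have E := evolution_pos r0 rt x12.
have C := @Rintegral_segment_cat _ (G x1 x2) 0 r t (ltW r0) (ltW rt) (G_int x1 x2 0 t).
rewrite -[\int[mu]_(s in `[0, t]) (_ - _)]/(\int[mu]_(s in `[0, t]) G x1 x2 s).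
have a1 : `|\int[mu]_(x in `[x1, x2]) U r x - \int[mu]_(x in `[x1, x2]) U 0 x| <= e * (x2 - x1).
  have ir : mu.-integrable `[x1, x2] (EFin \o U r) by apply: continuous_integrable_segment; exact: Uc (ltW r0).
  have i0 : mu.-integrable `[x1, x2] (EFin \o U 0) by apply: continuous_integrable_segment; exact: Uc.
  rewrite -RintegralB//; apply: Rintegral_segment_norm_le; [exact: ltW|exact: integrable_EFinB|].
  move=> x _; have [||h _] := Hdl r x x (ltW r0); [|by rewrite subrr normr0|exact: h].
  by rewrite subr0 ger0_norm ?(ltW r0).
have a2 : `|\int[mu]_(s in `[0, r]) G x1 x2 s| <= (3 * K ^+ 2 + 3 * K ^+ 2) * (r - 0).
  apply: Rintegral_segment_norm_le; [exact: ltW|exact: G_int|move=> s /andP[s0 sr]].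
  have st : 0 <= s <= t by rewrite s0 (le_trans sr)// ltW.
  rewrite /G (max_idPr s0) (le_trans (ler_normB _ _))// lerD//.
    by have [] := bfam_flux_bdd hb H x1 HK st.
  by have [] := bfam_flux_bdd hb H x2 HK st.
have a3 : (3 * K ^+ 2 + 3 * K ^+ 2) * (r - 0) <= 6 * K ^+ 2 * e.
  rewrite subr0 -mulrDl (_ : 3 + 3 = 6 :> R); last by lra.
  by rewrite ler_wpM2l ?mulr_ge0 ?sqr_ge0// ltW.
have {a3}a2 := le_trans a2 a3.
move: a1 a2 E; rewrite C (mulrDl (x2 - x1)) (mulrC e).
move: (\int[mu]_(s in `[0, r]) _) (\int[mu]_(s in `[r, t]) _) => I1 I2.
move: (\int[mu]_(x in `[x1, x2]) U r x) (\int[mu]_(x in `[x1, x2]) U 0 x) (\int[mu]_(x in `[x1, x2]) U t x) => I4 I5 I6.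
move: ((x2 - x1) * e) (6 * K ^+ 2 * e) => Z1 Z2.
rewrite !ler_norml => /andP[? ?] /andP[? ?] ?; apply/andP; split; lra.
Qed.

End evolution.

(** * The potential and the initial mass *)

Section potential.
Context {R : realType}.
Notation mu := (@lebesgue_measure R).

Lemma continuous_antiderivative (f : R -> R) : continuous f ->
  exists X : R -> R, forall x y, x <= y -> X y - X x = \int[mu]_(z in `[x, y]) f z.
Proof.
move=> fc.
exists (fun x => if 0 <= x then \int[mu]_(z in `[0, x]) f z else - \int[mu]_(z in `[x, 0]) f z).
have cat a c d : a <= c -> c <= d -> \int[mu]_(x in `[a, d]) f x =
    \int[mu]_(x in `[a, c]) f x + \int[mu]_(x in `[c, d]) f x.
  by move=> ac cd; apply: Rintegral_segment_cat => //; exact: continuous_integrable_segment.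
move=> x y xy; have [x0|x0] := leP 0 x; have [y0|y0] := leP 0 y.
- by rewrite (cat 0 x y)// addrAC subrr add0r.
- by have := lt_le_trans y0 (le_trans x0 xy); rewrite ltxx.
- by rewrite (cat x 0 y) ?(ltW x0)// opprK addrC.
- by rewrite (cat x y 0) ?(ltW y0)// opprK addrC addrK.
Qed.

(** The time derivative is built into the formula for [W]. The conservation law enters in the space
    derivative: it says that [W t] has the increments of an antiderivative of [U t]. *)
Lemma bfam_exists (b : R) (U V P Q : R -> R -> R) : 0 < b < 3 -> bfam_reg b U V P Q ->
  (forall t x1 x2, 0 <= t -> x1 <= x2 ->
    \int[mu]_(x in `[x1, x2]) U t x - \int[mu]_(x in `[x1, x2]) U 0 x =
    \int[mu]_(s in `[0, t]) ((2^-1 * U (Num.max 0 s) x1 ^+ 2 + P (Num.max 0 s) x1) -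
      (2^-1 * U (Num.max 0 s) x2 ^+ 2 + P (Num.max 0 s) x2))) ->
  exists W, bfam b W U V P Q.
Proof.
move=> hb H E; have Uc t : 0 <= t -> continuous (U t).
  by move=> t0 x; exact: is_derive_continuous (bfam_U H x t0).
have [X0 HX0] := continuous_antiderivative (Uc 0 (lexx 0)).
pose F x (s : R) := 2^-1 * U (Num.max 0 s) x ^+ 2 + P (Num.max 0 s) x.
have Fc x : continuous (F x) by exact: (bfam_flux_time_cont hb H).
exists (fun t x => X0 x - \int[mu]_(s in `[0, t]) F x s); split => //.
- move=> t x t0; apply: primitive_derive => [|y z yz]; first exact: Uc.
  have := E t y z t0 yz; rewrite -(HX0 y z yz) RintegralB//;
    [|exact: continuous_integrable_segment (Fc y)|exact: continuous_integrable_segment (Fc z)].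
  rewrite -/(F y) -/(F z).
  move: (\int[mu]_(x0 in _) _) (\int[mu]_(x0 in `[0, t]) F y x0) (\int[mu]_(x0 in `[0, t]) F z x0) => I1 I2 I3; lra.
- move=> t x t0; rewrite -[- _]add0r.
  have h := Rintegral_segment_deriv (Fc x) t0.
  rewrite (_ : - _ = - F x t); last by rewrite /F (max_idPr (ltW t0)).
  by apply: is_deriveD; apply: is_deriveN.
- move=> x e e0; have [K K0 HK] := bfam_UV_bdd H 1.
  exists (Num.min 1 (e / (3 * K ^+ 2))).
    by rewrite lt_min ltr01 divr_gt0// mulr_gt0// exprn_gt0.
  move=> s /andP[s0]; rewrite lt_min => /andP[s1 se].
  rewrite Rintegral_segment1 subr0 addrAC subrr add0r normrN.
  have F3 z : 0 <= z <= s -> `|F x z| <= 3 * K ^+ 2.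
    move=> /andP[z0 zs]; rewrite /F (max_idPr z0).
    have z1 : 0 <= z <= 1 by rewrite z0 (le_trans zs (ltW s1)).
    by have [] := bfam_flux_bdd hb H x HK z1.
  apply: le_trans (Rintegral_segment_norm_le s0 (continuous_integrable_segment _ _ (Fc x)) F3) _.
  by rewrite subr0 mulrC -ler_pdivlMr ?ltW// mulr_gt0// exprn_gt0.
Qed.

Lemma H2_rep_momentum (f f1 f2 U V W : R -> R) x y :
  [/\ f \in Lfun mu 2%:E, f1 \in Lfun mu 2%:E & f2 \in Lfun mu 2%:E] ->
  H2_rep f f1 f2 U V -> continuous U -> (forall z : R, is_derive z 1 W (U z)) -> x <= y ->
  W y - V y - (W x - V x) = \int[mu]_(z in `[x, y]) momentum f f2 z.
Proof.
move=> [h0 h1 h2] [r1 r2 r3 r4] Uc WU xy.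
rewrite /momentum RintegralB//; try exact: Lfun2_segment.
rewrite -(r4 x y xy) (_ : \int[mu]_(z in `[x, y]) f z = \int[mu]_(z in `[x, y]) U z).
  by rewrite (Rintegral_segment_FTC xy Uc WU); lra.
apply: ae_eq_Rintegral => //; apply: measurable_funTS; first exact: Lfun_measurable h0.
exact: continuous_measurable_fun.
Qed.

Lemma Rintegral_segment_le_norm (f : R -> R) x y : mu.-integrable setT (EFin \o f) ->
  `|\int[mu]_(z in `[x, y]) f z| <= \int[mu]_z `|f z|.
Proof.
move=> fi; have fxy : mu.-integrable `[x, y] (EFin \o f) by apply: (@integrableS _ _ _ mu setT).
rewrite (le_trans (le_normr_Rintegral _ fxy))// /Rintegral fine_le//.
- by apply: integrable_fin_num => //; exact: integrable_norm.
- by apply: integrable_fin_num => //; exact: integrable_norm.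
- by apply: ge0_subset_integral => //; apply/measurable_EFinP; apply: measurableT_comp => //;
  have /measurable_EFinP := measurable_int _ fi.
Qed.

(** Increments of [W 0 - V 0] are integrals of the momentum; hence the oscillation of [W 0] is at
    most the [L^1] norm of the momentum plus twice a bound of [V 0]. This is where the finite mass
    comes from. *)
Lemma bfam_initial (b : R) (W U V P Q : R -> R -> R) (f f1 f2 : R -> R) :
  bfam b W U V P Q -> [/\ f \in Lfun mu 2%:E, f1 \in Lfun mu 2%:E & f2 \in Lfun mu 2%:E] ->
  H2_rep f f1 f2 (U 0) (V 0) -> mu.-integrable setT (EFin \o momentum f f2) ->
  [/\ exists2 A : R, 0 <= A & forall x y, `|W 0 y - W 0 x| <= A,
      ({ae mu, forall x, 0 <= momentum f f2 x} ->
        forall x y, x <= y -> W 0 x - V 0 x <= W 0 y - V 0 y) &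
      ({ae mu, forall x, momentum f f2 x <= 0} ->
        forall x y, x <= y -> W 0 y - V 0 y <= W 0 x - V 0 x)].
Proof.
move=> H hf rep mi.
have Uc : continuous (U 0) by move=> x; exact: is_derive_continuous (bfam_U H x (lexx 0)).
have E x y : x <= y -> _ := H2_rep_momentum hf rep Uc (fun z => bfam_W H z (lexx 0)).
have mm : measurable_fun setT (momentum f f2).
  by have := measurable_int _ mi => /measurable_EFinP.
split.
- have [C HC] := bfam_bdd H (lexx 0).
  exists (\int[mu]_z `|momentum f f2 z| + 2 * C).
    rewrite addr_ge0 ?Rintegral_ge0// mulr_ge0//.
    by have [c _ _ _] := HC 0; exact: le_trans c.
  suff le x y : x <= y -> `|W 0 y - W 0 x| <= \int[mu]_z `|momentum f f2 z| + 2 * C.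
    by move=> x y; have [/le//|/ltW/le] := leP x y; rewrite distrC.
  move=> xy; have := Rintegral_segment_le_norm x y mi; rewrite -E//.
  have [_ c1 _ _] := HC x; have [_ c2 _ _] := HC y; move: c1 c2.
  move: (\int[mu]_z `|momentum f f2 z|) => I; rewrite !ler_norml.
  by move=> /andP[? ?] /andP[? ?] /andP[? ?]; apply/andP; split; lra.
- move=> m0 x y xy; rewrite -subr_ge0 E// (_ : \int[mu]_(z in _) _ = \int[mu]_(z in `[x, y]) `|momentum f f2 z|).
    by apply: Rintegral_ge0.
  apply: ae_eq_Rintegral => //; [exact: measurable_funTS|apply: measurable_funTS; exact: measurableT_comp|].
  by apply: ae_mono m0 => z /ger0_norm ->.
- move=> m0 x y xy; rewrite -subr_le0 E// (_ : \int[mu]_(z in _) _ =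
    \int[mu]_(z in `[x, y]) (-1 * `|momentum f f2 z|)).
    rewrite RintegralZl//; first by rewrite mulN1r oppr_le0 Rintegral_ge0.
    by apply: (@integrableS _ _ _ mu setT) => //; exact: integrable_norm.
  have mn : measurable_fun setT (fun z => `|momentum f f2 z|) by exact: measurableT_comp.
  apply: ae_eq_Rintegral => //.
  - exact: measurable_funTS.
  - by apply: measurable_funTS; exact: measurable_funM.
  by apply: ae_mono m0 => z /ler0_norm ->; rewrite mulN1r opprK.
Qed.

End potential.

(** * Decay of the norms *)

Section Lp_norms.
Context {R : realType}.
Notation mu := (@lebesgue_measure R).
Implicit Types (h U W : R -> R) (D : set R).

(** Monotone convergence along [D] cut by [[- n, n]]. The covering segment may depend on [n], which
    suits the right and the left half-line alike. *)
Lemma integral_exhaustion_le D U W (e : R) : measurable D -> continuous U ->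
  (forall x, 0 <= U x) -> (forall x : R, is_derive x 1 W (U x)) ->
  (forall n : nat, exists x y, [/\ x <= y, D `&` `[- n%:R, n%:R] `<=` `[x, y] & W y - W x <= e]) ->
  (\int[mu]_(x in D) (U x)%:E <= e%:E)%E.
Proof.
move=> mD Uc U0 WU hD.
pose F (n : nat) : set R := D `&` `[- n%:R, n%:R]%classic.
have Fnd : {homo F : n m / (n <= m)%N >-> (n <= m)%O}.
  move=> n m nm; apply/subsetPset => x [Dx]; rewrite /= in_itv /= => /andP[h1 h2]; split => //.
  have := nm; rewrite -(ler_nat R) => nm'; rewrite /= in_itv /=.
  by apply/andP; split; [rewrite (le_trans _ h1)// lerN2|exact: le_trans nm'].
have FD : \bigcup_i F i = D.
  rewrite eqEsubset; split => [x [n _ []]//|x Dx]; exists (Num.Def.archi_bound `|x|) => //.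
  by split => //; rewrite /= in_itv /= -ler_norml ltW// archi_boundP.
have mU A : measurable_fun A (EFin \o U).
  by apply/measurable_EFinP; apply: measurable_funTS; exact: continuous_measurable_fun.
have mF n : measurable (F n) by apply: measurableI => //; exact: measurable_itv.
have cv : (\int[mu]_(x in F n) (U x)%:E)%E @[n --> \oo] --> (\int[mu]_(x in \bigcup_i F i) (U x)%:E)%E.
  apply: ge0_nondecreasing_set_cvg_integral => // [n|n x _]; first exact: mU.
  by rewrite lee_fin.
rewrite FD in cv; rewrite -(cvg_lim _ cv)//; apply: lime_le; first by apply/cvg_ex; eexists; exact: cv.
near=> n; have [x [y [xy sub Wxy]]] := hD n.
apply: (@le_trans _ _ (\int[mu]_(x in `[x, y]) (U x)%:E)%E).
  apply: ge0_subset_integral; [exact: mF|exact: measurable_itv|exact: mU| |exact: sub].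
  by move=> z _; rewrite lee_fin.
have i := continuous_integrable_segment x y Uc.
have fin : (\int[mu]_(x in `[x, y]) (U x)%:E)%E \is a fin_num by apply: integrable_fin_num i => //.
by rewrite -(fineK fin) lee_fin
  -/(Rintegral mu _ U) (Rintegral_segment_FTC xy Uc WU).
Unshelve. all: by end_near. Qed.

(* [|h|^r <= e^(r - 1) U] on [D]. *)
Lemma Lp_norm_on_le D h U (e : R) (p : \bar R) : measurable D -> measurable_fun setT h ->
  measurable_fun setT U -> (1 <= p)%E -> 0 < e -> {ae mu, forall x, `|h x| <= U x} ->
  (forall x, D x -> U x <= e) -> (\int[mu]_(x in D) (U x)%:E <= e%:E)%E ->
  (Lp_norm_on p D h <= e%:E)%E.
Proof.
move=> mD mh mU p1 e0 hU Ue UI; rewrite /Lp_norm_on unlock.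
(* For [p = +oo] the norm is an essential supremum and the pointwise bound suffices; the integral
   bound enters for finite [p]. *)
case: p p1 => [r|_|//]; last first.
  case: ifPn => _; last by rewrite lee_fin ltW.
  apply/ess_supP; apply: ae_mono hU => x hx; rewrite /= lee_fin patchE.
  by case: ifPn => [/set_mem/Ue|_]; [exact: le_trans|rewrite normr0 ltW].
rewrite lee_fin => r1; have r0 : 0 < r by exact: lt_le_trans r1.
have rn0 : r != 0 by rewrite gt_eqF.
suff : (\int[mu]_x `|(EFin \o (h \_ D)) x| `^ r <= (e `^ r)%:E)%E.
  move=> h1; have -> : e%:E = ((e `^ r)%:E `^ r^-1)%E.
    by rewrite poweR_EFin -powRrM divff// powRr1// ltW.
  apply: gt0_ler_poweR => //; first by rewrite invr_ge0 ltW.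
    by rewrite in_itv /= leey andbT; apply: integral_ge0 => x _; rewrite lee_fin powR_ge0.
  by rewrite in_itv /= leey andbT lee_fin powR_ge0.
have U0 : {ae mu, forall x, 0 <= U x} by apply: ae_mono hU => x; exact: le_trans.
rewrite (_ : (\int[mu]_x _)%E = (\int[mu]_(x in D) (`|h x| `^ r)%:E)%E); last first.
  rewrite [RHS]integral_mkcond; apply: eq_integral => x _; rewrite /= !patchE.
  by case: ifPn => // _; rewrite normr0 powR0.
have mU' : measurable_fun setT (fun x => `|U x|) by exact: measurableT_comp.
have mUD (c : R) : measurable_fun D (fun x => (c * `|U x|)%:E).
  apply/measurable_EFinP; apply: measurable_funTS; exact: measurable_funM.
apply: (@le_trans _ _ (\int[mu]_(x in D) (e `^ (r - 1) * `|U x|)%:E)%E).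
  apply: ae_ge0_le_integral => //.
  - apply/measurable_EFinP; apply: measurable_funTS.
    by apply: (measurableT_comp (measurable_powR r)); exact: measurableT_comp.
  - by move=> x _; rewrite lee_fin mulr_ge0// powR_ge0.
  - exact: mUD.
  - apply: ae_mono hU => x hx Dx; rewrite lee_fin.
    have [h0|h0] := eqVneq (h x) 0.
      by rewrite h0 normr0 powR0// mulr_ge0// powR_ge0.
    have he : `|h x| <= e := le_trans hx (Ue x Dx).
    rewrite -[leLHS](_ : `|h x| `^ (r - 1) * `|h x| = _); last first.
      rewrite -[X in _ * X]powRr1// -powRD ?subrK//.
      by rewrite normr_eq0 h0 implybT.
    rewrite ler_pM ?powR_ge0//; last by rewrite (le_trans hx)// ler_norm.
    by rewrite ge0_ler_powR// ?nnegrE ?subr_ge0// ltW.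
under eq_integral do rewrite EFinM.
rewrite ge0_integralZl_EFin// ?powR_ge0//; last first.
- by apply/measurable_EFinP; apply: measurable_funTS; exact: measurableT_comp.
rewrite (_ : (\int[mu]_(x in D) (`|U x|)%:E)%E = (\int[mu]_(x in D) (U x)%:E)%E); last first.
  apply: ae_eq_integral => //.
  - by apply/measurable_EFinP; apply: measurable_funTS; exact: measurableT_comp.
  - by apply/measurable_EFinP; exact: measurable_funTS.
  - by apply: ae_mono U0 => x /ger0_norm + _ => /= ->.
apply: le_trans (lee_wpmul2l _ UI) _; first by rewrite lee_fin powR_ge0.
rewrite -EFinM lee_fin -[X in _ * X](@powRr1 _ e) ?(ltW e0)// -powRD ?subrK//.
by rewrite (gt_eqF e0) implybT.
Qed.

Lemma Lp_norm_on_ge0 (p : \bar R) D h : (0 <= Lp_norm_on p D h)%E.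
Proof. exact: Lnorm_ge0. Qed.

End Lp_norms.

Section rays.
Context {R : realType}.
Notation mu := (@lebesgue_measure R).

Lemma W1p_norm_on_le (D : set R) (f f1 U W : R -> R) (e : R) (p : \bar R) :
  measurable D -> measurable_fun setT f -> measurable_fun setT f1 -> (1 <= p)%E -> 0 < e ->
  continuous U -> (forall x, 0 <= U x) -> (forall x : R, is_derive x 1 W (U x)) ->
  {ae mu, forall x, `|f x| <= U x} -> {ae mu, forall x, `|f1 x| <= U x} ->
  (forall x, D x -> U x <= e) ->
  (forall n : nat, exists x y, [/\ x <= y, D `&` `[- n%:R, n%:R] `<=` `[x, y] & W y - W x <= e]) ->
  (W1p_norm_on p D f f1 <= (e + e)%:E)%E.
Proof.
move=> mD mf mf1 p1 e0 Uc U0 WU fU f1U De hD.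
have mU : measurable_fun setT U by exact: continuous_measurable_fun.
have UI := integral_exhaustion_le mD Uc U0 WU hD.
by rewrite /W1p_norm_on EFinD leeD//; apply: (Lp_norm_on_le mD _ mU p1 e0 _ De UI).
Qed.

Lemma W1p_norm_on_cvg0 (u ux : R -> R -> R) (D : R -> set R) (p : \bar R) :
  (forall e : R, 0 < e -> exists t0 : R, forall t, t0 <= t ->
    (W1p_norm_on p (D t) (u t) (ux t) <= (e + e)%:E)%E) ->
  W1p_norm_on p (D t) (u t) (ux t) @[t --> +oo] --> 0%E.
Proof.
move=> h.
have N0 t : (0 <= W1p_norm_on p (D t) (u t) (ux t))%E by rewrite adde_ge0// Lp_norm_on_ge0.
have fin t (e : R) : (W1p_norm_on p (D t) (u t) (ux t) <= e%:E)%E ->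
    W1p_norm_on p (D t) (u t) (ux t) \is a fin_num.
  by move=> le; rewrite ge0_fin_numE// (le_lt_trans le)// ltry.
apply/fine_cvgP; split.
  have [t0 Ht0] := h 1 ltr01; near=> t; apply: (fin t (1 + 1)); apply: Ht0.
  by near: t; apply: nbhs_pinfty_ge; exact: num_real.
apply/cvgrPdist_le => e e0; have [t0 Ht0] := h (e / 2) (divr_gt0 e0 (ltr0Sn _ _)).
near=> t; have := Ht0 t; rewrite -splitr => le.
have {}le : (W1p_norm_on p (D t) (u t) (ux t) <= e%:E)%E.
  by apply: le; near: t; apply: nbhs_pinfty_ge; exact: num_real.
rewrite sub0r normrN /= ger0_norm ?fine_ge0//.
by rewrite -lee_fin fineK// (fin t e).
Unshelve. all: by end_near. Qed.

(** Stated for an arbitrary [bfam], so that it also applies to the reflected solution, which covers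
    the left half-line. *)
Lemma bfam_right_ray (b : R) (W U V P Q : R -> R -> R) (A : R) : 0 < b < 3 ->
  bfam b W U V P Q -> 0 <= A -> (forall x y, W 0 y - W 0 x <= A) ->
  (forall x y, x <= y -> W 0 x - V 0 x <= W 0 y - V 0 y) ->
  forall e : R, 0 < e -> exists2 t0 : R, 0 <= t0 & forall t, t0 <= t ->
    [/\ forall x, `|V t x| <= U t x, forall x, (4 * A + 1) * t <= x -> U t x <= e &
        forall y, W t y - W t ((4 * A + 1) * t) <= e].
Proof.
move=> hb H A0 WA M0 e e0; have [t0 t00 Ht0] := bfam_spreading hb H M0 A0 WA e0.
exists t0 => // t tt; split=> [x|x xt|y].
- by apply: (bfam_V_le_U hb H M0); exact: le_trans tt.
- by have [] := Ht0 t x tt xt.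
- by have [_] := Ht0 t _ tt (lexx _); exact.
Qed.

End rays.

Theorem theorem1p5 (R : realType) (b : R) (u ux uxx : R -> R -> R)
    (hb : 0 < b < 3)
    (hu : continuous_H2_path u ux uxx)
    (hsol : b_family_solution b u ux)
    (hm0 : (@lebesgue_measure R).-integrable setT
             (EFin \o momentum (u 0) (uxx 0))) :
  ({ae @lebesgue_measure R, forall x, 0 <= momentum (u 0) (uxx 0) x} ->
    exists sigma : R, 0 < sigma /\
      forall p : \bar R, (1 <= p)%E ->
        W1p_norm_on p `]sigma * t, +oo[ (u t) (ux t) @[t --> +oo] --> 0%E)
  /\
  ({ae @lebesgue_measure R, forall x, momentum (u 0) (uxx 0) x <= 0} ->
    exists sigma : R, 0 < sigma /\
      forall p : \bar R, (1 <= p)%E ->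
        W1p_norm_on p `]-oo, - (sigma * t)[ (u t) (ux t) @[t --> +oo] --> 0%E).
Proof.
have [U [V [P [Q [H rep hP]]]]] := H2_path_regular hb hu.
have h2 t : 0 <= t -> [/\ u t \in Lfun (@lebesgue_measure R) 2%:E,
    ux t \in Lfun (@lebesgue_measure R) 2%:E & uxx t \in Lfun (@lebesgue_measure R) 2%:E].
  by move=> t0; have [] := hu.1 t t0.
have hu2 t : 0 <= t -> u t \in Lfun (@lebesgue_measure R) 2%:E /\
    ux t \in Lfun (@lebesgue_measure R) 2%:E.
  by move=> t0; have [] := h2 t t0.
have [W HW] := bfam_exists hb H (evolution hb H hu2 rep hP hsol).
have [[A A0 HA] mono anti] := bfam_initial HW (h2 0 (lexx 0)) (rep 0 (lexx 0)) hm0.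
have s0 : 0 < 4 * A + 1 by rewrite ltr_wpDl// mulr_ge0.
have mu_ t : 0 <= t -> measurable_fun setT (u t) by move=> /h2[/Lfun_measurable].
have mux t : 0 <= t -> measurable_fun setT (ux t) by move=> /h2[_ /Lfun_measurable].
have Uc t : 0 <= t -> continuous (U t).
  by move=> t0 x; exact: is_derive_continuous (bfam_U H x t0).
(* [A] depends on the initial data alone, so [sigma] is fixed before [p] and [e]; only the time [t0]
   depends on [e]. *)
split=> m0; exists (4 * A + 1); split=> // p p1; apply: W1p_norm_on_cvg0 => e e0.
- have WA x y : W 0 y - W 0 x <= A by exact: le_trans (ler_norm _) (HA x y).
  have [t0 t00 Ht0] := bfam_right_ray hb HW A0 WA (mono m0) e0.
  exists t0 => t tt; have t_ge0 := le_trans t00 tt; have [VU Ue We] := Ht0 t tt.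
  have U0 x : 0 <= U t x := le_trans (normr_ge0 _) (VU x).
  have [r1 r2 _ _] := rep t t_ge0.
  apply: (@W1p_norm_on_le _ _ _ _ (U t) (W t)) => //; try by [exact: mu_|exact: mux|exact: Uc].
  + by move=> x; exact: (bfam_W HW).
  + by apply: ae_mono r1 => x ->; rewrite ger0_norm.
  + by apply: ae_mono r2 => x ->.
  + by move=> x; rewrite /= in_itv /= andbT => /ltW; exact: Ue.
  (* The maximum keeps the ends in order for small [n], when [[- n, n]] does not reach the ray. *)
  + move=> n; exists ((4 * A + 1) * t), (Num.max ((4 * A + 1) * t) n%:R).
    split; [by rewrite le_max lexx| |exact: We].
    move=> x []; rewrite /= !in_itv /= andbT => h1 /andP[_ h2'].
    by rewrite ltW// le_max h2' orbT.
- have WA x y : W 0 (- y) - W 0 (- x) <= A by exact: le_trans (ler_norm _) (HA _ _).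
  have M0 x y : x <= y -> W 0 (- x) - V 0 (- x) <= W 0 (- y) - V 0 (- y).
    by move=> xy; apply: anti => //; rewrite lerN2.
  (* In the original variables the reflected bounds say that [- U t] majorizes the absolute values
     of [u t] and [ux t] almost everywhere; its antiderivative is [- W t]. *)
  have [t0 t00 Ht0] := bfam_right_ray hb (bfam_reflect HW) A0 WA M0 e0.
  exists t0 => t tt; have t_ge0 := le_trans t00 tt; have [VU Ue We] := Ht0 t tt.
  have {}VU x : `|V t x| <= - U t x by have := VU (- x); rewrite opprK.
  have U0 x : 0 <= - U t x := le_trans (normr_ge0 _) (VU x).
  have [r1 r2 _ _] := rep t t_ge0.
  apply: (@W1p_norm_on_le _ _ _ _ (fun x => - U t x) (fun x => - W t x)) => //; try by [exact: mu_|exact: mux].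
  + by move=> x; apply: cvgN; exact: Uc.
  + by move=> x; apply: is_deriveN; exact: (bfam_W HW).
  + by apply: ae_mono r1 => x ->; rewrite ler0_norm// -oppr_ge0.
  + by apply: ae_mono r2 => x ->.
  + move=> x; rewrite /= in_itv /= => xt; have := Ue (- x); rewrite opprK; apply.
    by rewrite lerNr ltW.
  + move=> n; exists (Num.min (- ((4 * A + 1) * t)) (- n%:R)), (- ((4 * A + 1) * t)).
    split; first by rewrite ge_min lexx.
    * move=> x []; rewrite /= !in_itv /= => h1 /andP[h2' _].
      by rewrite (ltW h1) andbT ge_min h2' orbT.
    * rewrite opprK addrC; have := We (- Num.min (- ((4 * A + 1) * t)) (- n%:R)).
      by rewrite opprK.
Qed.
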